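(* Let $(D,\Delta_D)$, $A,B$, $A_1,A_2,A_2'$, $B_1,B_1',B_2$ and $\langle-,-\rangle$ satisfy assumptions (i)--(vi) listed in the context, and let $R_1,R_2$ be the elements defined there. Consider the topological bialgebra structures $\Delta:D\to D^{\otimes_<2}$ and $\tilde\Delta:D\to D^{\otimes_>2}$ defined by $$\Delta(x):=R_2\Delta_D(x)R_2^{-1},\qquad \tilde\Delta(x):=R_1^{-1}\Delta_D(x)^{2,1}R_1 .$$ Then $\Delta$ and $\tilde\Delta$ actually take their values in $D^{\otimes2}$, and are equal as maps $D\to D^{\otimes 2}$.
   Context: Completions. For a $\mathbb Z$-graded vector space $V=\oplus_{n\in\mathbb Z}V[n]$, let $V^{\bar\otimes k}:=\prod_{n_1,\dots,n_k}V[n_1]\otimes\cdots\otimes V[n_k]$, and let $V^{\otimes_>k}\subset V^{\bar\otimes k}$ be the set of all combinations $\sum v_1\otimes\cdots\otimes v_k$ (homogeneous $v_i$) for which there exist a constant $c_1$ and functions $c_2(n_1),\dots,c_k(n_1,\dots,n_{k-1})$ with $\deg v_1\ge c_1$, $\deg v_2\ge c_2(\deg v_1)$, ..., $\deg v_k\ge c_k(\deg v_1,\dots,\deg v_{k-1})$. $V^{\otimes_<k}$ is the image of $V^{\otimes_>k}$ under $v_1\otimes\cdots\otimes v_k\mapsto v_k\otimes\cdots\otimes v_1$. $(V^{\otimes_<k})_{fs}$ is the direct sum over $n\in\mathbb Z$ of the parts of total degree $n$; similarly $(V^{\otimes_>k})_{fs}$. $X\otimes_<Y$, $X\otimes_>Y$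 are defined similarly for graded $X,Y$. $x^{2,1}$ denotes the flip. Assumptions (Sweedler notation refers to $\Delta_D$; $q\in\mathbb C^\times$). (i) $D$ is a $\mathbb Z$-graded topological bialgebra: a $\mathbb Z$-graded algebra with counit $\varepsilon_D$ and a degree $0$ algebra morphism $\Delta_D:D\to(D^{\otimes_<2})_{fs}$, coassociative as maps $D\to(D^{\otimes_<3})_{fs}$. (ii) $D\supset A,B\supset\mathbb C[\mathbb Z^r]$, where $A,B$ are $\mathbb Z$-graded topological subbialgebras and $\mathbb C[\mathbb Z^r]\subset D[0]$ has its standard bialgebra structure; the product induces a linear isomorphism $A\otimes_{\mathbb C[\mathbb Z^r]}B\to D$; there is a nondegenerate degree $0$ bialgebra pairing $\langle-,-\rangle:A\otimes B^{cop}\to\mathbb C$, i.e. $\langle aa',b\rangle=\langle a\otimes a',b^{(2)}\otimes b^{(1)}\rangle$, $\langle a,bb'\rangle=\langle a^{(1)}\otimes a^{(2)},b\otimes b'\rangle$, $\langle a,1_D\rangle=\varepsilon_D(a)$, $\langle 1_D,b\rangle=\varepsilon_D(b)$, satisfying $\langle a^{(1)},b^{(1)}\rangle b^{(2)}a^{(2)}=a^{(1)}b^{(1)}\langle a^{(2)},b^{(2)}\rangle$ for all $a,a'\in A$, $b,b'\in B$ (all sums are finite). (iii) $A\supset A_1,A_2$ are $\mathbb Z$-graded subalgebras, with nontrivial components of $A_1$ (resp. $A_2$) in degrees $\ge0$ (resp. $\le0$), and the product $A_1\otimes A_2\to A$ is a linear isomorphism; $B\supset B_1,B_2$ are $\mathbb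 Z$-graded subalgebras, with nontrivial components of $B_1$ (resp. $B_2$) in degrees $\ge0$ (resp. $\le0$), and the product $B_2\otimes B_1\to B$ is a linear isomorphism. (iv) $\Delta_D(A_1)\subset A\otimes_<A_1$, $\Delta_D(A_2)\subset A_2\otimes_<A$, $\Delta_D(B_1)\subset B\otimes_<B_1$, $\Delta_D(B_2)\subset B_2\otimes_<B$. Equivalently, $\langle a_1a_2,b_2b_1\rangle=\langle a_1,b_2\rangle_1\langle a_2,b_1\rangle_2$ for $a_i\in A_i,b_i\in B_i$, where $\langle-,-\rangle_i$ is the restriction of $\langle-,-\rangle$ to $A_i\otimes B_{3-i}$. (v) $A_2[0]=B_1[0]=\mathbb C[\mathbb Z^r]$, $A_1[0]=B_2[0]=\mathbb C$; $A_2,B_1$ contain graded subalgebras $A_2',B_1'$ such that the product induces linear isomorphisms $A_2'\otimes\mathbb C[\mathbb Z^r]\simeq A_2$, $B_1'\otimes\mathbb C[\mathbb Z^r]\simeq B_1$; the homogeneous components of $A_1,A_2',B_1',B_2$ are finite dimensional. (vi) The restriction $\langle-,-\rangle_0$ of the pairing to $A_2[0]\otimes B_1[0]$ is given by $\langle\delta_i,\delta_j\rangle_0=q^{\alpha_{ij}}$ with $(\alpha_{ij})$ a nondegenerate matrix ($\delta_i$ the $i$th basis vector of $\mathbb Z^r$); with $\langle-,-\rangle_2'$ the restriction of $\langle-,-\rangle_2$ to $A_2'\otimes B_1'$, one has $\langle a_2'a_0,b_1'b_0\rangle_2=\langle a_2',b_1'\rangle_2'\langle a_0,b_0\rangle_0$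 for $a_2'\in A_2'$, $b_1'\in B_1'$, $a_0\in A_2[0]$, $b_0\in B_1[0]$; the pairings $\langle-,-\rangle_1$ and $\langle-,-\rangle_2'$ are nondegenerate on each pair of homogeneous components of opposite degrees. Elements. $R_1\in A_1\otimes_>B_2$ is the tensor (canonical element) of $\langle-,-\rangle_1$; $R_2'\in A_2'\otimes_<B_1'$ is the tensor of $\langle-,-\rangle_2'$; $R_0=q^{r_0}$, with $r_0$ the inverse of the matrix $(\alpha_{ij})$, is the tensor of $\langle-,-\rangle_0$; $R_2:=R_2'R_0$, the tensor of $\langle-,-\rangle_2$, regarded as an element of (a suitable extension, accommodating $R_0$, of) $A_2\otimes_<B_1$. $R_1$ and $R_2$ are invertible. *)

(* Defs.v *)
From HB Require Import structures.
From mathcomp Require Import all_boot all_order all_algebra generic_quotient.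
From mathcomp Require Import complex.
From mathcomp Require Import all_classical all_reals all_analysis.

Set Implicit Arguments.
Unset Strict Implicit.
Unset Printing Implicit Defensive.

Import Order.TTheory GRing.Theory Num.Theory.

Local Open Scope classical_set_scope.
Local Open Scope ring_scope.
Local Open Scope quotient_scope.

(* Tensor products of arbitrary vector spaces. An element is a formal sum     *)
(* \sum_i v_i (x) w_i, i.e. a list of pairs, and two formal sums are          *)
(* identified when every bilinear map takes the same value on them.           *)

Definition bilinear_map (F : fieldType) (V W U : lmodType F)
    (f : V -> W -> U) : Prop :=
  (forall v, linear (f v)) /\ (forall w, linear (f ^~ w)).

Section Tensor.
Variables (F : fieldType) (V W : lmodType F).
Implicit Types s t : seq (V * W).

Definition tens_eval (U : lmodType F) (f : V -> W -> U) s : U :=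
  \sum_(p <- s) f p.1 p.2.

Definition tens_equiv s t : bool :=
  `[< forall (U : lmodType F) (f : V -> W -> U),
        bilinear_map f -> tens_eval f s = tens_eval f t >].

Lemma tens_equivP s t :
  reflect (forall (U : lmodType F) (f : V -> W -> U),
             bilinear_map f -> tens_eval f s = tens_eval f t)
          (tens_equiv s t).
Proof. exact: asboolP. Qed.

Lemma tens_equiv_refl : reflexive tens_equiv.
Proof. by move=> s; apply/tens_equivP. Qed.

Lemma tens_equiv_sym : symmetric tens_equiv.
Proof.
by move=> s t; apply/tens_equivP/tens_equivP => st U f fP; rewrite st.
Qed.

Lemma tens_equiv_trans : transitive tens_equiv.
Proof.
move=> t s u /tens_equivP st /tens_equivP tu; apply/tens_equivP => U f fP.
by rewrite st ?tu.
Qed.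

Canonical tens_equiv_equiv :=
  EquivRel tens_equiv tens_equiv_refl tens_equiv_sym tens_equiv_trans.

Definition tensor := {eq_quot tens_equiv}.
HB.instance Definition _ := Choice.on tensor.
HB.instance Definition _ := EqQuotient.on tensor.

Definition tens (v : V) (w : W) : tensor := \pi_tensor [:: (v, w)].

(* The linear map induced by a bilinear f; f is meant to be bilinear.         *)
Definition tlift (U : lmodType F) (f : V -> W -> U) (x : tensor) : U :=
  tens_eval f (repr x).

Definition tens_zero : tensor := \pi_tensor [::].
Definition tens_add (x y : tensor) : tensor := \pi_tensor (repr x ++ repr y).
Definition tens_scale (c : F) (x : tensor) : tensor :=
  \pi_tensor [seq (c *: p.1, p.2) | p <- repr x].
Definition tens_opp (x : tensor) : tensor := tens_scale (- 1) x.

Lemma tlift_pi (U : lmodType F) (f : V -> W -> U) s :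
  bilinear_map f -> tlift f (\pi_tensor s) = tens_eval f s.
Proof.
by move=> fP; apply: (tens_equivP _ _ _) => //; apply/eqmodP; rewrite reprK.
Qed.

Lemma tensor_eqP (x y : tensor) :
  (forall (U : lmodType F) (f : V -> W -> U),
     bilinear_map f -> tlift f x = tlift f y) -> x = y.
Proof.
by move=> xy; rewrite -(reprK x) -(reprK y); apply/eqmodP/tens_equivP.
Qed.

Lemma tens_eval_scale (U : lmodType F) (f : V -> W -> U) c s :
  bilinear_map f ->
  tens_eval f [seq (c *: p.1, p.2) | p <- s] = c *: tens_eval f s.
Proof.
move=> [_ fl]; rewrite /tens_eval big_map scaler_sumr; apply: eq_bigr => p _ /=.
by have /= := scalable_linear (fl p.2); apply.
Qed.

Lemma tlift_add0 (U : lmodType F) (f : V -> W -> U) x y :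
  bilinear_map f -> tlift f (tens_add x y) = tlift f x + tlift f y.
Proof. by move=> fP; rewrite tlift_pi // /tens_eval big_cat. Qed.

Lemma tlift_scale0 (U : lmodType F) (f : V -> W -> U) c x :
  bilinear_map f -> tlift f (tens_scale c x) = c *: tlift f x.
Proof. by move=> fP; rewrite tlift_pi // tens_eval_scale. Qed.

Lemma tlift_zero0 (U : lmodType F) (f : V -> W -> U) :
  bilinear_map f -> tlift f tens_zero = 0.
Proof. by move=> fP; rewrite tlift_pi // /tens_eval big_nil. Qed.

Lemma tens_addA : associative tens_add.
Proof.
by move=> x y z; apply: tensor_eqP => U f fP; rewrite !tlift_add0 // addrA.
Qed.

Lemma tens_addC : commutative tens_add.
Proof.
by move=> x y; apply: tensor_eqP => U f fP; rewrite !tlift_add0 // addrC.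
Qed.

Lemma tens_add0 : left_id tens_zero tens_add.
Proof.
move=> x; apply: tensor_eqP => U f fP.
by rewrite tlift_add0 // tlift_zero0 // add0r.
Qed.

Lemma tens_addN : left_inverse tens_zero tens_opp tens_add.
Proof.
move=> x; apply: tensor_eqP => U f fP.
by rewrite tlift_add0 // tlift_zero0 // tlift_scale0 // scaleN1r addNr.
Qed.

HB.instance Definition _ :=
  GRing.isZmodule.Build tensor tens_addA tens_addC tens_add0 tens_addN.

Lemma tens_scaleA a b x : tens_scale a (tens_scale b x) = tens_scale (a * b) x.
Proof.
by apply: tensor_eqP => U f fP; rewrite !tlift_scale0 // scalerA.
Qed.

Lemma tens_scale1 : left_id 1 tens_scale.
Proof.
by move=> x; apply: tensor_eqP => U f fP; rewrite tlift_scale0 // scale1r.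
Qed.

Lemma tens_scaleDr : right_distributive tens_scale +%R.
Proof.
move=> c x y; apply: tensor_eqP => U f fP.
by rewrite tlift_scale0 // !tlift_add0 // !tlift_scale0 // scalerDr.
Qed.

Lemma tens_scaleDl x : {morph tens_scale^~ x : a b / a + b}.
Proof.
move=> a b; apply: tensor_eqP => U f fP.
by rewrite tlift_add0 // !tlift_scale0 // scalerDl.
Qed.

HB.instance Definition _ :=
  GRing.Zmodule_isLmodule.Build F tensor
    tens_scaleA tens_scale1 tens_scaleDr tens_scaleDl.

Lemma tens_bilinear : bilinear_map tens.
Proof.
split=> [v|w] c x y; apply: tensor_eqP => U f fP.
- rewrite tlift_add0 // tlift_scale0 // !tlift_pi // /tens_eval !big_seq1 /=.
  by case: fP => fr _; exact: fr.
- rewrite tlift_add0 // tlift_scale0 // !tlift_pi // /tens_eval !big_seq1 /=.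
  by case: fP => _ fl; exact: fl.
Qed.

Lemma tlift_linear (U : lmodType F) (f : V -> W -> U) :
  bilinear_map f -> linear (tlift f).
Proof. by move=> fP c x y; rewrite tlift_add0 // tlift_scale0. Qed.

Lemma tlift_tens (U : lmodType F) (f : V -> W -> U) v w :
  bilinear_map f -> tlift f (tens v w) = f v w.
Proof. by move=> fP; rewrite tlift_pi // /tens_eval big_seq1. Qed.

Lemma tensor_sum (x : tensor) :
  exists s : seq (V * W), x = \sum_(p <- s) tens p.1 p.2.
Proof.
exists (repr x); apply: tensor_eqP => U f fP.
have fN : {morph tlift f : a b / a + b} by move=> a b; rewrite tlift_add0.
rewrite (big_morph _ fN (tlift_zero0 fP)) /tlift /tens_eval.
by apply: eq_bigr => p _; rewrite -[RHS]/(tlift f _) tlift_tens.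
Qed.

End Tensor.

Arguments tens {F V W} v w.

Section Graded.
Variables (F : fieldType) (D : algType F).

(* S, T are meant to be subspaces: this is then the image of S (x) T in       *)
(* D (x) D, to which S (x) T is isomorphic since F is a field.                *)
Definition tspan (S T : set D) : set (tensor D D) :=
  [set t | exists s : seq (D * D),
     (forall p, p \in s -> S p.1 /\ T p.2) /\ t = \sum_(p <- s) tens p.1 p.2].

Definition tmulr : tensor D D -> D := tlift (fun x y => x * y).
Definition tflip : tensor D D -> tensor D D := tlift (fun x y => tens y x).
Definition tmul (X Y : tensor D D) : tensor D D :=
  tlift (fun a b => tlift (fun c d => tens (a * c) (b * d)) Y) X.
Definition tassoc : tensor (tensor D D) D -> tensor D (tensor D D) :=
  tlift (fun t z => tlift (fun x y => tens x (tens y z)) t).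

Definition finite_dim (S : set D) : Prop :=
  exists s : seq D, forall x, S x ->
    exists c : nat -> F, x = \sum_(i < size s) c i *: s`_i.

(* The product S (x) T -> U is a linear isomorphism.                          *)
Definition product_iso (S T U : set D) : Prop :=
  tmulr @` tspan S T = U /\
  forall t, tspan S T t -> tmulr t = 0 -> t = 0.

Section Grading.
Variable G : int -> set D.

Definition graded_subspace (S : set D) : Prop :=
  GRing.submod_closed [in S] /\
  forall x, S x -> exists (s : seq int) (f : int -> D),
    (forall n, (S `&` G n) (f n)) /\ x = \sum_(n <- s) f n.

Definition graded_subalgebra (S : set D) : Prop :=
  GRing.subalg_closed [in S] /\ graded_subspace S.

Definition graded_algebra : Prop :=
  [/\ forall n, GRing.submod_closed [in G n],
      graded_subspace setT,
      forall (s : seq int) (f : int -> D), uniq s -> (forall n, G n (f n)) ->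
        \sum_(n <- s) f n = 0 -> forall n, n \in s -> f n = 0,
      G 0 1
    & forall m n x y, G m x -> G n y -> G (m + n) (x * y)].

(* A family X represents \sum_(n1, n2) X n1 n2 in the completed square of D,  *)
(* with X n1 n2 in D[n1] (x) D[n2].                                           *)
Definition ctens := int -> int -> tensor D D.

Definition cbar (S T : set D) : set ctens :=
  [set X | forall n1 n2, tspan (S `&` G n1) (T `&` G n2) (X n1 n2)].

Definition cgt (S T : set D) : set ctens :=
  [set X | cbar S T X /\ exists (c1 : int) (c2 : int -> int),
     forall n1 n2, X n1 n2 != 0 -> c1 <= n1 /\ c2 n1 <= n2].

Definition clt (S T : set D) : set ctens :=
  [set X | cbar S T X /\ exists (c1 : int) (c2 : int -> int),
     forall n1 n2, X n1 n2 != 0 -> c1 <= n2 /\ c2 n2 <= n1].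

Definition cfs : set ctens :=
  [set X | exists s : seq int, forall n1 n2, X n1 n2 != 0 -> n1 + n2 \in s].

(* The algebraic tensor square D (x) D inside its completions: the families   *)
(* with finitely many nonzero components.                                     *)
Definition calg : set ctens :=
  [set X | cbar setT setT X /\ exists s : seq (int * int),
     forall n1 n2, X n1 n2 != 0 -> (n1, n2) \in s].

Definition chom (m n : int) (t : tensor D D) : ctens :=
  fun n1 n2 => if (n1 == m) && (n2 == n) then t else 0.

Definition cone : ctens := chom 0 0 (tens 1 1).

(* On families in a common completion clt or cgt only finitely many terms     *)
(* of this sum are nonzero.                                                   *)
Definition cmul (X Y : ctens) : ctens := fun n1 n2 =>
  \sum_(m \in [set: int * int]) tmul (X m.1 m.2) (Y (n1 - m.1) (n2 - m.2)).

Definition cflip (X : ctens) : ctens := fun n1 n2 => tflip (X n2 n1).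

Definition cinverse (X Y : ctens) : Prop := cmul X Y = cone /\ cmul Y X = cone.

(* \sum f x1 x2, for X = \sum x1 (x) x2 and f bilinear, when finite.          *)
Definition csum (U : lmodType F) (f : D -> D -> U) (X : ctens) : U :=
  \sum_(n \in [set: int * int]) tlift f (X n.1 n.2).

(* \sum f x1 x2 y1 y2, for X = \sum x1 (x) x2 and Y = \sum y1 (x) y2.         *)
Definition csum2 (U : lmodType F) (f : D -> D -> D -> D -> U)
    (X Y : ctens) : U :=
  \sum_(n \in [set: (int * int) * (int * int)])
    tlift (fun x1 x2 => tlift (f x1 x2) (Y n.2.1 n.2.2)) (X n.1.1 n.1.2).

(* Since Delta has degree 0, the (n1, n2, n3) component of                    *)
(* (Delta (x) id) (Delta x) only involves the components of degrees (n1, n2)  *)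
(* of Delta and (n1 + n2, n3) of Delta x, and similarly for id (x) Delta and  *)
(* for the counit: all the identities below are finite.                       *)
Record topological_bialgebra (Delta : D -> ctens) (eps : D -> F) : Prop := {
  tb_graded : graded_algebra;
  tb_linear : forall n1 n2, linear (fun x => Delta x n1 n2);
  tb_clt : forall x, clt setT setT (Delta x);
  tb_cfs : forall x, cfs (Delta x);
  tb_degree : forall n x, G n x ->
    forall n1 n2, Delta x n1 n2 != 0 -> n1 + n2 = n;
  tb_one : Delta 1 = cone;
  tb_mul : forall x y, Delta (x * y) = cmul (Delta x) (Delta y);
  tb_coassoc : forall x n1 n2 n3,
    tassoc (tlift (fun y z => tens (Delta y n1 n2) z) (Delta x (n1 + n2) n3)) =
    tlift (fun y z => tens y (Delta z n2 n3)) (Delta x n1 (n2 + n3));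
  tb_eps_scalar : scalar eps;
  tb_eps_monoid : monoid_morphism eps;
  tb_eps_degree : forall n x, G n x -> n != 0 -> eps x = 0;
  tb_counitl : forall n x, G n x ->
    tlift (fun y z => eps y *: z) (Delta x 0 n) = x;
  tb_counitr : forall n x, G n x ->
    tlift (fun y z => eps z *: y) (Delta x n 0) = x }.

Definition subbialgebra (Delta : D -> ctens) (S : set D) : Prop :=
  graded_subalgebra S /\ forall x, S x -> clt S S (Delta x).

Section GroupAlgebra.
Variables (r : nat) (K : 'rV[int]_r -> D).

Definition group_algebra : set D :=
  [set x | exists s : seq (F * 'rV[int]_r), x = \sum_(p <- s) p.1 *: K p.2].

(* u |-> K u extends to an embedding in D[0] of the group algebra F[Z^r],     *)
(* with the elements of Z^r group-like.                                       *)
Record group_algebra_embedding (Delta : D -> ctens) (eps : D -> F) : Prop := {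
  ga_degree : forall u, G 0 (K u);
  ga_one : K 0 = 1;
  ga_mul : forall u v, K (u + v) = K u * K v;
  ga_free : forall (s : seq 'rV[int]_r) (c : 'rV[int]_r -> F), uniq s ->
    \sum_(u <- s) c u *: K u = 0 -> forall u, u \in s -> c u = 0;
  ga_Delta : forall u, Delta (K u) = chom 0 0 (tens (K u) (K u));
  ga_eps : forall u, eps (K u) = 1 }.

(* The product A (x)_(F[Z^r]) B -> D is a linear isomorphism.                 *)
Definition balanced_product_iso (A B : set D) : Prop :=
  tmulr @` tspan A B = setT /\
  forall t, tspan A B t -> tmulr t = 0 ->
    exists s : seq (D * 'rV[int]_r * D),
      (forall z, z \in s -> A z.1.1 /\ B z.2) /\
      t = \sum_(z <- s) (tens (z.1.1 * K z.1.2) z.2 - tens z.1.1 (K z.1.2 * z.2)).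

End GroupAlgebra.

Definition nondegenerate (p : D -> D -> F) (S T : set D) : Prop :=
  (forall x, S x -> (forall y, T y -> p x y = 0) -> x = 0) /\
  (forall y, T y -> (forall x, S x -> p x y = 0) -> y = 0).

Definition graded_nondegenerate (p : D -> D -> F) (S T : set D) : Prop :=
  forall n, nondegenerate p (S `&` G n) (T `&` G (- n)).

(* The pairing of A and B is given by some bilinear form p on D, of which     *)
(* only the values on A and B matter.                                         *)
Record bialgebra_pairing (Delta : D -> ctens) (eps : D -> F) (A B : set D)
    (p : D -> D -> F) : Prop := {
  bp_bilinear : bilinear_map (p : D -> D -> F^o);
  bp_nondegenerate : nondegenerate p A B;
  bp_degree : forall m n a b, (A `&` G m) a -> (B `&` G n) b ->
    m + n != 0 -> p a b = 0;
  bp_mull : forall a a' b, A a -> A a' -> B b ->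
    p (a * a') b = csum (fun b1 b2 => p a b2 * p a' b1 : F^o) (Delta b);
  bp_mulr : forall a b b', A a -> B b -> B b' ->
    p a (b * b') = csum (fun a1 a2 => p a1 b * p a2 b' : F^o) (Delta a);
  bp_oner : forall a, A a -> p a 1 = eps a;
  bp_onel : forall b, B b -> p 1 b = eps b;
  bp_exchange : forall a b, A a -> B b ->
    csum2 (fun a1 a2 b1 b2 => p a1 b1 *: (b2 * a2)) (Delta a) (Delta b) =
    csum2 (fun a1 a2 b1 b2 => p a2 b2 *: (a1 * b1)) (Delta a) (Delta b) }.

(* X is the canonical element of the pairing of S and T.                      *)
Definition pairing_tensor (p : D -> D -> F) (S T : set D) (X : ctens) : Prop :=
  [/\ forall n1 n2, n1 + n2 != 0 -> X n1 n2 = 0,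
      forall n y, (T `&` G (- n)) y ->
        tlift (fun x z => p x y *: z) (X n (- n)) = y
    & forall n x, (S `&` G n) x ->
        tlift (fun z y => p x y *: z) (X n (- n)) = x].

End Grading.
End Graded.

Section ComplexPowers.
Variable R : realType.

Definition cexp (z : R[i]) : R[i] :=
  Complex (expR (complex.Re z) * cos (complex.Im z))
          (expR (complex.Re z) * sin (complex.Im z)).

(* q ^ z for the determination lq of the logarithm of q.                      *)
Definition qpow (lq z : R[i]) : R[i] := cexp (z * lq).

Variables (D : algType R[i]) (G : int -> set D) (r : nat).
Variables (K : 'rV[int]_r -> D) (lq : R[i]) (alpha : 'M[R[i]]_r).

Definition zvec (u : 'rV[int]_r) : 'rV[R[i]]_r := map_mx intr u.

(* [h_i, x] = s_i x, where the i-th basis vector of Z^r is q ^ h_i.           *)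
Definition weight (s : 'rV[R[i]]_r) (x : D) : Prop :=
  forall i, K (delta_mx 0 i) * x = qpow lq (s 0 i) *: (x * K (delta_mx 0 i)).

(* r0 = \sum_(i, j) (r0mx i j) h_i (x) h_j is the canonical element of the    *)
(* pairing (h_i, h_j) |-> alpha i j, hence the transposition.                 *)
Definition r0mx : 'M[R[i]]_r := (invmx alpha)^T.

(* E is an algebra containing the completion D (x)_< D together with an       *)
(* element R0 = q ^ r0. If x has weight s then                                *)
(*   R0 (x (x) 1) R0^-1 = x (x) q ^ (\sum_(i, j) s_i (r0mx i j) h_j),         *)
(* and symmetrically for 1 (x) x; these relations are required whenever the   *)
(* right-hand side is in D (x) D, that is, when the exponent is in Z^r, and   *)
(* conjugation by R0 is required to be compatible with infinite sums.         *)
Record q_r0_extension (E : unitAlgType R[i]) (iota : ctens D -> E) (R0 : E) :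
    Prop := {
  ext_linear : forall c X Y, clt G setT setT X -> clt G setT setT Y ->
    iota (fun n1 n2 => c *: X n1 n2 + Y n1 n2) = c *: iota X + iota Y;
  ext_one : iota (@cone _ D) = 1;
  ext_mul : forall X Y, clt G setT setT X -> clt G setT setT Y ->
    iota (cmul X Y) = iota X * iota Y;
  ext_inj : forall X Y, clt G setT setT X -> clt G setT setT Y ->
    iota X = iota Y -> X = Y;
  ext_unit : R0 \is a GRing.unit;
  ext_weightl : forall n x (s : 'rV[R[i]]_r) (u : 'rV[int]_r),
    G n x -> weight s x -> s *m r0mx = zvec u ->
    R0 * iota (chom n 0 (tens x 1)) = iota (chom n 0 (tens x (K u))) * R0;
  ext_weightr : forall n x (s : 'rV[R[i]]_r) (u : 'rV[int]_r),
    G n x -> weight s x -> s *m r0mx^T = zvec u ->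
    R0 * iota (chom 0 n (tens 1 x)) = iota (chom 0 n (tens (K u) x)) * R0;
  ext_continuous : forall X Y, clt G setT setT X -> clt G setT setT Y ->
    (forall n1 n2, R0 * iota (chom n1 n2 (X n1 n2)) =
                   iota (chom n1 n2 (Y n1 n2)) * R0) ->
    R0 * iota X = iota Y * R0 }.

End ComplexPowers.

(* Main.v *)
Require Import Defs.
From HB Require Import structures.
From mathcomp Require Import all_boot all_order all_algebra.
From mathcomp Require Import complex.
From mathcomp Require Import all_classical all_reals all_analysis.
From mathcomp Require Import ring zify.

Set Implicit Arguments.
Unset Strict Implicit.
Unset Printing Implicit Defensive.

Import Order.TTheory GRing.Theory Num.Theory.

Local Open Scope classical_set_scope.
Local Open Scope ring_scope.

(** Let R be the canonical element of the pairing between A and B, and Delta_D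
    the given coproduct. Since the pairing of A = A1 A2 with B = B2 B1
    factorizes, R is formally the product R1 R2; and the exchange relation
    between A and B says that R Delta_D(x) = Delta_D(x)^(2,1) R. Formally, then,
    R2 Delta_D(x) R2^-1 = R1^-1 Delta_D(x)^(2,1) R1. But R1 and R2 belong to
    opposite completions and their product does not exist, which is also why
    the two sides have to be finite. What is proved is that every x has a Y in
    the algebraic tensor square D (x) D such that

      R1 Y = Delta_D(x)^(2,1) R1   and   Y R2 = R2 Delta_D(x)

    (intertwines). Each equation makes sense in one of the completions, and
    there R1 or R2 can be cancelled.

    The elements x that have such a Y form a subalgebra, so that homogeneous x
    in A1, A2, B1 and B2 are enough. Exchanging A with B while flipping tensors
    and reversing degrees is a symmetry of the situation (double_swap) which
    exchanges A1 with B2 and A2 with B1; this leaves x in A1 and x in A2.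

    Let x be in A1. Conjugation by R0 turns Delta_D(x) into a family D', and the
    second equation becomes Y R2' = R2' D'. Contracting the left legs of R2' D'
    with b in B gives an element Phi(b) of D, and Y is the contraction of R1
    with the restriction of Phi to B2, that is Y = (id (x) Phi)(R1). This is a
    finite sum because A1 has no negative degrees and Phi kills the elements of
    B2 of very negative degree. The second equation says that Phi, corrected for
    weights, is right linear over B1 (PhiK_mul). In the first equation both
    sides are contracted with b in B2, and the product R1 R2, whose contraction
    with b is well defined and equal to b, appears on the left (contrL_sum). For
    x in A2 the roles of the two equations are exchanged (Phi2_mul, contrR_sum).
    In all cases the computation ends with the exchange element

      psi(a, b) = <a1, b1> b2 a2 = a1 b1 <a2, b2>,

    which is a b for a in A1 and b in B1, and b a for a in A2 and b in B2.

    The conjugation by R0 is only available on tensors of weight vectors for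
    the conjugation by the group-like elements K_w. The exchange relation with
    b = K_w expresses this conjugation through the coproduct, hence through
    characters of the lattice, and the independence of characters shows that
    A is spanned by weight vectors (A_wtI, A_wtII). *)

(** * Finitely supported sums *)

Section FiniteSums.
Variables (M : choiceType) (V : nmodType).
Implicit Types (f g : M -> V) (s : seq M).

Definition fsup f := exists s, forall i, f i != 0 -> i \in s.

Lemma fsum_seq f s : uniq s -> (forall i, f i != 0 -> i \in s) ->
  \sum_(i \in [set: M]) f i = \sum_(i <- s) f i.
Proof.
move=> us fs; rewrite (@fsbigE V 0 +%R M setT s f) //.
  by apply: eq_bigl => i; rewrite in_setT.
by move=> i _ /negP si; apply/eqP/negPn/negP => /fs.
Qed.

Lemma fsum_undup f s : (forall i, f i != 0 -> i \in s) ->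
  \sum_(i \in [set: M]) f i = \sum_(i <- undup s) f i.
Proof.
by move=> fs; apply: fsum_seq => [|i /fs]; rewrite ?undup_uniq ?mem_undup.
Qed.

Lemma fsum0 f : (forall i, f i = 0) -> \sum_(i \in [set: M]) f i = 0.
Proof. by move=> f0; apply: fsbig1 => i _; exact: f0. Qed.

Lemma fsum_single i0 f : (forall i, i != i0 -> f i = 0) ->
  \sum_(i \in [set: M]) f i = f i0.
Proof.
move=> f0; rewrite (fsum_seq (s := [:: i0])) ?big_seq1 // => i.
by rewrite inE; apply: contraR => /f0 ->.
Qed.

Lemma eq_fsum f g : f =1 g ->
  \sum_(i \in [set: M]) f i = \sum_(i \in [set: M]) g i.
Proof. by move=> fg; apply: eq_fsbigr => i _. Qed.

End FiniteSums.

Lemma fsum_dflt (M : choiceType) (V : nmodType) (f : M -> V) :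
  ~ fsup f -> \sum_(i \in [set: M]) f i = 0.
Proof.
move=> nf; apply: fsbig_dflt => ff; apply: nf.
exists (finite_support 0 setT f) => i fi.
by rewrite in_finite_support // inE; split=> //=; exact/eqP.
Qed.

Lemma fsum_inj (M N : choiceType) (V : nmodType) (h : M -> N) (f : N -> V) :
  injective h -> (forall j, f j != 0 -> exists i, j = h i) ->
  \sum_(j \in [set: N]) f j = \sum_(i \in [set: M]) f (h i).
Proof.
move=> hI fh; case: (pselect (fsup (f \o h))) => [[s fs]|nf]; last first.
  rewrite !fsum_dflt // => -[s fs]; apply: nf.
  pose g j := if pselect (exists i, j = h i) is left e then Some (sval (cid e)) else None.
  exists (pmap g s) => i fi; rewrite mem_pmap; apply/mapP; exists (h i); first exact: fs.
  rewrite /g; case: pselect => [e|[]]; last by exists i.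
  by congr Some; apply: hI; case: cid.
rewrite (fsum_undup (f := f \o h) fs) (fsum_seq (s := map h (undup s))).
- by rewrite big_map.
- by rewrite map_inj_uniq ?undup_uniq.
- move=> j fj; have [i ji] := fh _ fj; rewrite ji map_f // mem_undup fs //=.
  by rewrite -ji.
Qed.

Lemma fsum_morph (M : choiceType) (V W : nmodType) (h : V -> W) (f : M -> V) :
  h 0 = 0 -> {morph h : x y / x + y} -> fsup f ->
  h (\sum_(i \in [set: M]) f i) = \sum_(i \in [set: M]) h (f i).
Proof.
move=> h0 hD [s fs]; rewrite (fsum_undup fs) (fsum_undup (s := s)).
  exact: big_morph.
by move=> i; apply: contraR => /(contra (fs i)); rewrite negbK => /eqP ->; apply/eqP.
Qed.

Lemma fsum_big (M : choiceType) (V : nmodType) (J : eqType) (t : seq J)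
    (f : M -> J -> V) : (forall j, j \in t -> fsup (f^~ j)) ->
  \sum_(i \in [set: M]) \sum_(j <- t) f i j =
  \sum_(j <- t) \sum_(i \in [set: M]) f i j.
Proof.
elim: t => [|j t IHt] ft.
  by rewrite big_nil fsum0 // => i; rewrite big_nil.
have [s fs] := ft _ (mem_head _ _).
have /IHt {}IHt j' : j' \in t -> fsup (f^~ j').
  by move=> jt; apply: ft; rewrite inE jt orbT.
have [s' fs'] : fsup (fun i => \sum_(j <- t) f i j).
  have {IHt} : forall j, j \in t -> fsup (f^~ j).
    by move=> j' jt; apply: ft; rewrite inE jt orbT.
  elim: (t) => [|j' t' IHt'] ft'.
    by exists [::] => i; rewrite big_nil eqxx.
  have [s1 fs1] := ft' _ (mem_head _ _).
  have [|s2 fs2] := IHt'.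
    by move=> j1 j1t; apply: ft'; rewrite inE j1t orbT.
  exists (s1 ++ s2) => i; rewrite big_cons mem_cat; apply: contraR.
  case/norP=> /(contra (fs1 i)); rewrite negbK => /eqP ->.
  by move=> /(contra (fs2 i)); rewrite negbK => /eqP ->; rewrite addr0.
rewrite big_cons -IHt.
pose r := s ++ s'.
rewrite (fsum_undup (s := r) (f := fun i => \sum_(j <- j :: t) f i j)) => [|i]; last first.
  rewrite big_cons mem_cat; apply: contraR.
  case/norP=> /(contra (fs i)); rewrite negbK => /eqP ->.
  by move=> /(contra (fs' i)); rewrite negbK => /eqP ->; rewrite addr0.
rewrite (fsum_undup (s := r) (f := f^~ j)) => [|i /fs]; last by rewrite mem_cat => ->.
rewrite (fsum_undup (s := r) (f := fun i => \sum_(j <- t) f i j)) =>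
  [|i /fs']; last by rewrite mem_cat orbC => ->.
by rewrite -big_split; apply: eq_bigr => i _; rewrite big_cons.
Qed.

Lemma fsum_exch (M N : choiceType) (V : nmodType) (f : M -> N -> V)
    (s : seq M) (t : seq N) :
  (forall i j, f i j != 0 -> (i \in s) && (j \in t)) ->
  \sum_(i \in [set: M]) \sum_(j \in [set: N]) f i j =
  \sum_(j \in [set: N]) \sum_(i \in [set: M]) f i j.
Proof.
move=> fst.
have fE i : \sum_(j \in [set: N]) f i j = \sum_(j <- undup t) f i j.
  by apply: fsum_undup => j /fst/andP[].
rewrite (eq_fsum fE) fsum_big => [|j _]; last first.
  by exists s => i /fst/andP[].
rewrite -fsum_undup // => j; apply: contraR => jt.
by apply/eqP/fsum0 => i; apply/eqP/negPn/negP => /fst/andP[_]; exact/negP.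
Qed.

Definition zwin (lo hi : int) : seq int :=
  [seq lo + k%:Z | k <- iota 0 `|hi - lo|%N.+1].

Arguments zwin : simpl never.

Lemma mem_zwin lo hi i : lo <= i -> i <= hi -> i \in zwin lo hi.
Proof.
move=> li ih; apply/mapP; exists `|i - lo|%N; last by lia.
by rewrite mem_iota; lia.
Qed.

Section Convolution.
Variables (M : zmodType) (V : nmodType).
Implicit Types f : M -> V.

Lemma fsum_shift f c :
  \sum_(i \in [set: M]) f i = \sum_(i \in [set: M]) f (i - c).
Proof.
have cI : injective (fun i : M => i - c) by move=> i j /addIr.
by apply: (fsum_inj cI) => j _; exists (j + c); rewrite addrK.
Qed.

Lemma fsum_refl f c :
  \sum_(i \in [set: M]) f i = \sum_(i \in [set: M]) f (c - i).
Proof.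
have cI : injective (fun i : M => c - i) by move=> i j /addrI/oppr_inj.
apply: (fsum_inj cI) => j _; exists (c - j).
by rewrite opprB addrCA subrr addr0.
Qed.

Lemma fsum_conv (f : M -> M -> V) (s t : seq M) :
  (forall i j, f i j != 0 -> (i \in s) && (j \in t)) ->
  \sum_(k \in [set: M]) \sum_(i \in [set: M]) f i (k - i) =
  \sum_(i \in [set: M]) \sum_(j \in [set: M]) f i j.
Proof.
move=> fst; rewrite (@fsum_exch _ _ _ _ [seq i + j | i <- s, j <- t] s).
  by apply: eq_fsum => i; rewrite -fsum_shift.
move=> k i /fst/andP[si tj]; rewrite si andbT; apply/allpairsP.
by exists (i, k - i); rewrite si tj /= addrC subrK.
Qed.

End Convolution.

(** * Tensors as finite sums *)

Section TensorCalculus.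
Variables (F : fieldType).

Lemma bilP (V W U : lmodType F) (f : V -> W -> U) :
  (forall c x y z, f (c *: x + y) z = c *: f x z + f y z) ->
  (forall c x y z, f z (c *: x + y) = c *: f z x + f z y) -> bilinear_map f.
Proof. by move=> fl fr; split=> v c x y; [exact: fr|exact: fl]. Qed.

Section Tlift.
Variables V W U : lmodType F.
Implicit Types (f : V -> W -> U) (t : tensor V W).

Lemma bil_l f : bilinear_map f ->
  forall c x y z, f (c *: x + y) z = c *: f x z + f y z.
Proof. by case=> _ fl c x y z; exact: fl. Qed.

Lemma bil_r f : bilinear_map f ->
  forall c x y z, f z (c *: x + y) = c *: f z x + f z y.
Proof. by case=> fr _ c x y z; exact: fr. Qed.

Lemma tliftD f : bilinear_map f -> {morph tlift f : x y / x + y}.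
Proof. by move=> fP x y; have := tlift_linear fP 1 x y; rewrite !scale1r. Qed.

Lemma tlift0 f : bilinear_map f -> tlift f 0 = 0.
Proof. by move=> fP; apply: (addrI (tlift f 0)); rewrite -tliftD // !addr0. Qed.

Lemma tlift_sum f (I : Type) (s : seq I) (P : pred I) (G : I -> tensor V W) :
  bilinear_map f ->
  tlift f (\sum_(i <- s | P i) G i) = \sum_(i <- s | P i) tlift f (G i).
Proof. by move=> fP; apply: big_morph; [exact: tliftD|exact: tlift0]. Qed.

Lemma tlift_list f (s : seq (V * W)) : bilinear_map f ->
  tlift f (\sum_(q <- s) tens q.1 q.2) = \sum_(q <- s) f q.1 q.2.
Proof.
by move=> fP; rewrite tlift_sum //; apply: eq_bigr => q _; rewrite tlift_tens.
Qed.

Lemma tlift_eq f g t : f =2 g -> tlift f t = tlift g t.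
Proof. by move=> fg; rewrite /tlift /tens_eval; apply: eq_bigr. Qed.

End Tlift.

Lemma linP (V W : lmodType F) (h : V -> W) : linear h ->
  [/\ h 0 = 0, {morph h : x y / x + y} & forall c x, h (c *: x) = c *: h x].
Proof.
move=> hl; have hD : {morph h : x y / x + y}.
  by move=> x y; have := hl 1 x y; rewrite !scale1r.
have h0 : h 0 = 0 by apply: (addrI (h 0)); rewrite -hD !addr0.
by split=> // c x; rewrite -[c *: x]addr0 hl h0 addr0.
Qed.

Lemma linear_tlift (V W U U' : lmodType F) (f : V -> W -> U) (h : U -> U')
    (t : tensor V W) : linear h -> bilinear_map f ->
  h (tlift f t) = tlift (fun x y => h (f x y)) t.
Proof.
move=> hl fP; have [h0 hD _] := linP hl.
have [s ->] := tensor_sum t; rewrite !tlift_list //.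
  exact: big_morph.
by apply: bilP => c x y z; rewrite ?(bil_l fP) ?(bil_r fP); exact: hl.
Qed.

Lemma linear_bigsum (V W : lmodType F) (h : V -> W) I (s : seq I) (P : pred I)
    (G : I -> V) : linear h ->
  h (\sum_(i <- s | P i) G i) = \sum_(i <- s | P i) h (G i).
Proof. by move=> /linP[h0 hD _]; apply: big_morph. Qed.

Lemma tlift_exch (V W V' W' U : lmodType F) (f : V -> W -> V' -> W' -> U)
    (t : tensor V W) (t' : tensor V' W') :
  (forall x y, bilinear_map (f x y)) ->
  (forall x' y', bilinear_map (fun x y => f x y x' y')) ->
  tlift (fun x y => tlift (f x y) t') t =
  tlift (fun x' y' => tlift (fun x y => f x y x' y') t) t'.
Proof.
move=> f1 f2; have [s ->] := tensor_sum t; have [s' ->] := tensor_sum t'.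
rewrite !tlift_list.
- under eq_bigr do rewrite tlift_list //.
  by rewrite exchange_big; apply: eq_bigr => q _; rewrite tlift_list.
- apply: bilP => c x y z; rewrite !tlift_list // scaler_sumr -big_split;
    by apply: eq_bigr => q _; rewrite /= ?(bil_l (f1 _ _)) ?(bil_r (f1 _ _)).
- apply: bilP => c x y z; rewrite !tlift_list // scaler_sumr -big_split;
    by apply: eq_bigr => q _; rewrite /= ?(bil_l (f2 _ _)) ?(bil_r (f2 _ _)).
Qed.

Lemma tlift_linl (V W V' U : lmodType F) (f : V' -> V -> W -> U)
    (t : tensor V W) : (forall z, bilinear_map (f z)) ->
  (forall x y, linear (fun z => f z x y)) -> linear (fun z => tlift (f z) t).
Proof.
move=> fP fl c x y; have [s ->] := tensor_sum t; rewrite !tlift_list //.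
by rewrite scaler_sumr -big_split; apply: eq_bigr => q _; exact: fl.
Qed.

End TensorCalculus.

Section Subspaces.
Variables (F : fieldType) (D : algType F).
Implicit Types (S T : set D) (t : tensor D D).

Definition subsp S := S 0 /\ forall c x y, S x -> S y -> S (c *: x + y).

Lemma subspZ S c x : subsp S -> S x -> S (c *: x).
Proof. by case=> S0 Sl Sx; rewrite -[c *: x]addr0; exact: Sl. Qed.

Lemma subspD S x y : subsp S -> S x -> S y -> S (x + y).
Proof. by case=> S0 Sl Sx Sy; rewrite -[x]scale1r; exact: Sl. Qed.

Lemma subsp_sum S (I : eqType) (s : seq I) (f : I -> D) : subsp S ->
  (forall i, i \in s -> S (f i)) -> S (\sum_(i <- s) f i).
Proof.
move=> SS fs; rewrite big_seq; apply: (big_ind S) => //; first by case: SS.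
by move=> x y; exact: subspD.
Qed.

Lemma subspI S T : subsp S -> subsp T -> subsp (S `&` T).
Proof.
move=> [S0 Sl] [T0 Tl]; split=> [|c x y [Sx Tx] [Sy Ty]]; first by split.
by split; [exact: Sl|exact: Tl].
Qed.

Lemma subsp_fsum S (M : choiceType) (f : M -> D) : subsp S ->
  (forall i, S (f i)) -> S (\sum_(i \in [set: M]) f i).
Proof. by move=> SS fs; apply: subsp_sum. Qed.

Lemma tspan_tens S T x y : S x -> T y -> tspan S T (tens x y).
Proof.
move=> Sx Ty; exists [:: (x, y)]; rewrite big_seq1; split=> // q.
by rewrite inE => /eqP ->.
Qed.

Lemma tspan0 S T : tspan S T 0.
Proof. by exists [::]; rewrite big_nil. Qed.

Lemma tspanD S T t t' : tspan S T t -> tspan S T t' -> tspan S T (t + t').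
Proof.
move=> [s [Hs ->]] [s' [Hs' ->]]; exists (s ++ s'); rewrite big_cat; split=> // q.
by rewrite mem_cat => /orP[/Hs|/Hs'].
Qed.

Lemma tspan_sum S T (I : eqType) (s : seq I) (f : I -> tensor D D) :
  (forall i, i \in s -> tspan S T (f i)) -> tspan S T (\sum_(i <- s) f i).
Proof.
move=> fs; rewrite big_seq; apply: (big_ind (tspan S T)) => //.
  exact: tspan0.
by move=> x y; exact: tspanD.
Qed.

Lemma tspan_fsum S T (M : choiceType) (f : M -> tensor D D) :
  (forall i, tspan S T (f i)) -> tspan S T (\sum_(i \in [set: M]) f i).
Proof. by move=> fs; apply: tspan_sum. Qed.

Lemma tspan_sub S T S' T' t : S `<=` S' -> T `<=` T' -> tspan S T t ->
  tspan S' T' t.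
Proof.
move=> SS TT [s [Hs ->]]; exists s; split=> // q /Hs[].
by split; [exact: SS|exact: TT].
Qed.

Lemma tlift_subsp S T (P : set D) f t : bilinear_map f -> subsp P ->
  (forall x y, S x -> T y -> P (f x y)) -> tspan S T t -> P (tlift f t).
Proof.
move=> fP PP SP [s [Hs ->]]; rewrite tlift_list //; apply: subsp_sum => // q /Hs.
by case=> ? ?; exact: SP.
Qed.

Lemma tlift_eq_on (U : lmodType F) S T (f g : D -> D -> U) t :
  bilinear_map f -> bilinear_map g ->
  (forall x y, S x -> T y -> f x y = g x y) -> tspan S T t ->
  tlift f t = tlift g t.
Proof.
move=> fP gP fg [s [Hs ->]]; rewrite !tlift_list //.
by rewrite big_seq [RHS]big_seq; apply: eq_bigr => q /Hs[]; exact: fg.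
Qed.

Lemma tlift_eq0 (U : lmodType F) S T (f : D -> D -> U) t : bilinear_map f ->
  (forall x y, S x -> T y -> f x y = 0) -> tspan S T t -> tlift f t = 0.
Proof.
move=> fP f0 [s [Hs ->]]; rewrite tlift_list // big_seq big1 // => q /Hs[].
exact: f0.
Qed.

(** A functional that does not vanish on the first left leg expresses the
    first right leg through the others; substituting it shortens the sum. *)
Lemma tensor_test S (J : Type) (phi : J -> D -> F) t :
  subsp S -> (forall j, linear (phi j : D -> F^o)) ->
  (forall x, S x -> (forall j, phi j x = 0) -> x = 0) -> tspan S setT t ->
  (forall j, tlift (fun x y => phi j x *: y) t = 0) -> t = 0.
Proof.
move=> SS phil phi0 [s [Hs ->]].
have phiB j : bilinear_map (fun x y : D => phi j x *: y).
  apply: bilP => c x y z; first by rewrite (phil j c x y) scalerDl scalerA.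
  by rewrite scalerDr !scalerA mulrC.
have [n] := ubnP (size s); elim: n s Hs => // n IHn [|[x y] s] Hs.
  by rewrite big_nil.
rewrite ltnS => sn t0.
have [Sx _] := Hs _ (mem_head _ _).
have {}Hs q : q \in s -> S q.1 by move=> qs; case: (Hs q) => //; rewrite inE qs orbT.
have tb := tens_bilinear D D.
case: (pselect (exists j, phi j x != 0)) => [[j xj]|nx]; last first.
  have x0 : x = 0.
    apply: phi0 => // j; apply/eqP/negPn/negP => xj; apply: nx; by exists j.
  rewrite big_cons /= x0.
  have -> : tens 0 y = 0 :> tensor D D.
    have := bil_l tb 0 0 0 y; rewrite !scale0r !add0r => e.
    by have := bil_l tb (-1) 0 0 y; rewrite scaler0 addr0 scaleN1r addNr.
  rewrite add0r; apply: IHn => [q /Hs||j] //; have := t0 j.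
  rewrite !tlift_list // big_cons /= x0.
  by have /linP[-> _ _] := phil j; rewrite scale0r add0r.
have yE : y = \sum_(q <- s) (- (phi j q.1 / phi j x)) *: q.2.
  have := t0 j; rewrite tlift_list // big_cons /= => /(congr1 ( *:%R (phi j x)^-1)).
  rewrite scalerDr scalerA mulVf // scale1r scaler0 => /eqP; rewrite addr_eq0.
  move=> /eqP ->; rewrite scaler_sumr -sumrN; apply: eq_bigr => q _.
  by rewrite scalerA scaleNr mulrC.
pose s' := [seq (q.1 - (phi j q.1 / phi j x) *: x, q.2) | q <- s].
have sE : \sum_(q <- (x, y) :: s) tens q.1 q.2 = \sum_(q <- s') tens q.1 q.2.
  have [_ tD tZ] : [/\ _, _ & _] := linP (fun c a b => bil_r tb c a b x).
  rewrite big_cons /= {1}yE big_map.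
  rewrite (linear_bigsum _ _ _ (fun c a b => bil_r tb c a b x)).
  rewrite -big_split /=; apply: eq_bigr => q _.
  have := bil_l tb (- (phi j q.1 / phi j x)) x q.1 q.2.
  by rewrite [_ *: x + _]addrC scaleNr => ->; rewrite tZ.
rewrite sE in t0 *; apply: IHn => //; last by rewrite size_map.
move=> _ /mapP[q /Hs Sq ->] /=; split=> //.
by rewrite addrC -scaleNr; case: SS => _; apply.
Qed.

End Subspaces.
(** * The tensor square as an algebra *)

Section Linearity.
Variables (F : fieldType).

Lemma lin_id (V : lmodType F) : linear (fun x : V => x).
Proof. by []. Qed.

Lemma lin_comp (V W U : lmodType F) (g : W -> U) (h : V -> W) :
  linear g -> linear h -> linear (fun x => g (h x)).
Proof. by move=> gl hl c x y; rewrite hl gl. Qed.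

Variable D : algType F.
Implicit Types (t : tensor D D).

Lemma lin_mull (a : D) : linear (fun x => a * x).
Proof. by move=> c x y; rewrite mulrDr scalerAr. Qed.

Lemma lin_mulr (a : D) : linear (fun x => x * a).
Proof. by move=> c x y; rewrite mulrDl scalerAl. Qed.

Lemma bil_mul (V W : lmodType F) (g : V -> D) (h : W -> D) :
  linear g -> linear h -> bilinear_map (fun x y => g x * h y).
Proof.
move=> gl hl; apply: bilP => c x y z.
  by rewrite gl mulrDl scalerAl.
by rewrite hl mulrDr scalerAr.
Qed.

Lemma bil_mul' (V W : lmodType F) (g : V -> D) (h : W -> D) :
  linear g -> linear h -> bilinear_map (fun y x => g x * h y).
Proof. by move=> gl hl; have [a b] := bil_mul gl hl; split. Qed.

Lemma bil_scl (V W U : lmodType F) (phi : V -> F) (h : W -> U) :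
  linear (phi : V -> F^o) -> linear h -> bilinear_map (fun x y => phi x *: h y).
Proof.
move=> pl hl; apply: bilP => c x y z; first by rewrite pl scalerDl scalerA.
by rewrite hl scalerDr !scalerA mulrC.
Qed.

Lemma bil_scr (V W U : lmodType F) (phi : W -> F) (h : V -> U) :
  linear (phi : W -> F^o) -> linear h -> bilinear_map (fun x y => phi y *: h x).
Proof. by move=> pl hl; have [a b] := bil_scl pl hl; split. Qed.

Lemma bil_mulF (V W : lmodType F) (phi : V -> F) (psi : W -> F) :
  linear (phi : V -> F^o) -> linear (psi : W -> F^o) ->
  bilinear_map (fun x y => phi x * psi y : F^o).
Proof. exact: bil_scl. Qed.

Lemma bil_mulF' (V W : lmodType F) (phi : V -> F) (psi : W -> F) :
  linear (phi : V -> F^o) -> linear (psi : W -> F^o) ->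
  bilinear_map (fun y x => phi x * psi y : F^o).
Proof. by move=> gl hl; have [a b] := bil_mulF gl hl; split. Qed.

Lemma bil_comp (V W V' W' U : lmodType F) (f : V' -> W' -> U)
    (g : V -> V') (h : W -> W') :
  bilinear_map f -> linear g -> linear h -> bilinear_map (fun x y => f (g x) (h y)).
Proof.
move=> fP gl hl; apply: bilP => c x y z; first by rewrite gl (bil_l fP).
by rewrite hl (bil_r fP).
Qed.

Lemma bil_swap (V W U : lmodType F) (f : V -> W -> U) :
  bilinear_map f -> bilinear_map (fun y x => f x y).
Proof. by case=> a b; split. Qed.

Lemma bil_post (V W U U' : lmodType F) (f : V -> W -> U) (h : U -> U') :
  bilinear_map f -> linear h -> bilinear_map (fun x y => h (f x y)).
Proof.
move=> fP hl; apply: bilP => c x y z; first by rewrite (bil_l fP) hl.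
by rewrite (bil_r fP) hl.
Qed.

Lemma bil_tlift2 (V W V' W' U : lmodType F) (f : V -> W -> V' -> W' -> U)
    (t : tensor V' W') : (forall x y, bilinear_map (f x y)) ->
  (forall x' y', bilinear_map (fun x y => f x y x' y')) ->
  bilinear_map (fun x y => tlift (f x y) t).
Proof.
move=> f1 f2; have [s ->] := tensor_sum t.
apply: bilP => c x y z; rewrite !tlift_list // scaler_sumr -big_split;
  by apply: eq_bigr => q _; rewrite /= ?(bil_l (f2 _ _)) ?(bil_r (f2 _ _)).
Qed.

Lemma tensor_ext (V : lmodType F) (g h : tensor D D -> V) t :
  linear g -> linear h -> (forall x y, g (tens x y) = h (tens x y)) -> g t = h t.
Proof.
move=> gl hl gh; have [s ->] := tensor_sum t.
by rewrite !linear_bigsum //; apply: eq_bigr.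
Qed.

End Linearity.

Section TensorAlgebra.
Variables (F : fieldType) (D : algType F).
Implicit Types (S T : set D) (t u v : tensor D D).

Let tb : bilinear_map (@tens F D D) := tens_bilinear D D.

Lemma tmul_bil2 a b : bilinear_map (fun c d : D => tens (a * c) (b * d)).
Proof. exact: bil_comp tb (lin_mull a) (lin_mull b). Qed.

Lemma tmul_bil1 u : bilinear_map
  (fun a b : D => tlift (fun c d => tens (a * c) (b * d)) u).
Proof.
apply: bil_tlift2 => [x y|x' y']; first exact: tmul_bil2.
exact: bil_comp tb (lin_mulr x') (lin_mulr y').
Qed.

Lemma tmul_linr t : linear (tmul t).
Proof.
rewrite /tmul => c u v.
have [s ->] := tensor_sum t.
rewrite !tlift_list; try exact: tmul_bil1.
rewrite scaler_sumr -big_split; apply: eq_bigr => q _.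
by rewrite tlift_linear //; exact: tmul_bil2.
Qed.

Lemma tmul_linl u : linear (fun t => tmul t u).
Proof. by move=> c t v; rewrite /tmul tlift_linear //; exact: tmul_bil1. Qed.

Lemma tmul_tens a b c d : tmul (tens a b) (tens c d) = tens (a * c) (b * d) :> tensor D D.
Proof. by rewrite /tmul !tlift_tens //; [exact: tmul_bil2|exact: tmul_bil1]. Qed.

Lemma tmul_list (s s' : seq (D * D)) :
  tmul (\sum_(q <- s) tens q.1 q.2) (\sum_(q <- s') tens q.1 q.2) =
  \sum_(q <- s) \sum_(q' <- s') tens (q.1 * q'.1) (q.2 * q'.2).
Proof.
rewrite (linear_bigsum _ _ _ (tmul_linl _)); apply: eq_bigr => q _.
rewrite (linear_bigsum _ _ _ (tmul_linr _)); apply: eq_bigr => q' _.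
exact: tmul_tens.
Qed.

Lemma tmul0t t : tmul 0 t = 0.
Proof. by have [] := linP (tmul_linl t). Qed.

Lemma tmult0 t : tmul t 0 = 0.
Proof. by have [] := linP (tmul_linr t). Qed.

Lemma tmulDl t : {morph (fun x => tmul x t) : x y / x + y}.
Proof. by have [] := linP (tmul_linl t). Qed.

Lemma tmulDr t : {morph (tmul t) : x y / x + y}.
Proof. by have [] := linP (tmul_linr t). Qed.

Lemma tmulA t u v : tmul t (tmul u v) = tmul (tmul t u) v.
Proof.
apply: (tensor_ext (g := fun t => tmul t (tmul u v))
  (h := fun t => tmul (tmul t u) v)) => [||x y]; first exact: tmul_linl.
  exact: lin_comp (tmul_linl v) (tmul_linl u).
apply: (tensor_ext (g := fun u => tmul (tens x y) (tmul u v))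
  (h := fun u => tmul (tmul (tens x y) u) v)) => [||x' y'].
- exact: lin_comp (tmul_linr _) (tmul_linl v).
- exact: lin_comp (tmul_linl v) (tmul_linr _).
apply: (tensor_ext (g := fun v => tmul (tens x y) (tmul (tens x' y') v))
  (h := tmul (tmul (tens x y) (tens x' y')))) => [||x2 y2].
- exact: lin_comp (tmul_linr _) (tmul_linr _).
- exact: tmul_linr.
by rewrite !tmul_tens !mulrA.
Qed.

Lemma tmul1t t : tmul (tens 1 1) t = t.
Proof.
apply: (tensor_ext (g := tmul (tens 1 1)) (h := fun t => t)) => [||x y] //.
  exact: tmul_linr.
by rewrite tmul_tens !mul1r.
Qed.

Lemma tlift_tmul (U : lmodType F) (f : D -> D -> U) t u : bilinear_map f ->
  tlift f (tmul t u) = tlift (fun x y => tlift (fun x' y' => f (x * x') (y * y')) u) t.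
Proof.
move=> fP; have [s ->] := tensor_sum t; have [s' ->] := tensor_sum u.
have fb x y : bilinear_map (fun x' y' => f (x * x') (y * y')).
  exact: bil_comp fP (lin_mull x) (lin_mull y).
have fc x' y' : bilinear_map (fun x y => f (x * x') (y * y')).
  exact: bil_comp fP (lin_mulr x') (lin_mulr y').
rewrite tmul_list tlift_sum // tlift_list; last exact: bil_tlift2.
apply: eq_bigr => q _; rewrite tlift_sum // tlift_list //.
by apply: eq_bigr => q' _; rewrite tlift_tens.
Qed.

Lemma tspan_tmul S T S' T' P Q t u :
  (forall x y, S x -> S' y -> P (x * y)) ->
  (forall x y, T x -> T' y -> Q (x * y)) ->
  tspan S T t -> tspan S' T' u -> tspan P Q (tmul t u).
Proof.
move=> SP TQ [s [Hs ->]] [s' [Hs' ->]]; rewrite tmul_list.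
apply: tspan_sum => q /Hs[Sq Tq]; apply: tspan_sum => q' /Hs'[Sq' Tq'].
by apply: tspan_tens; [exact: SP|exact: TQ].
Qed.

Let fb : bilinear_map (fun x y : D => tens y x) := bil_swap tb.

Lemma tflip_tens x y : tflip (tens x y) = tens y x :> tensor D D.
Proof. by rewrite /tflip tlift_tens. Qed.

Lemma tflip_lin : linear (@tflip F D).
Proof. exact: tlift_linear. Qed.

Lemma tflip0 : tflip (0 : tensor D D) = 0.
Proof. by have [] := linP tflip_lin. Qed.

Lemma tflip_list (s : seq (D * D)) :
  tflip (\sum_(q <- s) tens q.1 q.2) = \sum_(q <- s) tens q.2 q.1.
Proof. by rewrite /tflip tlift_list. Qed.

Lemma tflipK : involutive (@tflip F D).
Proof.
move=> t; have [s ->] := tensor_sum t; rewrite tflip_list.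
rewrite (linear_bigsum _ _ _ tflip_lin); apply: eq_bigr => q _.
exact: tflip_tens.
Qed.

Lemma tflip_eq0 t : (tflip t == 0) = (t == 0).
Proof. by rewrite -(inj_eq (inv_inj tflipK)) tflipK tflip0. Qed.

Lemma tflip_tmul t u : tflip (tmul t u) = tmul (tflip t) (tflip u).
Proof.
apply: (tensor_ext (g := fun t => tflip (tmul t u))
  (h := fun t => tmul (tflip t) (tflip u))) => [||x y].
- exact: lin_comp tflip_lin (tmul_linl _).
- exact: lin_comp (tmul_linl _) tflip_lin.
apply: (tensor_ext (g := fun u => tflip (tmul (tens x y) u))
  (h := fun u => tmul (tflip (tens x y)) (tflip u))) => [||x' y'].
- exact: lin_comp tflip_lin (tmul_linr _).
- exact: lin_comp (tmul_linr _) tflip_lin.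
by rewrite tmul_tens !tflip_tens tmul_tens.
Qed.

Lemma tlift_tflip (U : lmodType F) (f : D -> D -> U) t : bilinear_map f ->
  tlift f (tflip t) = tlift (fun x y => f y x) t.
Proof.
move=> fP; have [s ->] := tensor_sum t; rewrite tflip_list.
rewrite tlift_sum // tlift_list; last exact: bil_swap.
by apply: eq_bigr => q _; rewrite tlift_tens.
Qed.

Lemma tspan_tflip S T t : tspan S T t -> tspan T S (tflip t).
Proof.
move=> [s [Hs ->]]; rewrite tflip_list; apply: tspan_sum => q /Hs[? ?].
exact: tspan_tens.
Qed.

(** The product of two homogeneous elements of a completed tensor square. In
    total degree n the component of bidegree (i, n - i) is recorded at index
    i, and then the product depends on n only through the way its result is
    read. *)
Definition tconv (X Y : int -> tensor D D) (j : int) : tensor D D :=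
  \sum_(i \in [set: int]) tmul (X i) (Y (j - i)).

(** The partial evaluations phi (x) id and id (x) phi. Elements of the
    completed tensor squares are compared through them. *)
Definition ctl (phi : D -> F) t : D := tlift (fun x y => phi x *: y) t.
Definition ctr (phi : D -> F) t : D := tlift (fun x y => phi y *: x) t.

Lemma ctl_bil (phi : D -> F) : linear (phi : D -> F^o) ->
  bilinear_map (fun x y : D => phi x *: y).
Proof. by move=> pl; exact: bil_scl pl (@lin_id _ _). Qed.

Lemma ctr_bil (phi : D -> F) : linear (phi : D -> F^o) ->
  bilinear_map (fun x y : D => phi y *: x).
Proof. by move=> pl; exact: bil_scr pl (@lin_id _ _). Qed.

Lemma ctl_lin phi : linear (phi : D -> F^o) -> linear (ctl phi).
Proof. by move=> pl; apply: tlift_linear; exact: ctl_bil. Qed.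

Lemma ctr_lin phi : linear (phi : D -> F^o) -> linear (ctr phi).
Proof. by move=> pl; apply: tlift_linear; exact: ctr_bil. Qed.

Lemma ctl_list phi (s : seq (D * D)) : linear (phi : D -> F^o) ->
  ctl phi (\sum_(q <- s) tens q.1 q.2) = \sum_(q <- s) phi q.1 *: q.2.
Proof. by move=> pl; rewrite /ctl tlift_list //; exact: ctl_bil. Qed.

Lemma ctl_subsp phi S T t : linear (phi : D -> F^o) -> subsp T ->
  tspan S T t -> T (ctl phi t).
Proof.
move=> pl TT; apply: tlift_subsp => //; first exact: ctl_bil.
by move=> x y _; exact: subspZ.
Qed.

Lemma ctr_subsp phi S T t : linear (phi : D -> F^o) -> subsp S ->
  tspan S T t -> S (ctr phi t).
Proof.
move=> pl TT; apply: tlift_subsp => //; first exact: ctr_bil.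
by move=> x y Sx _; exact: subspZ.
Qed.

Lemma ctl_linphi (V : lmodType F) (phi : V -> D -> F) t :
  (forall z, linear (phi z : D -> F^o)) -> (forall x, linear (phi^~ x : V -> F^o)) ->
  linear (fun z => ctl (phi z) t).
Proof.
move=> p1 p2; apply: tlift_linl => [z|x y]; first exact: ctl_bil.
by move=> c z z'; rewrite (p2 x) scalerDl scalerA.
Qed.

Lemma ctr_linphi (V : lmodType F) (phi : V -> D -> F) t :
  (forall z, linear (phi z : D -> F^o)) -> (forall x, linear (phi^~ x : V -> F^o)) ->
  linear (fun z => ctr (phi z) t).
Proof.
move=> p1 p2; apply: tlift_linl => [z|x y]; first exact: ctr_bil.
by move=> c z z'; rewrite (p2 y) scalerDl scalerA.
Qed.

End TensorAlgebra.

(** * The double, one degree at a time *)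

Section Double.
Variables (F : fieldType) (D : algType F).

Definition submon (S : set D) := S 1 /\ forall x y, S x -> S y -> S (x * y).

(** The finite identities between homogeneous elements that the proof uses;
    R1 i and R2 i stand for the components of bidegree (i, - i) of the
    canonical elements R1 and R2'. The list is closed under the symmetry
    double_swap, so that everything proved from it for the elements of A
    also holds for those of B. The spanning conditions dA_ind, dB_ind,
    dA2_ind and dB1_ind are induction principles for linear properties of
    homogeneous elements. *)
Record double_data (G : int -> set D) (Delta : D -> ctens D) (eps : D -> F)
    (r : nat) (K : 'rV[int]_r -> D) (p : D -> D -> F)
    (A A1 A2 A2' B B2 B1 B1' : set D) (R1 R2 : int -> tensor D D) : Prop := {
  dG : forall n, subsp (G n);
  dG1 : G 0 1;
  dGM : forall m n x y, G m x -> G n y -> G (m + n) (x * y);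
  dA : subsp A; dA1 : subsp A1; dA2 : subsp A2; dA2' : subsp A2';
  dB : subsp B; dB2 : subsp B2; dB1 : subsp B1; dB1' : subsp B1';
  dAM : submon A; dA1M : submon A1; dA2M : submon A2; dA2'M : submon A2';
  dBM : submon B; dB2M : submon B2; dB1M : submon B1; dB1'M : submon B1';
  dA1A : A1 `<=` A; dA2A : A2 `<=` A; dA2'A : A2' `<=` A2;
  dB2B : B2 `<=` B; dB1B : B1 `<=` B; dB1'B : B1' `<=` B1;
  dKA : forall u, A2 (K u); dKB : forall u, B1 (K u);
  dKG : forall u, G 0 (K u);
  dK0 : K 0 = 1; dKD : forall u v, K (u + v) = K u * K v;
  dA1n : forall n x, n < 0 -> A1 x -> G n x -> x = 0;
  dA2n : forall n x, 0 < n -> A2 x -> G n x -> x = 0;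
  dB1n : forall n x, n < 0 -> B1 x -> G n x -> x = 0;
  dB2n : forall n x, 0 < n -> B2 x -> G n x -> x = 0;
  dA_ind : forall n (P : set D), subsp P ->
    (forall i a1 a2 u, A1 a1 -> G i a1 -> A2' a2 -> G (n - i) a2 ->
       P (a1 * a2 * K u)) -> forall x, A x -> G n x -> P x;
  dB_ind : forall n (P : set D), subsp P ->
    (forall i b2 b1 u, B2 b2 -> G i b2 -> B1' b1 -> G (n - i) b1 ->
       P (b2 * b1 * K u)) -> forall x, B x -> G n x -> P x;
  dA2_ind : forall n (P : set D), subsp P ->
    (forall a2 u, A2' a2 -> G n a2 -> P (a2 * K u)) ->
    forall x, A2 x -> G n x -> P x;
  dB1_ind : forall n (P : set D), subsp P ->
    (forall b1 u, B1' b1 -> G n b1 -> P (b1 * K u)) ->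
    forall x, B1 x -> G n x -> P x;
  dDl : forall i j, linear (fun x => Delta x i j);
  dDdeg : forall n x, G n x -> exists c : int, forall i j, Delta x i j != 0 ->
    i + j = n /\ c <= j;
  dDA : forall x i j, A x -> tspan (A `&` G i) (A `&` G j) (Delta x i j);
  dDA1 : forall x i j, A1 x -> tspan (A `&` G i) (A1 `&` G j) (Delta x i j);
  dDA2 : forall x i j, A2 x -> tspan (A2 `&` G i) (A `&` G j) (Delta x i j);
  dDB : forall x i j, B x -> tspan (B `&` G i) (B `&` G j) (Delta x i j);
  dDB1 : forall x i j, B1 x -> tspan (B `&` G i) (B1 `&` G j) (Delta x i j);
  dDB2 : forall x i j, B2 x -> tspan (B2 `&` G i) (B `&` G j) (Delta x i j);
  dDM : forall m n x y, G m x -> G n y -> forall k,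
    Delta (x * y) k (m + n - k) =
    \sum_(i \in [set: int])
      tmul (Delta x i (m - i)) (Delta y (k - i) (n - (k - i)));
  dDK : forall u, Delta (K u) = chom 0 0 (tens (K u) (K u));
  dcounitl : forall n x, G n x -> ctl eps (Delta x 0 n) = x;
  dcounitr : forall n x, G n x -> ctr eps (Delta x n 0) = x;
  depsl : linear (eps : D -> F^o);
  depsM : forall x y, eps (x * y) = eps x * eps y;
  depsdeg : forall n x, G n x -> n != 0 -> eps x = 0;
  depsK : forall u, eps (K u) = 1;
  dpl : forall b, linear (p^~ b : D -> F^o);
  dpr : forall a, linear (p a : D -> F^o);
  dpA : forall n a, A a -> G n a ->
    (forall b, B b -> G (- n) b -> p a b = 0) -> a = 0;
  dpB : forall n b, B b -> G n b ->
    (forall a, A a -> G (- n) a -> p a b = 0) -> b = 0;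
  dpdeg : forall m n a b, A a -> G m a -> B b -> G n b -> m + n != 0 ->
    p a b = 0;
  dpmull : forall i j m a a' b, A a -> G i a -> A a' -> G j a' ->
    B b -> G m b ->
    p (a * a') b =
    tlift (fun y1 y2 => p a' y1 * p a y2 : F^o) (Delta b (- j) (- i));
  dpmulr : forall i j m b b' a, B b -> G i b -> B b' -> G j b' ->
    A a -> G m a ->
    p a (b * b') =
    tlift (fun x1 x2 => p x1 b * p x2 b' : F^o) (Delta a (- i) (- j));
  dpr1 : forall a, A a -> p a 1 = eps a;
  dpl1 : forall b, B b -> p 1 b = eps b;
  dexch : forall n m a b, A a -> G n a -> B b -> G m b ->
    \sum_(i \in [set: int]) tlift (fun x1 x2 => tlift (fun y1 y2 =>
        p x1 y1 *: (y2 * x2)) (Delta b (- i) (m + i))) (Delta a i (n - i)) =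
    \sum_(i \in [set: int]) tlift (fun x1 x2 => tlift (fun y1 y2 =>
        p x2 y2 *: (x1 * y1)) (Delta b (m + i) (- i))) (Delta a (n - i) i);
  dpfac : forall a1 a2 b2 b1, A1 a1 -> A2 a2 -> B2 b2 -> B1 b1 ->
    p (a1 * a2) (b2 * b1) = p a1 b2 * p a2 b1;
  dpfac2 : forall a b u v, A2' a -> B1' b ->
    p (a * K u) (b * K v) = p a b * p (K u) (K v);
  dchir : forall v v', (forall w, p (K w) (K v) = p (K w) (K v')) -> v = v';
  dchil : forall u u', (forall w, p (K u) (K w) = p (K u') (K w)) -> u = u';
  dR1 : forall i, tspan (A1 `&` G i) (B2 `&` G (- i)) (R1 i);
  dR1l : forall i z, B2 z -> G (- i) z -> ctl (p^~ z) (R1 i) = z;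
  dR1r : forall i x, A1 x -> G i x -> ctr (p x) (R1 i) = x;
  dR2 : forall i, tspan (A2' `&` G i) (B1' `&` G (- i)) (R2 i);
  dR2l : forall i z, B1' z -> G (- i) z -> ctl (p^~ z) (R2 i) = z;
  dR2r : forall i x, A2' x -> G i x -> ctr (p x) (R2 i) = x }.

End Double.
(** * Actions of A and B on each other *)

Lemma subsp_eq (F : fieldType) (D : algType F) (V : lmodType F) (f g : D -> V) :
  linear f -> linear g -> subsp [set x | f x = g x].
Proof.
move=> fl gl; have [f0 _ _] := linP fl; have [g0 _ _] := linP gl.
split=> [|c x y /= xe ye]; first by rewrite /= f0 g0.
by rewrite fl gl xe ye.
Qed.

Section Half.
Variables (F : fieldType) (D : algType F) (G : int -> set D).
Variables (Delta : D -> ctens D) (eps : D -> F).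
Variables (r : nat) (K : 'rV[int]_r -> D) (p : D -> D -> F).
Variables (A A1 A2 A2' B B2 B1 B1' : set D) (R1 R2 : int -> tensor D D).
Hypothesis H : double_data G Delta eps K p A A1 A2 A2' B B2 B1 B1' R1 R2.

Local Notation chi u v := (p (K u) (K v)).

(** Through the pairing and the coproducts, B acts on A from both sides, and
    A on B. For homogeneous arguments the only component of the infinite
    coproduct that contributes is the one whose contracted leg has the
    degree opposite to that of the acting element; taking this component as
    the definition avoids any discussion of convergence. *)
Definition LA (m n : int) b a := ctl (p^~ b) (Delta a (- m) (n + m)).
Definition RA (m n : int) b a := ctr (p^~ b) (Delta a (n + m) (- m)).
Definition LB (n m : int) a b := ctl (p a) (Delta b (- n) (m + n)).
Definition RB (n m : int) a b := ctr (p a) (Delta b (m + n) (- n)).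

Let pl := dpl H.
Let pr := dpr H.

Lemma pDl c x y b : p (c *: x + y) b = c * p x b + p y b.
Proof. exact: (pl b). Qed.
Lemma pDr c x y a : p a (c *: x + y) = c * p a x + p a y.
Proof. exact: (pr a). Qed.
Lemma p0l b : p 0 b = 0. Proof. by have [] := linP (pl b). Qed.
Lemma p0r a : p a 0 = 0. Proof. by have [] := linP (pr a). Qed.
Lemma pZl c x b : p (c *: x) b = c * p x b.
Proof. by have [_ _ pZ] := linP (pl b); exact: pZ. Qed.
Lemma pZr c x a : p a (c *: x) = c * p a x.
Proof. by have [_ _ pZ] := linP (pr a); exact: pZ. Qed.
Lemma p_sumr I (s : seq I) (f : I -> D) a :
  p a (\sum_(i <- s) f i) = \sum_(i <- s) p a (f i).
Proof. exact: (linear_bigsum _ _ _ (pr a)). Qed.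

Lemma A_M x y : A x -> A y -> A (x * y). Proof. by case: (dAM H) => _; apply. Qed.
Lemma A1_1 : A1 1. Proof. by case: (dA1M H). Qed.
Lemma A1_M x y : A1 x -> A1 y -> A1 (x * y). Proof. by case: (dA1M H) => _; apply. Qed.
Lemma A2_M x y : A2 x -> A2 y -> A2 (x * y). Proof. by case: (dA2M H) => _; apply. Qed.
Lemma A2'_1 : A2' 1. Proof. by case: (dA2'M H). Qed.
Lemma B_M x y : B x -> B y -> B (x * y). Proof. by case: (dBM H) => _; apply. Qed.
Lemma B1_1 : B1 1. Proof. by case: (dB1M H). Qed.
Lemma B1_M x y : B1 x -> B1 y -> B1 (x * y). Proof. by case: (dB1M H) => _; apply. Qed.
Lemma B2_1 : B2 1. Proof. by case: (dB2M H). Qed.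
Lemma B2_M x y : B2 x -> B2 y -> B2 (x * y). Proof. by case: (dB2M H) => _; apply. Qed.
Lemma B1'_1 : B1' 1. Proof. by case: (dB1'M H). Qed.
Lemma KA u : A (K u). Proof. exact: (dA2A H) (dKA H u). Qed.
Lemma KB u : B (K u). Proof. exact: (dB1B H) (dKB H u). Qed.
Lemma A2'A x : A2' x -> A x. Proof. by move=> /(dA2'A H)/(dA2A H). Qed.
Lemma B1'B x : B1' x -> B x. Proof. by move=> /(dB1'B H)/(dB1B H). Qed.
Lemma GM m n k x y : G m x -> G n y -> m + n = k -> G k (x * y).
Proof. by move=> gx gy <-; exact: (dGM H). Qed.
Lemma GMK n x u : G n x -> G n (x * K u).
Proof. by move=> gx; apply: (GM gx (dKG H u)); rewrite addr0. Qed.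
Lemma GKM n x u : G n x -> G n (K u * x).
Proof. by move=> gx; apply: (GM (dKG H u) gx); rewrite add0r. Qed.
Lemma KN u : K u * K (- u) = 1. Proof. by rewrite -(dKD H) subrr (dK0 H). Qed.
Lemma NK u : K (- u) * K u = 1. Proof. by rewrite -(dKD H) addNr (dK0 H). Qed.
Lemma pdeg m n a b : A a -> G m a -> B b -> G n b -> m + n != 0 -> p a b = 0.
Proof. exact: (dpdeg H). Qed.

Lemma pairing_eqA n x y : A x -> G n x -> A y -> G n y ->
  (forall i b2 b1 u, B2 b2 -> G i b2 -> B1' b1 -> G (- n - i) b1 ->
     p x (b2 * b1 * K u) = p y (b2 * b1 * K u)) -> x = y.
Proof.
move=> Ax gx Ay gy xy; apply/eqP; rewrite -subr_eq0; apply/eqP.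
have e : x - y = -1 *: y + x by rewrite scaleN1r addrC.
apply: (dpA H (n := n)); rewrite e; [exact: (dA H).2|exact: (dG H _).2|].
apply: (dB_ind H (P := fun b => p (-1 *: y + x) b = 0)).
  by apply: (subsp_eq (V := F^o) (g := fun=> 0)) => // c u v; rewrite ?pDr ?scaler0 ?addr0.
by move=> i b2 b1 u b2B gb2 b1B gb1; rewrite pDl (xy i) // mulN1r addNr.
Qed.

Lemma pairing_eqB n x y : B x -> G n x -> B y -> G n y ->
  (forall i a1 a2 u, A1 a1 -> G i a1 -> A2' a2 -> G (- n - i) a2 ->
     p (a1 * a2 * K u) x = p (a1 * a2 * K u) y) -> x = y.
Proof.
move=> Ax gx Ay gy xy; apply/eqP; rewrite -subr_eq0; apply/eqP.
have e : x - y = -1 *: y + x by rewrite scaleN1r addrC.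
apply: (dpB H (n := n)); rewrite e; [exact: (dB H).2|exact: (dG H _).2|].
apply: (dA_ind H (P := fun b => p b (-1 *: y + x) = 0)).
  by apply: (subsp_eq (V := F^o) (f := p^~ _) (g := fun=> 0)) => // c u v; rewrite ?scaler0 ?addr0.
by move=> i b2 b1 u b2B gb2 b1B gb1; rewrite pDr (xy i) // mulN1r addNr.
Qed.

Let subAG n : subsp (A `&` G n) := subspI (dA H) (dG H n).
Let subBG n : subsp (B `&` G n) := subspI (dB H) (dG H n).

Lemma LA_A m n b a : A a -> A (LA m n b a).
Proof. by move=> /(dDA H (- m) (n + m))/(ctl_subsp (pl b) (subAG _))[]. Qed.
Lemma LA_G m n b a : A a -> G (n + m) (LA m n b a).
Proof. by move=> /(dDA H (- m) (n + m))/(ctl_subsp (pl b) (subAG _))[]. Qed.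
Lemma LA_A1 m n b a : A1 a -> A1 (LA m n b a).
Proof.
move=> /(dDA1 H (- m) (n + m)).
by move=> /(ctl_subsp (pl b) (subspI (dA1 H) (dG H _)))[].
Qed.
Lemma RA_A m n b a : A a -> A (RA m n b a).
Proof. by move=> /(dDA H (n + m) (- m))/(ctr_subsp (pl b) (subAG _))[]. Qed.
Lemma RA_G m n b a : A a -> G (n + m) (RA m n b a).
Proof. by move=> /(dDA H (n + m) (- m))/(ctr_subsp (pl b) (subAG _))[]. Qed.
Lemma RA_A2 m n b a : A2 a -> A2 (RA m n b a).
Proof.
move=> /(dDA2 H (n + m) (- m)).
by move=> /(ctr_subsp (pl b) (subspI (dA2 H) (dG H _)))[].
Qed.
Lemma LB_B m n b a : B a -> B (LB m n b a).
Proof. by move=> /(dDB H (- m) (n + m))/(ctl_subsp (pr b) (subBG _))[]. Qed.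
Lemma LB_G m n b a : B a -> G (n + m) (LB m n b a).
Proof. by move=> /(dDB H (- m) (n + m))/(ctl_subsp (pr b) (subBG _))[]. Qed.
Lemma LB_B1 m n b a : B1 a -> B1 (LB m n b a).
Proof.
move=> /(dDB1 H (- m) (n + m)).
by move=> /(ctl_subsp (pr b) (subspI (dB1 H) (dG H _)))[].
Qed.
Lemma RB_B m n b a : B a -> B (RB m n b a).
Proof. by move=> /(dDB H (n + m) (- m))/(ctr_subsp (pr b) (subBG _))[]. Qed.
Lemma RB_G m n b a : B a -> G (n + m) (RB m n b a).
Proof. by move=> /(dDB H (n + m) (- m))/(ctr_subsp (pr b) (subBG _))[]. Qed.
Lemma RB_B2 m n b a : B2 a -> B2 (RB m n b a).
Proof.
move=> /(dDB2 H (n + m) (- m)).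
by move=> /(ctr_subsp (pr b) (subspI (dB2 H) (dG H _)))[].
Qed.

(** Each action is adjoint to a multiplication. Together with the
    nondegeneracy of the pairing this is how identities between the actions
    are checked below. *)
Lemma LA_adj m n k a b b' : A a -> G n a -> B b -> G m b -> B b' -> G k b' ->
  p (LA m n b a) b' = p a (b * b').
Proof.
move=> Aa ga Bb gb Bb' gb'; have [e|ne] := eqVneq (n + m + k) 0; last first.
  rewrite (pdeg (LA_A _ _ _ Aa) (LA_G _ _ _ Aa) Bb' gb') //.
  rewrite (pdeg Aa ga (B_M Bb Bb') (dGM H gb gb')) //; lia.
rewrite (dpmulr H Bb gb Bb' gb' Aa ga) /LA (_ : n + m = - k); last lia.
rewrite [LHS](linear_tlift (h := p^~ b' : D -> F^o)) //; last exact: ctl_bil.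
by apply: (tlift_eq (U := F^o)) => x y; rewrite pZl.
Qed.

Lemma RA_adj m n k a b b' : A a -> G n a -> B b -> G m b -> B b' -> G k b' ->
  p (RA m n b a) b' = p a (b' * b).
Proof.
move=> Aa ga Bb gb Bb' gb'; have [e|ne] := eqVneq (n + m + k) 0; last first.
  rewrite (pdeg (RA_A _ _ _ Aa) (RA_G _ _ _ Aa) Bb' gb') //.
  rewrite (pdeg Aa ga (B_M Bb' Bb) (dGM H gb' gb)) //; lia.
rewrite (dpmulr H Bb' gb' Bb gb Aa ga) /RA (_ : n + m = - k); last lia.
rewrite [LHS](linear_tlift (h := p^~ b' : D -> F^o)) //; last exact: ctr_bil.
by apply: (tlift_eq (U := F^o)) => x y; rewrite pZl mulrC.
Qed.

Lemma LB_adj m n k a b b' : B a -> G n a -> A b -> G m b -> A b' -> G k b' ->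
  p b' (LB m n b a) = p (b' * b) a.
Proof.
move=> Aa ga Bb gb Bb' gb'; have [e|ne] := eqVneq (n + m + k) 0; last first.
  rewrite (pdeg Bb' gb' (LB_B _ _ _ Aa) (LB_G _ _ _ Aa)); last lia.
  rewrite (pdeg (A_M Bb' Bb) (dGM H gb' gb) Aa ga) //; lia.
rewrite (dpmull H Bb' gb' Bb gb Aa ga) /LB (_ : n + m = - k); last lia.
rewrite [LHS](linear_tlift (h := p b' : D -> F^o)) //; last exact: ctl_bil.
by apply: (tlift_eq (U := F^o)) => x y; rewrite pZr.
Qed.

Lemma RB_adj m n k a b b' : B a -> G n a -> A b -> G m b -> A b' -> G k b' ->
  p b' (RB m n b a) = p (b * b') a.
Proof.
move=> Aa ga Bb gb Bb' gb'; have [e|ne] := eqVneq (n + m + k) 0; last first.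
  rewrite (pdeg Bb' gb' (RB_B _ _ _ Aa) (RB_G _ _ _ Aa)); last lia.
  rewrite (pdeg (A_M Bb Bb') (dGM H gb gb') Aa ga) //; lia.
rewrite (dpmull H Bb gb Bb' gb' Aa ga) /RB (_ : n + m = - k); last lia.
rewrite [LHS](linear_tlift (h := p b' : D -> F^o)) //; last exact: ctr_bil.
by apply: (tlift_eq (U := F^o)) => x y; rewrite pZr mulrC.
Qed.

Lemma chiDl u u' v : chi (u + u') v = chi u v * chi u' v.
Proof.
rewrite (dKD H) (dpmull H (KA u) (dKG H u) (KA u') (dKG H u') (KB v) (dKG H v)).
rewrite oppr0 (dDK H) /chom eqxx /= tlift_tens; first by rewrite mulrC.
exact: bil_mulF.
Qed.

Lemma chiDr u v v' : chi u (v + v') = chi u v * chi u v'.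
Proof.
rewrite (dKD H) (dpmulr H (KB v) (dKG H v) (KB v') (dKG H v') (KA u) (dKG H u)).
rewrite oppr0 (dDK H) /chom eqxx /= tlift_tens //.
exact: (bil_mulF (phi := p^~ _) (psi := p^~ _)).
Qed.

Lemma chi0l v : chi 0 v = 1.
Proof. by rewrite (dK0 H) (dpl1 H (KB v)) (depsK H). Qed.

Lemma chi0r u : chi u 0 = 1.
Proof. by rewrite (dK0 H) (dpr1 H (KA u)) (depsK H). Qed.

Lemma chiNl u v : chi (- u) v * chi u v = 1.
Proof. by rewrite -chiDl addNr chi0l. Qed.

Lemma chiNr u v : chi u (- v) * chi u v = 1.
Proof. by rewrite -chiDr addNr chi0r. Qed.

Lemma chiNN u v : chi (- u) v = chi u (- v).
Proof.
by rewrite -[LHS]mulr1 -(chiNr u v) mulrCA [_ * chi u v]chiNl mulr1.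
Qed.

(** The factorization of the pairing with one factor equal to 1: on the
    subalgebras that are not paired with each other only the counits remain. *)
Lemma p_A2 a b2 b1 : A2 a -> B2 b2 -> B1 b1 -> p a (b2 * b1) = eps b2 * p a b1.
Proof.
move=> a1 bb2 bb1; rewrite -{1}[a]mul1r (dpfac H) //; last exact: A1_1.
by rewrite (dpl1 H) //; exact: (dB2B H).
Qed.

Lemma p_B2 a1 a2 b : A1 a1 -> A2 a2 -> B2 b -> p (a1 * a2) b = p a1 b * eps a2.
Proof.
move=> aa1 aa2 b2; rewrite -{1}[b]mulr1 (dpfac H) //; last exact: B1_1.
by rewrite (dpr1 H) //; exact: (dA2A H).
Qed.

Lemma p_B1 a1 a2 b : A1 a1 -> A2 a2 -> B1 b -> p (a1 * a2) b = eps a1 * p a2 b.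
Proof.
move=> aa1 aa2 b2; rewrite -{1}[b]mul1r (dpfac H) //; last exact: B2_1.
by rewrite (dpr1 H) //; exact: (dA1A H).
Qed.

Lemma p_full a1 a2 u b2 b1 v : A1 a1 -> A2' a2 -> B2 b2 -> B1' b1 ->
  p (a1 * a2 * K u) (b2 * b1 * K v) = p a1 b2 * p a2 b1 * chi u v.
Proof.
move=> ? a2' ? b1'; rewrite -!mulrA (dpfac H) //.
- by rewrite (dpfac2 H) // mulrA.
- exact: A2_M (dA2'A H a2') (dKA H _).
- exact: B1_M (dB1'B H b1') (dKB H _).
Qed.

(** Weights for the right multiplication by the K_w, read through the
    pairing. The elements of A1 and B2 have weight 0, and those of A2' K_u
    and B1' K_u have weight u, by the factorization of the pairing. *)
Definition rwA u a := forall n b w, B b -> G n b ->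
  p a (b * K w) = chi u w * p a b.
Definition lwB w b := forall n a u, A a -> G n a ->
  p (a * K u) b = chi u w * p a b.

Lemma rwA_prod a1 a2 u : A1 a1 -> A2' a2 -> rwA u (a1 * a2 * K u).
Proof.
move=> aa1 aa2 n b w Bb gb; move: b Bb gb.
apply: (dB_ind H (P := [set b | p (a1 * a2 * K u) (b * K w) =
  chi u w * p (a1 * a2 * K u) b])) => [|i b2 b1 v ? _ ? _ /=].
  apply: (subsp_eq (V := F^o)).
    exact: (lin_comp (g := p _ : D -> F^o) (pr _) (lin_mulr _)).
  by move=> c x y; rewrite pDr mulrDr /=; congr (_ + _); rewrite mulrCA.
by rewrite -[_ * K v * K w]mulrA -(dKD H) !p_full // chiDr; ring.
Qed.

Lemma lwB_prod b2 b1 w : B2 b2 -> B1' b1 -> lwB w (b2 * b1 * K w).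
Proof.
move=> aa1 aa2 n a u Aa ga; move: a Aa ga.
apply: (dA_ind H (P := [set a | p (a * K u) (b2 * b1 * K w) =
  chi u w * p a (b2 * b1 * K w)])) => [|i a1 a2 v ? _ ? _ /=].
  apply: (subsp_eq (V := F^o)).
    exact: (lin_comp (g := p^~ _ : D -> F^o) (pl _) (lin_mulr _)).
  by move=> c x y; rewrite pDl mulrDr /=; congr (_ + _); rewrite mulrCA.
by rewrite -[_ * K v * K u]mulrA -(dKD H) !p_full // chiDl; ring.
Qed.

Lemma rwA1 a : A1 a -> rwA 0 a.
Proof.
by move=> a1; rewrite -[a]mulr1 -[1](dK0 H) -[a]mulr1; apply: rwA_prod => //; exact: A2'_1.
Qed.

Lemma rwA2 a u : A2' a -> rwA u (a * K u).
Proof. by move=> a2; rewrite -[a]mul1r; apply: rwA_prod => //; exact: A1_1. Qed.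

Lemma lwB2 b : B2 b -> lwB 0 b.
Proof.
by move=> a1; rewrite -[b]mulr1 -[1](dK0 H) -[b]mulr1; apply: lwB_prod => //; exact: B1'_1.
Qed.

Lemma lwB1 b w : B1' b -> lwB w (b * K w).
Proof. by move=> a2; rewrite -[b]mul1r; apply: lwB_prod => //; exact: B2_1. Qed.

End Half.
(** * Weight decompositions *)

Section Characters.
Variables (F : fieldType) (D : algType F) (Z : zmodType) (f : Z -> Z -> F).
Hypothesis fD : forall w w' v, f (w + w') v = f w v * f w' v.
Hypothesis f0 : forall v, f 0 v = 1.
Hypothesis fI : forall v v', (forall w, f w v = f w v') -> v = v'.

(** Artin's independence of distinct characters, modulo a subspace P. *)
Lemma char_indep (P : set D) (s : seq Z) (x : Z -> D) : subsp P -> uniq s ->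
  (forall w, P (\sum_(v <- s) f w v *: x v)) -> forall v, v \in s -> P (x v).
Proof.
move=> PP; elim: s x => [|v0 s IHs] x //= /andP[v0s us] Px.
have Ps v : v \in s -> P (x v).
  move=> vs; have [w0 w0P] : exists w0, f w0 v != f w0 v0.
    apply: contrapT => nw; move: v0s; rewrite -(fI (v := v) (v' := v0)) ?vs // => w.
    by apply/eqP/negPn/negP => wP; apply: nw; exists w.
  suff : P ((f w0 v - f w0 v0) *: x v).
    move=> /(subspZ (f w0 v - f w0 v0)^-1 PP).
    by rewrite scalerA mulVf ?scale1r // subr_eq0.
  apply: (IHs (fun v => (f w0 v - f w0 v0) *: x v)) => // w.
  (* The relation at w + w0 minus f w0 v0 times the relation at w no longer
     involves the term of v0. *)
  have := PP.2 (- f w0 v0) _ _ (Px w) (Px (w + w0)).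
  rewrite !big_cons scalerDr addrACA scalerA fD mulrC mulrN -scalerDl addNr.
  rewrite scale0r add0r scaler_sumr -big_split /=; congr (P _).
  apply: eq_bigr => v' _; rewrite fD !scalerA -scalerDl; congr (_ *: _); ring.
move=> v; rewrite inE => /orP[/eqP ->|/Ps //].
have := Px 0; rewrite big_cons f0 scale1r => PS.
have -> : x v0 = -1 *: \sum_(v <- s) f 0 v *: x v +
    (x v0 + \sum_(v <- s) f 0 v *: x v).
  by rewrite scaleN1r addrC addrK.
by apply: PP.2 => //; apply: subsp_sum => // v' /Ps; exact: subspZ.
Qed.

(** If the orbit of x under an action of Z is a combination of characters,
    then independence of characters, applied to the orbits of the
    coefficients, shows that these are eigenvectors; and x is their sum. *)
Lemma char_split (T : Z -> D -> D) (P Q : set D) (s : seq (Z * D)) x :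
  (forall w, linear (T w)) -> (forall y, T 0 y = y) ->
  (forall w w' y, T (w + w') y = T w (T w' y)) ->
  subsp P -> subsp Q -> (forall q, q \in s -> P q.2) ->
  (forall w, T w x = \sum_(q <- s) f w q.1 *: q.2) ->
  (forall v y, P y -> (forall w, T w y = f w v *: y) -> Q y) -> Q x.
Proof.
move=> Tl T0 TD PP QQ Ps Tx HQ.
pose S := undup (map fst s); pose xv v := \sum_(q <- s | q.1 == v) q.2.
have Tx' w : T w x = \sum_(v <- S) f w v *: xv v.
  rewrite Tx; under [RHS]eq_bigr => v _ do rewrite scaler_sumr.
  rewrite (exchange_big_dep xpredT) //=; apply: eq_big_seq => q qs.
  have qS : q.1 \in S by rewrite mem_undup map_f.
  rewrite big_mkcond (bigD1_seq q.1) ?undup_uniq //= eqxx big1 ?addr0 // => v.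
  by rewrite eq_sym => /negbTE ->.
have TxvE w' v : v \in S -> T w' (xv v) = f w' v *: xv v.
  move=> vS; apply/eqP; rewrite -subr_eq0; apply/eqP.
  have S0 : subsp [set y : D | y = 0].
    by split=> // c y z /= -> ->; rewrite scaler0 addr0.
  apply: (char_indep (x := fun v => T w' (xv v) - f w' v *: xv v) S0 _ _ vS).
    exact: undup_uniq.
  move=> w /=; under eq_bigr => v' _ do rewrite scalerBr.
  rewrite sumrB; apply/eqP; rewrite subr_eq0; apply/eqP.
  have [_ _ TZ] := linP (Tl w').
  under eq_bigr => v' _ do rewrite -TZ.
  rewrite -(linear_bigsum _ _ _ (Tl w')) -Tx' -TD addrC Tx'.
  by apply: eq_bigr => v' _; rewrite fD scalerA.
have -> : x = \sum_(v <- S) xv v.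
  by rewrite -[LHS]T0 Tx'; apply: eq_bigr => v _; rewrite f0 scale1r.
apply: subsp_sum => // v vS; apply: (HQ v) => [|w]; last exact: TxvE.
by rewrite /xv -big_filter; apply: subsp_sum => // q; rewrite mem_filter => /andP[_ /Ps].
Qed.

End Characters.

Section Weights.
Variables (F : fieldType) (D : algType F) (G : int -> set D).
Variables (Delta : D -> ctens D) (eps : D -> F).
Variables (r : nat) (K : 'rV[int]_r -> D) (p : D -> D -> F).
Variables (A A1 A2 A2' B B2 B1 B1' : set D) (R1 R2 : int -> tensor D D).
Hypothesis H : double_data G Delta eps K p A A1 A2 A2' B B2 B1 B1' R1 R2.

Local Notation chi u v := (p (K u) (K v)).
Local Notation LA := (LA Delta p).
Local Notation RA := (RA Delta p).
Local Notation LB := (LB Delta p).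
Local Notation RB := (RB Delta p).
Let pl := dpl H.
Let pr := dpr H.

(** Weight vectors for the conjugation by the K_w. The parameter of the
    character is put in the second or in the first argument of the pairing
    of the K_u, according to the leg of a tensor where the vector stands:
    the conjugation by R0 sends x (x) y, for x of weight v in the first
    sense and y of weight u in the second, to x K_(-u) (x) K_(-v) y. *)
Definition wtI v x := forall w, x * K w = chi w v *: (K w * x).
Definition wtII u x := forall w, x * K w = chi u w *: (K w * x).

Lemma wtI_M v v' x x' : wtI v x -> wtI v' x' -> wtI (v + v') (x * x').
Proof.
move=> hx hx' w; rewrite -mulrA hx' -scalerAr [x * (_ * _)]mulrA hx -!scalerAl scalerA.
by rewrite -mulrA (chiDr H) mulrC.
Qed.

Lemma wtI_K u : wtI 0 (K u).
Proof. by move=> w; rewrite (chi0r H) scale1r -!(dKD H) addrC. Qed.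

Lemma wtII_MK u x v : wtII u x -> wtII u (x * K v).
Proof.
move=> hx w; rewrite -mulrA -(dKD H) addrC (dKD H) mulrA hx -scalerAl.
by rewrite -mulrA.
Qed.

Let T w x := K (- w) * x * K w.
Let Tl w : linear (T w).
Proof. exact: (lin_comp (lin_mulr _) (lin_mull _)). Qed.
Let T0 x : T 0 x = x. Proof. by rewrite /T oppr0 (dK0 H) mul1r mulr1. Qed.
Let TD w w' x : T (w + w') x = T w (T w' x).
Proof. by rewrite /T opprD [w + _]addrC !(dKD H) !mulrA. Qed.

Let DK0 w i j : i != 0 -> Delta (K w) i j = 0.
Proof. by move=> i0; rewrite (dDK H) /chom /= (negbTE i0). Qed.

Let DK w : Delta (K w) 0 0 = tens (K w) (K w).
Proof. by rewrite (dDK H). Qed.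

Lemma linLB n m b : linear (fun x => LB n m x b).
Proof. by apply: (ctl_linphi (phi := p)). Qed.
Lemma linRB n m b : linear (fun x => RB n m x b).
Proof. by apply: (ctr_linphi (phi := p)). Qed.
Lemma linLA n m b : linear (fun x => LA n m x b).
Proof. by apply: (ctl_linphi (phi := fun x => p^~ x)). Qed.
Lemma linRA n m b : linear (fun x => RA n m x b).
Proof. by apply: (ctr_linphi (phi := fun x => p^~ x)). Qed.

(** The common value <a1, b1> b2 a2 = a1 b1 <a2, b2> of the two sides of the
    exchange relation. Contracting the coproduct of a or that of b first
    gives two forms of each side. *)
Definition psi (n m : int) (a b : D) : D :=
  \sum_(i \in [set: int])
    tlift (fun x1 x2 => LB i m x1 b * x2) (Delta a i (n - i)).

Lemma psi_LA n m a b : psi n m a b = \sum_(i \in [set: int])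
  tlift (fun y1 y2 => y2 * LA (- i) n y1 a) (Delta b (- i) (m + i)).
Proof.
apply: eq_fsum => i; rewrite /LB /LA opprK.
transitivity (tlift (fun x1 x2 => tlift (fun y1 y2 =>
        p x1 y1 *: (y2 * x2)) (Delta b (- i) (m + i))) (Delta a i (n - i))).
  apply: tlift_eq => x y.
  rewrite [LHS](linear_tlift (h := fun z => z * y)); last 2 first.
  - exact: lin_mulr.
  - exact: ctl_bil.
  by apply: tlift_eq => x' y'; rewrite scalerAl.
rewrite tlift_exch; last 2 first.
- by move=> x y; exact: (bil_scl (pr x) (lin_mulr y)).
- by move=> x y; exact: (bil_scl (pl x) (lin_mull y)).
apply: tlift_eq => x y.
rewrite [RHS](linear_tlift (h := fun z => y * z)); last 2 first.
- exact: lin_mull.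
- exact: ctl_bil.
by apply: tlift_eq => x' y'; rewrite scalerAr.
Qed.

Let rhs_RA n m a b i : tlift (fun x1 x2 => tlift (fun y1 y2 =>
        p x2 y2 *: (x1 * y1)) (Delta b (m + i) (- i))) (Delta a (n - i) i) =
  tlift (fun y1 y2 => RA (- i) n y2 a * y1) (Delta b (m + i) (- i)).
Proof.
rewrite tlift_exch; last 2 first.
- by move=> x y; exact: (bil_scr (pr y) (lin_mull x)).
- by move=> x y; exact: (bil_scr (pl y) (lin_mulr x)).
apply: tlift_eq => x y; rewrite /RA opprK.
rewrite [RHS](linear_tlift (h := fun z => z * x)); last 2 first.
- exact: lin_mulr.
- exact: ctr_bil.
by apply: tlift_eq => x' y'; rewrite scalerAl.
Qed.

Let rhs_RB n m a b i : tlift (fun x1 x2 => tlift (fun y1 y2 =>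
        p x2 y2 *: (x1 * y1)) (Delta b (m + i) (- i))) (Delta a (n - i) i) =
  tlift (fun x1 x2 => x1 * RB i m x2 b) (Delta a (n - i) i).
Proof.
apply: tlift_eq => x y; rewrite /RB.
rewrite [RHS](linear_tlift (h := fun z => x * z)); last 2 first.
- exact: lin_mull.
- exact: ctr_bil.
by apply: tlift_eq => x' y'; rewrite scalerAr.
Qed.

Lemma psi_RB n m a b : A a -> G n a -> B b -> G m b ->
  psi n m a b = \sum_(i \in [set: int])
    tlift (fun x1 x2 => x1 * RB i m x2 b) (Delta a (n - i) i).
Proof.
move=> Aa ga Bb gb; under [RHS]eq_fsum => i do rewrite -rhs_RB.
rewrite -(dexch H) //; apply: eq_fsum => i; apply: tlift_eq => x y.
rewrite [LHS](linear_tlift (h := fun z => z * y)); last 2 first.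
- exact: lin_mulr.
- exact: ctl_bil.
by apply: tlift_eq => x' y'; rewrite scalerAl.
Qed.

Lemma psi_RA n m a b : A a -> G n a -> B b -> G m b ->
  psi n m a b = \sum_(i \in [set: int])
    tlift (fun y1 y2 => RA (- i) n y2 a * y1) (Delta b (m + i) (- i)).
Proof.
move=> Aa ga Bb gb; rewrite psi_RB //; apply: eq_fsum => i.
by rewrite -rhs_RA -rhs_RB.
Qed.

(** The exchange relation for b = K_w: the conjugation by K_w transforms one
    of the two actions of K_w on A into the other. *)
Lemma exchK_A n a w : A a -> G n a -> K w * LA 0 n (K w) a = RA 0 n (K w) a * K w.
Proof.
move=> Aa ga; have := psi_RA Aa ga (KB H w) (dKG H w).
rewrite psi_LA (fsum_single (i0 := 0)) => [|i i0]; last first.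
  rewrite DK0 ?oppr_eq0 // tlift0 //; exact: (bil_mul' (@lin_id _ _) (linLA _ _ _)).
rewrite (fsum_single (i0 := 0)) => [|i i0]; last first.
  rewrite DK0 ?add0r // tlift0 //.
  exact: bil_mul' (linRA _ _ _) (@lin_id _ _).
rewrite oppr0 addr0 DK !tlift_tens //.
  exact: bil_mul' (@lin_id _ _) (linLA _ _ _).
exact: bil_mul' (linRA _ _ _) (@lin_id _ _).
Qed.

Lemma RA_rw n a u w : A a -> G n a -> rwA G K p B u a ->
  RA 0 n (K w) a = chi u w *: a.
Proof.
move=> Aa ga ua; apply: (pairing_eqA H (n := n)).
- exact: (RA_A H _ _ _ Aa).
- by have := RA_G H 0 n (K w) Aa; rewrite addr0.
- exact: subspZ (dA H) Aa.
- exact: subspZ (dG H n) ga.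
move=> i b2 b1 v b2B gb2 b1B gb1.
have Bb : B (b2 * b1 * K v).
  apply: (B_M H); last exact: KB H v.
  by apply: (B_M H); [exact: (dB2B H)|exact: (B1'B H b1B)].
have gb : G (i + (- n - i)) (b2 * b1 * K v) := GMK H _ (dGM H gb2 gb1).
rewrite (RA_adj H Aa ga (KB H w) (dKG H w) Bb gb) (pZl H).
exact: ua Bb gb.
Qed.

(** For an element of right weight 0 the exchange relation computes the
    conjugation by K_w from the coproduct. This makes the orbit of a under
    conjugation a combination of characters. *)
Lemma LA_rw n a w : A a -> G n a -> rwA G K p B 0 a -> LA 0 n (K w) a = T w a.
Proof.
move=> Aa ga ra; have := exchK_A w Aa ga; rewrite (RA_rw _ Aa ga ra) (chi0l H).
by rewrite scale1r => e; rewrite /T -mulrA -e mulrA (NK H) mul1r.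
Qed.

Lemma p_A0 x : A x -> G 0 x -> exists s : seq (F * 'rV[int]_r),
  forall w, p x (K w) = \sum_(q <- s) q.1 * chi q.2 w.
Proof.
move: x; apply: (dA_ind H (P := [set x | exists s : seq (F * 'rV[int]_r),
  forall w, p x (K w) = \sum_(q <- s) q.1 * chi q.2 w])).
  split=> [|c x y [s sx] [s' sy]].
    by exists [::] => w; rewrite (p0l H) big_nil.
  exists ([seq (c * q.1, q.2) | q <- s] ++ s') => w.
  rewrite (pDl H) sx sy big_cat big_map mulr_sumr; congr (_ + _).
  by apply: eq_bigr => q _; rewrite mulrA.
move=> i a1 a2 u a1A _ a2A _; exists [:: (p a1 1 * p a2 1, u)] => w.
rewrite big_seq1 -{1}[K w]mul1r -{1}[1]mul1r.
by rewrite (p_full H) //; [exact: (B2_1 H)|exact: (B1'_1 H)].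
Qed.

Lemma p_B0 x : B x -> G 0 x -> exists s : seq (F * 'rV[int]_r),
  forall w, p (K w) x = \sum_(q <- s) q.1 * chi w q.2.
Proof.
move: x; apply: (dB_ind H (P := [set x | exists s : seq (F * 'rV[int]_r),
  forall w, p (K w) x = \sum_(q <- s) q.1 * chi w q.2])).
  split=> [|c x y [s sx] [s' sy]].
    by exists [::] => w; rewrite (p0r H) big_nil.
  exists ([seq (c * q.1, q.2) | q <- s] ++ s') => w.
  rewrite (pDr H) sx sy big_cat big_map mulr_sumr; congr (_ + _).
  by apply: eq_bigr => q _; rewrite mulrA.
move=> i a1 a2 u a1A _ a2A _; exists [:: (p 1 a1 * p 1 a2, u)] => w.
rewrite big_seq1 -{1}[K w]mul1r -{1}[1]mul1r.
by rewrite (p_full H) //; [exact: (A1_1 H)|exact: (A2'_1 H)].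
Qed.

Lemma ctl_chars T' t : tspan (A `&` G 0) T' t ->
  exists s : seq ('rV[int]_r * D),
    (forall q, q \in s -> exists2 x, T' x & exists c, q.2 = c *: x) /\
  forall w, ctl (p^~ (K w)) t = \sum_(q <- s) chi q.1 w *: q.2.
Proof.
move=> [s [Hs ->]].
elim: s Hs => [|[x y] s IHs] Hs.
  by exists [::]; split=> // w; rewrite !big_nil; have [-> _ _] := linP (ctl_lin (pl (K w))).
have [|s1 [Hs1 s1E]] := IHs.
  by move=> q qs; apply: Hs; rewrite inE qs orbT.
have [[/= Ax gx] Ty] := Hs _ (mem_head _ _).
have [s2 s2E] := p_A0 Ax gx.
exists ([seq (q.2, q.1 *: y) | q <- s2] ++ s1); split=> [q|w].
  rewrite mem_cat => /orP[/mapP[q' _ ->]|/Hs1 //]; exists y => //.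
  by exists q'.1.
rewrite big_cons big_cat big_map /=; have [_ -> _] := linP (ctl_lin (pl (K w))).
rewrite s1E /ctl tlift_tens; last exact: ctl_bil.
rewrite s2E scaler_suml; congr (_ + _); apply: eq_bigr => q _.
by rewrite scalerA mulrC.
Qed.

Lemma ctr_chars T' t : tspan T' (B `&` G 0) t ->
  exists s : seq ('rV[int]_r * D),
    (forall q, q \in s -> exists2 x, T' x & exists c, q.2 = c *: x) /\
  forall w, ctr (p (K w)) t = \sum_(q <- s) chi w q.1 *: q.2.
Proof.
move=> [s [Hs ->]].
elim: s Hs => [|[y x] s IHs] Hs.
  by exists [::]; split=> // w; rewrite !big_nil; have [-> _ _] := linP (ctr_lin (pr (K w))).
have [|s1 [Hs1 s1E]] := IHs.
  by move=> q qs; apply: Hs; rewrite inE qs orbT.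
have [Ty [/= Bx gx]] := Hs _ (mem_head _ _).
have [s2 s2E] := p_B0 Bx gx.
exists ([seq (q.2, q.1 *: y) | q <- s2] ++ s1); split=> [q|w].
  rewrite mem_cat => /orP[/mapP[q' _ ->]|/Hs1 //]; exists y => //.
  by exists q'.1.
rewrite big_cons big_cat big_map /=; have [_ -> _] := linP (ctr_lin (pr (K w))).
rewrite s1E /ctr tlift_tens; last exact: ctr_bil.
rewrite s2E scaler_suml; congr (_ + _); apply: eq_bigr => q _.
by rewrite scalerA mulrC.
Qed.

Lemma T_wt (chi' : 'rV[int]_r -> F) y :
  (forall w, T w y = chi' w *: y) -> forall w, y * K w = chi' w *: (K w * y).
Proof. by move=> Ty w; rewrite scalerAr -Ty /T !mulrA (KN H) mul1r. Qed.

(** The orbit of a under conjugation is obtained by pairing the left leg of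
    Delta(a), of degree 0, with the K_w; its coefficients are characters
    chi(u, w) of w. *)
Lemma wtII_rw n a (Q : set D) : A a -> G n a -> rwA G K p B 0 a -> subsp Q ->
  (forall u y, A y -> G n y -> wtII u y -> Q y) -> Q a.
Proof.
move=> Aa ga ra QQ HQ.
have /ctl_chars[s [Hs sE]] := dDA H 0 n Aa.
apply: (@char_split _ _ _ (fun w u => chi u w) _ _ _ T (A `&` G n) Q s) => //.
- by move=> w w' v; rewrite (chiDr H).
- by move=> v; rewrite (chi0r H).
- by move=> v v' vv'; apply: (dchil H).
- exact: subspI (dA H) (dG H n).
- by move=> q /Hs[x [Ax gx] [c ->]]; split; apply: subspZ => //; [exact: dA H|exact: dG H n].
- by move=> w; rewrite -(LA_rw w Aa ga ra) /LA oppr0 addr0 sE.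
- by move=> v y [Ay gy] Ty; apply: (HQ v) => //; exact: T_wt.
Qed.

Lemma A_wtII n (Q : set D) : subsp Q ->
  (forall u y, A y -> G n y -> wtII u y -> Q y) ->
  forall x, A x -> G n x -> Q x.
Proof.
move=> QQ HQ; apply: (dA_ind H) => // i a1 a2 u a1A ga1 a2A ga2.
have Aa : A (a1 * a2) by apply: (A_M H); [exact: (dA1A H)|exact: (A2'A H a2A)].
have ga : G n (a1 * a2) by apply: (GM H ga1 ga2); lia.
have ra : rwA G K p B 0 (a1 * a2).
  by rewrite -[a1 * a2]mulr1 -(dK0 H); exact: (rwA_prod H).
apply: (wtII_rw (Q := [set x | Q (x * K u)]) Aa ga ra).
  by split=> [|c x y /= Qx Qy]; rewrite /= ?mul0r ?mulrDl -?scalerAl; case: QQ => // _; exact.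
move=> v y Ay gy wy /=; apply: (HQ v).
- exact: (A_M H) Ay (KA H u).
- exact: (GMK H).
- exact: wtII_MK.
Qed.

Let T_A n w a : A a -> G n a -> A (T w a) /\ G n (T w a).
Proof.
move=> Aa ga; split; last by apply: (GMK H); exact: (GKM H).
by apply: (A_M H); last exact: (KA H); apply: (A_M H) => //; exact: (KA H).
Qed.

Let T_A1 n w a : A1 a -> G n a -> A1 (T w a).
Proof.
move=> a1 ga; rewrite -(LA_rw w (dA1A H a1) ga (rwA1 H a1)).
exact: (LA_A1 H).
Qed.

Let T_rw n w a : A a -> G n a -> rwA G K p B 0 a -> rwA G K p B 0 (T w a).
Proof.
move=> Aa ga ra k b v Bb gb; rewrite -(LA_rw w Aa ga ra).
rewrite (LA_adj H Aa ga (KB H w) (dKG H w) (B_M H Bb (KB H v)) (GMK H v gb)).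
rewrite (LA_adj H Aa ga (KB H w) (dKG H w) Bb gb) mulrA.
exact: ra (B_M H (KB H w) Bb) (GKM H w gb).
Qed.

(** The conjugate by K_w of an element of A2' may leave A2', but its right
    weight is still 0. Elements of A2 are separated by B1, and those of
    right weight 0 even by B1', so the canonical element R2' reproduces
    them. *)
Lemma R2_canon n x : A2 x -> G n x -> rwA G K p B 0 x -> ctr (p x) (R2 n) = x.
Proof.
move=> a2 gx rx.
have [y2 gy] : A2' (ctr (p x) (R2 n)) /\ G n (ctr (p x) (R2 n)).
  exact: (ctr_subsp (pr x) (subspI (dA2' H) (dG H n)) (dR2 H n)).
have y2' := dA2'A H y2.
apply: (pairing_eqA H (n := n)) => //; [exact: (dA2A H)|exact: (dA2A H)|].
move=> i b2 b1 u b2B gb2 b1B gb1.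
have b1B' : B1 (b1 * K u) := B1_M H (dB1'B H b1B) (dKB H u).
rewrite -mulrA (p_A2 H a2 b2B b1B') (p_A2 H y2' b2B b1B'); congr (_ * _).
have Bb1 := B1'B H b1B.
have ry : rwA G K p B 0 (ctr (p x) (R2 n)).
  by rewrite -[ctr _ _]mulr1 -(dK0 H); exact: (rwA2 H).
rewrite (rx _ _ _ Bb1 gb1) (ry _ _ _ Bb1 gb1); congr (_ * _).
have [e|ne] := eqVneq (- n - i) (- n); last first.
  rewrite (pdeg H (dA2A H a2) gx Bb1 gb1) ?(pdeg H (dA2A H y2') gy Bb1 gb1) //; lia.
rewrite e in gb1; rewrite -[in RHS](dR2l H b1B gb1).
rewrite [LHS](linear_tlift (h := p^~ b1 : D -> F^o)) //; last exact: ctr_bil.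
rewrite [RHS](linear_tlift (h := p x : D -> F^o)) //; last exact: ctl_bil.
by apply: (tlift_eq (U := F^o)) => x' y'; rewrite (pZl H) (pZr H) mulrC.
Qed.

(** For weights of the first kind the characters come from the other side:
    the orbit of a is recovered from its pairing with the right legs z of a
    canonical element t, and the pairing of K_(-w) a K_w with z is that of a
    with K_(-w) acting on z. *)
Lemma wtI_gen (S Q : set D) n a t : subsp S -> A a -> G n a ->
  (forall w, ctr (p (T w a)) t = T w a) ->
  tspan (S `&` G n) [set z | [/\ B z, G (- n) z & lwB G K p A 0 z]] t ->
  subsp Q -> (forall v y, S y -> G n y -> wtI v y -> Q y) -> Q a.
Proof.
move=> SS Aa ga Ta tS QQ HQ.
suff [s [Hs sE]] : exists s : seq ('rV[int]_r * D),
    (forall q, q \in s -> (S `&` G n) q.2) /\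
    forall w, ctr (p (T w a)) t = \sum_(q <- s) chi w q.1 *: q.2.
  apply: (@char_split _ _ _ (fun w u => chi w u) _ _ _ T (S `&` G n) Q s) => //.
  - by move=> w w' v; rewrite (chiDl H).
  - by move=> v; rewrite (chi0l H).
  - by move=> v v' vv'; apply: (dchir H).
  - exact: subspI SS (dG H n).
  - by move=> w; rewrite -Ta.
  - by move=> v y [Sy gy] Ty; apply: (HQ v) => //; exact: T_wt.
have Sn := subspI SS (dG H n).
move: tS => [s [Hs ->]] {Ta}.
elim: s Hs => [|[x z] s IHs] Hs.
  by exists [::]; split=> // w; rewrite !big_nil; have [-> _ _] := linP (ctr_lin (pr (T w a))).
have [|s1 [Hs1 s1E]] := IHs.
  by move=> q qs; apply: Hs; rewrite inE qs orbT.
have [/= Sx [Bz gz wz]] := Hs _ (mem_head _ _).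
have /ctr_chars[s2 [_ s2E]] := dDB H (- n) 0 Bz.
exists ([seq (- q.1, p a q.2 *: x) | q <- s2] ++ s1); split=> [q|w].
  rewrite mem_cat => /orP[/mapP[q' _ ->]|/Hs1 //]; exact: (subspZ _ Sn Sx).
rewrite big_cons big_cat big_map /=; have [_ -> _] := linP (ctr_lin (pr (T w a))).
rewrite s1E /ctr tlift_tens; last exact: ctr_bil.
rewrite (wz n) //; last 2 first.
- exact: (A_M H) (KA H _) Aa.
- exact: (GKM H).
rewrite (chi0r H) mul1r -(RB_adj H Bz gz (KA H _) (dKG H _) Aa ga).
rewrite /RB addr0 oppr0 s2E (p_sumr H) scaler_suml; congr (_ + _).
by apply: eq_bigr => q _; rewrite (pZr H) (chiNN H) scalerA.
Qed.

Let Qs (Q : set D) (f : D -> D) : subsp Q -> linear f -> subsp [set x | Q (f x)].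
Proof.
move=> QQ fl; have [f0 _ _] := linP fl.
split=> [|c x y /= Qx Qy]; first by rewrite /= f0; case: QQ.
by rewrite fl; exact: QQ.2.
Qed.

Let A1_wtI i (Q : set D) a : subsp Q -> A1 a -> G i a ->
  (forall v y, A1 y -> G i y -> wtI v y -> Q y) -> Q a.
Proof.
move=> QQ a1A ga1; apply: (wtI_gen (S := A1) (n := i) (t := R1 i)) => //.
- exact: dA1 H.
- exact: (dA1A H).
- by move=> w; apply: (dR1r H); [exact: T_A1 ga1|exact: (T_A _ (dA1A H a1A) ga1).2].
- apply: tspan_sub (dR1 H i) => // z [b2 gz]; split=> //; first exact: (dB2B H).
  exact: (lwB2 H).
Qed.

Let A2'_wtI i (Q : set D) a : subsp Q -> A2' a -> G i a ->
  (forall v y, A2 y -> G i y -> wtI v y -> Q y) -> Q a.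
Proof.
move=> QQ a2A ga2; have a2A' := A2'A H a2A.
have ra2 : rwA G K p B 0 a by rewrite -[a]mulr1 -(dK0 H); exact: (rwA2 H).
apply: (wtI_gen (S := A2) (n := i) (t := R2 i)) => //.
- exact: dA2 H.
- move=> w; apply: R2_canon.
  + by apply: (A2_M H); [apply: (A2_M H); [exact: dKA H _|exact: (dA2'A H)]|exact: dKA H _].
  + exact: (T_A _ a2A' ga2).2.
  + exact: T_rw ga2 ra2.
- apply: tspan_sub (dR2 H i).
    by move=> z [z2 gz]; split=> //; exact: (dA2'A H).
  move=> z [b1 gz]; split=> //; first exact: (B1'B H).
  by rewrite -[z]mulr1 -(dK0 H); exact: (lwB1 H).
Qed.

Lemma A2_wtI n (Q : set D) : subsp Q ->
  (forall v y, A2 y -> G n y -> wtI v y -> Q y) ->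
  forall x, A2 x -> G n x -> Q x.
Proof.
move=> QQ HQ; apply: (dA2_ind H) => // a2 u a2A ga2.
apply: (A2'_wtI (Q := [set x | Q (x * K u)]) _ a2A ga2).
  exact: Qs (lin_mulr _).
move=> v y y2 gy wy /=; apply: (HQ (v + 0)).
- exact: (A2_M H) y2 (dKA H u).
- exact: (GMK H).
- exact: wtI_M wy (wtI_K _).
Qed.

Lemma A_wtI n (Q : set D) : subsp Q ->
  (forall v y, A y -> G n y -> wtI v y -> Q y) ->
  forall x, A x -> G n x -> Q x.
Proof.
move=> QQ HQ; apply: (dA_ind H) => // i a1 a2 u a1A ga1 a2A ga2.
apply: (A1_wtI (Q := [set x | Q (x * a2 * K u)]) _ a1A ga1).
  exact: Qs (lin_comp (lin_mulr _) (lin_mulr _)).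
move=> v1 y1 y1A gy1 wy1 /=.
apply: (A2'_wtI (Q := [set x | Q (y1 * x * K u)]) _ a2A ga2).
  exact: Qs (lin_comp (lin_mulr _) (lin_mull _)).
move=> v2 y2 y2A gy2 wy2 /=; apply: (HQ (v1 + v2 + 0)).
- apply: (A_M H); last exact: (KA H).
  by apply: (A_M H); [exact: (dA1A H)|exact: (dA2A H)].
- by apply: (GMK H); apply: (GM H gy1 gy2); lia.
- exact: wtI_M (wtI_M wy1 wy2) (wtI_K _).
Qed.

End Weights.
(** * The factors of the canonical element as operators *)

Section Factors.
Variables (F : fieldType) (D : algType F) (G : int -> set D).
Variables (Delta : D -> ctens D) (eps : D -> F).
Variables (r : nat) (K : 'rV[int]_r -> D) (p : D -> D -> F).
Variables (A A1 A2 A2' B B2 B1 B1' : set D) (R1 R2 : int -> tensor D D).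
Hypothesis H : double_data G Delta eps K p A A1 A2 A2' B B2 B1 B1' R1 R2.

Local Notation LA := (LA Delta p).
Local Notation RA := (RA Delta p).
Local Notation LB := (LB Delta p).
Local Notation RB := (RB Delta p).
Local Notation lwB := (lwB G K p A).
Let pl := dpl H.
Let pr := dpr H.

(** As operators on B, R1 and R2' are projections: by the factorization of
    the pairing, they send b2 b1 K_u, for b2 in B2 and b1 in B1', to eps(b1)
    b2 and to eps(b2) b1. *)
Definition cR1 (m : int) b := ctl (p^~ b) (R1 (- m)).
Definition cR2 (m : int) b := ctl (p^~ b) (R2 (- m)).

Lemma cR1_lin m : linear (cR1 m).
Proof. by apply: (ctl_linphi (phi := fun x => p^~ x)). Qed.
Lemma cR2_lin m : linear (cR2 m).
Proof. by apply: (ctl_linphi (phi := fun x => p^~ x)). Qed.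

Lemma cR1_B2 m b : B2 (cR1 m b).
Proof. by case: (ctl_subsp (pl b) (subspI (dB2 H) (dG H _)) (dR1 H (- m))). Qed.
Lemma cR1_G m b : G m (cR1 m b).
Proof.
by case: (ctl_subsp (pl b) (subspI (dB2 H) (dG H _)) (dR1 H (- m))); rewrite opprK.
Qed.
Lemma cR2_B1' m b : B1' (cR2 m b).
Proof. by case: (ctl_subsp (pl b) (subspI (dB1' H) (dG H _)) (dR2 H (- m))). Qed.
Lemma cR2_G m b : G m (cR2 m b).
Proof.
by case: (ctl_subsp (pl b) (subspI (dB1' H) (dG H _)) (dR2 H (- m))); rewrite opprK.
Qed.
Lemma cR1_0 m b : 0 < m -> cR1 m b = 0.
Proof. by move=> m0; apply: (dB2n H m0); [exact: cR1_B2|exact: cR1_G]. Qed.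
Lemma cR2_0 m b : m < 0 -> cR2 m b = 0.
Proof.
by move=> m0; apply: (dB1n H m0); [exact: (dB1'B H (cR2_B1' _ _))|exact: cR2_G].
Qed.
Lemma cR1_id m z : B2 z -> G m z -> cR1 m z = z.
Proof. by move=> z2 gz; apply: (dR1l H); rewrite ?opprK. Qed.
Let p_canon x b (t : tensor D D) : ctr (p x) t = x -> p x (ctl (p^~ b) t) = p x b.
Proof.
move=> xE; rewrite -[in RHS]xE.
rewrite [LHS](linear_tlift (h := p x : D -> F^o)) //; last exact: ctl_bil.
rewrite [RHS](linear_tlift (h := p^~ b : D -> F^o)) //; last exact: ctr_bil.
by apply: (tlift_eq (U := F^o)) => x' y'; rewrite (pZl H) (pZr H) mulrC.
Qed.

Lemma p_cR1 k m x b : A1 x -> G k x -> B b -> G m b -> p x (cR1 m b) = p x b.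
Proof.
move=> x1 gx Bb gb; have [e|ne] := eqVneq (k + m) 0; last first.
  have xA := dA1A H x1.
  rewrite (pdeg H xA gx Bb gb) //.
  exact: (pdeg H xA gx (dB2B H (cR1_B2 m b)) (cR1_G m b)).
by apply: p_canon; apply: (dR1r H) => //; rewrite (_ : - m = k) //; lia.
Qed.

Lemma p_cR2 k m x b : A2' x -> G k x -> B b -> G m b -> p x (cR2 m b) = p x b.
Proof.
move=> x1 gx Bb gb; have [e|ne] := eqVneq (k + m) 0; last first.
  have xA := A2'A H x1.
  rewrite (pdeg H xA gx Bb gb) //.
  exact: (pdeg H xA gx (B1'B H (cR2_B1' m b)) (cR2_G m b)).
by apply: p_canon; apply: (dR2r H) => //; rewrite (_ : - m = k) //; lia.
Qed.

Lemma eqB2 m z z' : B2 z -> G m z -> B2 z' -> G m z' ->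
  (forall x, A1 x -> G (- m) x -> p x z = p x z') -> z = z'.
Proof.
move=> bz gz bz' gz' zz'; rewrite -(cR1_id bz gz) -(cR1_id bz' gz').
apply: (tlift_eq_on (S := A1 `&` G (- m)) (T := setT)); try exact: ctl_bil.
  by move=> x y [x1 gx] _; rewrite zz'.
exact: tspan_sub (dR1 H (- m)).
Qed.

Lemma cR1_mul m2 m b2 b : B2 b2 -> G m2 b2 -> B b -> G m b ->
  cR1 (m2 + m) (b2 * b) = b2 * cR1 m b.
Proof.
move=> b2B gb2 Bb gb; have Bb2 := dB2B H b2B.
apply: (eqB2 (m := m2 + m)).
- exact: cR1_B2.
- exact: cR1_G.
- exact: (B2_M H) b2B (cR1_B2 _ _).
- exact: (dGM H) gb2 (cR1_G _ _).
move=> x x1 gx; have xA := dA1A H x1.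
rewrite (p_cR1 x1 gx (B_M H Bb2 Bb) (dGM H gb2 gb)).
rewrite -(LA_adj H xA gx Bb2 gb2 Bb gb).
rewrite -(LA_adj H xA gx Bb2 gb2 (dB2B H (cR1_B2 _ _)) (cR1_G _ _)).
by rewrite (p_cR1 (LA_A1 H _ _ _ x1) (LA_G H _ _ _ xA)).
Qed.

Lemma cR1_K m b w : B b -> G m b -> cR1 m (b * K w) = cR1 m b.
Proof.
move=> Bb gb; apply: (eqB2 (m := m)); try exact: cR1_B2; try exact: cR1_G.
move=> x x1 gx; rewrite !(p_cR1 x1 gx) //.
- by rewrite (rwA1 H x1 _ Bb gb) (chi0l H) mul1r.
- exact: (B_M H) Bb (KB H w).
- exact: (GMK H).
Qed.

(** The projection b2 b1 |-> eps(b2) b1 of B onto B1. It is the contraction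
    with the full canonical element R2 = R2' R0 of A2 and B1. Since R0 is
    not a tensor, its value is characterized by the pairing with A2. *)
Definition cR2K (m : int) (b : D) : D :=
  xget 0 [set z | [/\ B1 z, G m z & forall x, A2 x -> G (- m) x -> p x z = p x b]].

Lemma eqB1 m z z' : B1 z -> G m z -> B1 z' -> G m z' ->
  (forall x, A2 x -> G (- m) x -> p x z = p x z') -> z = z'.
Proof.
move=> bz gz bz' gz' zz'; apply: (pairing_eqB H (n := m)) => //; try exact: (dB1B H).
move=> i a1 a2 u a1A ga1 a2A ga2.
have a2K : A2 (a2 * K u) := A2_M H (dA2'A H a2A) (dKA H u).
rewrite -mulrA (p_B1 H a1A a2K bz) (p_B1 H a1A a2K bz'); have [e|ne] := eqVneq i 0; last first.
  by rewrite (depsdeg H ga1) // !mul0r.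
rewrite zz' //; apply: (GMK H); by rewrite e subr0 in ga2.
Qed.

Lemma cR2K_spec m b : B b -> G m b -> [/\ B1 (cR2K m b), G m (cR2K m b) &
  forall x, A2 x -> G (- m) x -> p x (cR2K m b) = p x b].
Proof.
move=> Bb gb; pose P := [set b : D | exists z, [/\ B1 z, G m z &
  forall x, A2 x -> G (- m) x -> p x z = p x b]].
have : P b.
  move: b Bb gb; apply: (dB_ind H) => [|i b2 b1 u b2B gb2 b1B gb1].
    split=> [|c x y [z [zB gz zE]] [z' [zB' gz' zE']]].
      exists 0; split=> //; [by case: (dB1 H)|by case: (dG H m)].
    exists (c *: z + z'); split; [exact: (dB1 H).2|exact: (dG H m).2|].
    by move=> a Aa ga; rewrite !(pDr H) zE ?zE'.
  have b1K : B1 (b1 * K u) := B1_M H (dB1'B H b1B) (dKB H u).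
  exists (eps b2 *: (b1 * K u)); split.
  - exact: subspZ (dB1 H) b1K.
  - have [e|ne] := eqVneq i 0; last first.
      by rewrite (depsdeg H gb2) // scale0r; case: (dG H m).
    by apply: subspZ (dG H m) _; apply: (GMK H); rewrite e subr0 in gb1.
  - by move=> x x2 _; rewrite -mulrA (p_A2 H) // (pZr H).
by case=> z zP; rewrite /cR2K; case: xgetP => [y _ yP|/(_ z)] //.
Qed.

Lemma cR2K_eq m b z : B b -> G m b -> B1 z -> G m z ->
  (forall x, A2 x -> G (- m) x -> p x z = p x b) -> cR2K m b = z.
Proof.
move=> Bb gb zB gz zE; have [qB gq qE] := cR2K_spec Bb gb.
by apply: (eqB1 qB gq zB gz) => x x2 gx; rewrite qE ?zE.
Qed.

Lemma cR2K_D m c b b' : B b -> G m b -> B b' -> G m b' ->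
  cR2K m (c *: b + b') = c *: cR2K m b + cR2K m b'.
Proof.
move=> Bb gb Bb' gb'; have [qB gq qE] := cR2K_spec Bb gb.
have [qB' gq' qE'] := cR2K_spec Bb' gb'.
apply: cR2K_eq; [exact: (dB H).2|exact: (dG H m).2|exact: (dB1 H).2|exact: (dG H m).2|].
by move=> x x2 gx; rewrite !(pDr H) qE ?qE'.
Qed.

Lemma cR2K_zero m : cR2K m 0 = 0.
Proof.
by apply: cR2K_eq => //; [case: (dB H)|case: (dG H m)|case: (dB1 H)|case: (dG H m)].
Qed.

Lemma cR2K_sum m I (s : seq I) (P : pred I) (f : I -> D) :
  (forall i, P i -> B (f i) /\ G m (f i)) ->
  cR2K m (\sum_(i <- s | P i) f i) = \sum_(i <- s | P i) cR2K m (f i).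
Proof.
move=> fP; suff [_ []] : B (\sum_(i <- s | P i) f i) /\
  G m (\sum_(i <- s | P i) f i) /\
  cR2K m (\sum_(i <- s | P i) f i) = \sum_(i <- s | P i) cR2K m (f i) by [].
elim: s => [|i s [Bs [gs IHs]]].
  by rewrite !big_nil cR2K_zero; split; [case: (dB H)|split=> //; case: (dG H m)].
rewrite !big_cons; case Pi: (P i) => //.
have [Bf gf] := fP i Pi; split; first exact: subspD (dB H) Bf Bs.
split; first exact: subspD (dG H m) gf gs.
by have := cR2K_D 1 Bf gf Bs gs; rewrite !scale1r IHs.
Qed.

Lemma cR2K_neg m b : m < 0 -> B b -> G m b -> cR2K m b = 0.
Proof.
by move=> m0 Bb gb; have [qB gq _] := cR2K_spec Bb gb; exact: (dB1n H m0).
Qed.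

Lemma cR2K_mul m k b c : B b -> G m b -> B1 c -> G k c ->
  cR2K (m + k) (b * c) = cR2K m b * c.
Proof.
move=> Bb gb c1 gc; have cB := dB1B H c1; have [qB gq qE] := cR2K_spec Bb gb.
apply: cR2K_eq; [exact: (B_M H)|exact: (dGM H)|exact: (B1_M H)|exact: (dGM H)|].
move=> x x2 gx; have xA := dA2A H x2.
rewrite -(RA_adj H xA gx cB gc (dB1B H qB) gq) -(RA_adj H xA gx cB gc Bb gb).
apply: qE; first exact: (RA_A2 H).
by have := RA_G H k (- (m + k)) c xA; rewrite (_ : - (m + k) + k = - m) //; lia.
Qed.

Lemma cR2K_B1 m b : B1 b -> G m b -> cR2K m b = b.
Proof. by move=> b1 gb; apply: cR2K_eq => //; exact: (dB1B H). Qed.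

(** On an element of weight w, R0 contributes the single group-like element
    K_w. *)
Lemma cR2K_lw m b w : B b -> G m b -> lwB w b -> cR2K m b = cR2 m b * K w.
Proof.
move=> Bb gb wb; apply: cR2K_eq => //.
- exact: (B1_M H) (dB1'B H (cR2_B1' _ _)) (dKB H w).
- exact: (GMK H) (cR2_G _ _).
apply: (dA2_ind H (P := [set x | p x (cR2 m b * K w) = p x b])).
  by apply: (subsp_eq (V := F^o) (f := p^~ _) (g := p^~ _)).
move=> a2 u a2A ga2 /=; rewrite (dpfac2 H) //; last exact: cR2_B1'.
by rewrite (p_cR2 a2A ga2 Bb gb) (wb _ _ _ (A2'A H a2A) ga2) mulrC.
Qed.

Lemma linLAa m n b : linear (LA m n b).
Proof. by move=> c x y; rewrite /LA (dDl H) (ctl_lin (pl b)). Qed.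
Lemma linRAa m n b : linear (RA m n b).
Proof. by move=> c x y; rewrite /RA (dDl H) (ctr_lin (pl b)). Qed.
Lemma linLBb m n b : linear (LB m n b).
Proof. by move=> c x y; rewrite /LB (dDl H) (ctl_lin (pr b)). Qed.
Lemma linRBb m n b : linear (RB m n b).
Proof. by move=> c x y; rewrite /RB (dDl H) (ctr_lin (pr b)). Qed.

Lemma LA_mul m m' n b b' a : B b -> G m b -> B b' -> G m' b' -> A a -> G n a ->
  LA (m + m') n (b * b') a = LA m' (n + m) b' (LA m n b a).
Proof.
move=> Bb gb Bb' gb' Aa ga; apply: (pairing_eqA H (n := n + (m + m'))).
- exact: (LA_A H).
- exact: (LA_G H).
- by apply: (LA_A H); exact: (LA_A H).
- by rewrite addrA; apply: (LA_G H); exact: (LA_A H).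
move=> i b2 b1 u b2B gb2 b1B gb1.
have Bc : B (b2 * b1 * K u).
  apply: (B_M H); last exact: (KB H u).
  by apply: (B_M H); [exact: (dB2B H)|exact: (B1'B H b1B)].
have gc := GMK H u (dGM H gb2 gb1).
have gL : G (n + m) (LA m n b a) := LA_G H _ _ _ Aa.
rewrite (LA_adj H Aa ga (B_M H Bb Bb') (dGM H gb gb') Bc gc).
rewrite (LA_adj H (LA_A H _ _ _ Aa) gL Bb' gb' Bc gc).
by rewrite (LA_adj H Aa ga Bb gb (B_M H Bb' Bc) (dGM H gb' gc)) !mulrA.
Qed.

Lemma RA_mul m m' n b b' a : B b -> G m b -> B b' -> G m' b' -> A a -> G n a ->
  RA (m + m') n (b * b') a = RA m (n + m') b (RA m' n b' a).
Proof.
move=> Bb gb Bb' gb' Aa ga; apply: (pairing_eqA H (n := n + (m + m'))).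
- exact: (RA_A H).
- exact: (RA_G H).
- by apply: (RA_A H); exact: (RA_A H).
- by rewrite [m + m']addrC addrA; apply: (RA_G H); exact: (RA_A H).
move=> i b2 b1 u b2B gb2 b1B gb1.
have Bc : B (b2 * b1 * K u).
  apply: (B_M H); last exact: (KB H u).
  by apply: (B_M H); [exact: (dB2B H)|exact: (B1'B H b1B)].
have gc := GMK H u (dGM H gb2 gb1).
have gL : G (n + m') (RA m' n b' a) := RA_G H _ _ _ Aa.
rewrite (RA_adj H Aa ga (B_M H Bb Bb') (dGM H gb gb') Bc gc).
rewrite (RA_adj H (RA_A H _ _ _ Aa) gL Bb gb Bc gc).
by rewrite (RA_adj H Aa ga Bb' gb' (B_M H Bc Bb) (dGM H gc gb)) !mulrA.
Qed.

Lemma RB_A1B1 i m x c : A1 x -> G i x -> B1 c -> G m c -> RB i m x c = eps x *: c.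
Proof.
move=> x1 gx c1 gc; have cB := dB1B H c1; have xA := dA1A H x1.
apply: (pairing_eqB H (n := m + i)).
- exact: (RB_B H).
- exact: (RB_G H).
- exact: subspZ (dB H) cB.
- have [e|ne] := eqVneq i 0; first by rewrite e addr0; exact: subspZ (dG H m) gc.
  by rewrite (depsdeg H gx) // scale0r; case: (dG H (m + i)).
move=> j a1 a2 u a1A ga1 a2A ga2.
have a2K : A2 (a2 * K u) := A2_M H (dA2'A H a2A) (dKA H u).
have Aa : A (a1 * a2 * K u).
  by rewrite -mulrA; apply: (A_M H); [exact: (dA1A H)|exact: (dA2A H)].
rewrite (RB_adj H cB gc xA gx Aa (GMK H u (dGM H ga1 ga2))) (pZr H).
rewrite -[a1 * a2 * K u]mulrA mulrA (p_B1 H (A1_M H x1 a1A) a2K c1).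
by rewrite (p_B1 H a1A a2K c1) (depsM H) mulrA.
Qed.

Lemma LB_A2B2 i m x c : A2 x -> G i x -> B2 c -> G m c -> LB i m x c = eps x *: c.
Proof.
move=> x2 gx c2 gc; have cB := dB2B H c2; have xA := dA2A H x2.
apply: (pairing_eqB H (n := m + i)).
- exact: (LB_B H).
- exact: (LB_G H).
- exact: subspZ (dB H) cB.
- have [e|ne] := eqVneq i 0; first by rewrite e addr0; exact: subspZ (dG H m) gc.
  by rewrite (depsdeg H gx) // scale0r; case: (dG H (m + i)).
move=> j a1 a2 u a1A ga1 a2A ga2.
have a2K : A2 (a2 * K u) := A2_M H (dA2'A H a2A) (dKA H u).
have Aa : A (a1 * a2 * K u).
  by rewrite -mulrA; apply: (A_M H); [exact: (dA1A H)|exact: (dA2A H)].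
rewrite (LB_adj H cB gc xA gx Aa (GMK H u (dGM H ga1 ga2))) (pZr H).
rewrite -[a1 * a2 * K u]mulrA -mulrA (p_B2 H a1A (A2_M H a2K x2) c2).
by rewrite (p_B2 H a1A a2K c2) (depsM H); ring.
Qed.

(** The right leg of Delta(a) lies in A1, which acts on B1 through the
    counit; so the exchange element degenerates to a product. *)
Lemma psi_A1B1 n m a c : A1 a -> G n a -> B1 c -> G m c ->
  psi Delta p n m a c = a * c.
Proof.
move=> a1 ga c1 gc; rewrite (psi_RB H (dA1A H a1) ga (dB1B H c1) gc).
have bil i : bilinear_map (fun x1 x2 => x1 * RB i m x2 c).
  exact: bil_mul (@lin_id _ _) (linRB H _ _ _).
have bil2 : bilinear_map (fun x1 x2 => x1 * (eps x2 *: c)).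
  apply: bil_mul (@lin_id _ _) _ => k x y.
  by rewrite (depsl H) scalerDl scalerA.
have tE i : tlift (fun x1 x2 => x1 * RB i m x2 c) (Delta a (n - i) i) =
    tlift (fun x1 x2 => x1 * (eps x2 *: c)) (Delta a (n - i) i).
  apply: (tlift_eq_on (bil i) bil2) (dDA1 H (n - i) i a1) => x y _ [y1 gy].
  by rewrite (RB_A1B1 y1 gy).
rewrite (eq_fsum tE) (fsum_single (i0 := 0)) => [|i i0]; last first.
  apply: (tlift_eq0 bil2) (dDA1 H (n - i) i a1) => x y _ [_ gy].
  by rewrite (depsdeg H gy) // scale0r mulr0.
rewrite subr0 -[in RHS](dcounitr H ga).
rewrite [RHS](linear_tlift (h := fun z => z * c)); last 2 first.
- exact: lin_mulr.
- exact: (ctr_bil (depsl H)).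
by apply: tlift_eq => x y; rewrite -scalerAl -scalerAr.
Qed.

(** The mirror case: the left leg of Delta(a) lies in A2, which acts on B2
    through the counit, and the product appears in the opposite order. *)
Lemma psi_A2B2 n m a b : A2 a -> G n a -> B2 b -> G m b ->
  psi Delta p n m a b = b * a.
Proof.
move=> a1 ga c1 gc; rewrite /psi.
have bil i : bilinear_map (fun x1 x2 => LB i m x1 b * x2).
  exact: bil_mul (linLB H _ _ _) (@lin_id _ _).
have bil2 : bilinear_map (fun x1 x2 => (eps x1 *: b) * x2).
  apply: bil_mul _ (@lin_id _ _) => k x y.
  by rewrite (depsl H) scalerDl scalerA.
have tE i : tlift (fun x1 x2 => LB i m x1 b * x2) (Delta a i (n - i)) =
    tlift (fun x1 x2 => (eps x1 *: b) * x2) (Delta a i (n - i)).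
  apply: (tlift_eq_on (bil i) bil2) (dDA2 H i (n - i) a1) => x y [x1 gx] _.
  by rewrite (LB_A2B2 x1 gx).
rewrite (eq_fsum tE) (fsum_single (i0 := 0)) => [|i i0]; last first.
  apply: (tlift_eq0 bil2) (dDA2 H i (n - i) a1) => x y [_ gx] _.
  by rewrite (depsdeg H gx) // scale0r mul0r.
rewrite subr0 -[in RHS](dcounitl H ga).
rewrite [RHS](linear_tlift (h := fun z => b * z)); last 2 first.
- exact: lin_mull.
- exact: (ctl_bil (depsl H)).
by apply: tlift_eq => x y; rewrite -scalerAl -scalerAr.
Qed.

Lemma DeltaMK m b w i j : G m b -> i + j = m ->
  Delta (b * K w) i j = tmul (Delta b i j) (tens (K w) (K w)).
Proof.
move=> gb e; rewrite -{m}e in gb; have := dDM H gb (dKG H w) i.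
have e1 : i + j - i = j by rewrite addrAC subrr add0r.
rewrite addr0 e1 => ->.
rewrite (fsum_single (i0 := i)) => [|k ki]; last first.
  by rewrite (dDK H) /chom /= subr_eq0 [i == k]eq_sym (negbTE ki) tmult0.
by rewrite e1 (dDK H) /chom subrr subr0.
Qed.

Lemma DeltaA_sup n a : G n a ->
  exists c : int, forall i j, i + j = n -> j < c -> Delta a i j = 0.
Proof.
move=> ga; have [c Hc] := dDdeg H ga; exists c => i j _ jc.
by apply/eqP; apply: contraLR jc => /Hc[_ cj]; rewrite -leNgt.
Qed.

End Factors.
(** * Testing tensors against B and expanding them by weights *)

Section Contractions.
Variables (F : fieldType) (D : algType F).
Implicit Types (phi : D -> F) (t : tensor D D).

Lemma ctl_tmul_tens phi t x' y' : linear (phi : D -> F^o) ->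
  ctl phi (tmul t (tens x' y')) = ctl (fun x => phi (x * x')) t * y'.
Proof.
move=> pl; have pl' : linear ((fun x => phi (x * x')) : D -> F^o).
  exact: lin_comp pl (lin_mulr x').
apply: (tensor_ext (g := fun t => ctl phi (tmul t (tens x' y')))
  (h := fun t => ctl (fun x => phi (x * x')) t * y')) => [||x y].
- exact: lin_comp (ctl_lin pl) (tmul_linl _).
- exact: lin_comp (lin_mulr _) (ctl_lin pl').
rewrite tmul_tens /ctl !tlift_tens; [|exact: ctl_bil|exact: ctl_bil].
by rewrite scalerAl.
Qed.

Lemma ctl_tens_tmul phi t x' y' : linear (phi : D -> F^o) ->
  ctl phi (tmul (tens x' y') t) = y' * ctl (fun x => phi (x' * x)) t.
Proof.
move=> pl; have pl' : linear ((fun x => phi (x' * x)) : D -> F^o).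
  exact: lin_comp pl (lin_mull x').
apply: (tensor_ext (g := fun t => ctl phi (tmul (tens x' y') t))
  (h := fun t => y' * ctl (fun x => phi (x' * x)) t)) => [||x y].
- exact: lin_comp (ctl_lin pl) (tmul_linr _).
- exact: lin_comp (lin_mull _) (ctl_lin pl').
rewrite tmul_tens /ctl !tlift_tens; [|exact: ctl_bil|exact: ctl_bil].
by rewrite scalerAr.
Qed.

Lemma ctl_ext S T phi psi t : linear (phi : D -> F^o) -> linear (psi : D -> F^o) ->
  (forall x, S x -> phi x = psi x) -> tspan S T t -> ctl phi t = ctl psi t.
Proof.
move=> pl sl ps; apply: tlift_eq_on => [||x y Sx _]; [exact: ctl_bil|exact: ctl_bil|].
by rewrite ps.
Qed.

End Contractions.

Section Brackets.
Variables (F : fieldType) (D : algType F) (G : int -> set D).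
Variables (Delta : D -> ctens D) (eps : D -> F).
Variables (r : nat) (K : 'rV[int]_r -> D) (p : D -> D -> F).
Variables (A A1 A2 A2' B B2 B1 B1' : set D) (R1 R2 : int -> tensor D D).
Hypothesis H : double_data G Delta eps K p A A1 A2 A2' B B2 B1 B1' R1 R2.

Local Notation chi u v := (p (K u) (K v)).
Local Notation LB := (LB Delta p).
Local Notation lwB := (lwB G K p A).
Local Notation wtI := (wtI K p).
Local Notation wtII := (wtII K p).
Let pl := dpl H.
Let pr := dpr H.

(** A tensor with left leg in A vanishes when all its contractions with
    elements of B vanish; products of elements of B2, of B1' and of
    group-like elements suffice. The next lemmas are the variants for
    equalities and for left legs in A2 or A1. *)
Lemma testA j t : tspan (A `&` G j) setT t ->
  (forall i b2 c w, B2 b2 -> G i b2 -> B1' c -> G (- j - i) c ->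
     ctl (p^~ (b2 * c * K w)) t = 0) -> t = 0.
Proof.
move=> tA t0.
pose J := {b : D | exists i b2 c w, [/\ B2 b2, G i b2, B1' c, G (- j - i) c &
  b = b2 * c * K w]}.
apply: (tensor_test (phi := fun b : J => p^~ (sval b)) _ _ _ tA).
- exact: subspI (dA H) (dG H j).
- by move=> b; exact: pl.
- move=> x [Ax gx] x0; apply: (pairing_eqA H Ax gx); [by case: (dA H)|by case: (dG H j)|].
  move=> i b2 c w b2B gb2 cB gc; rewrite (p0l H).
  by apply: (x0 (exist _ (b2 * c * K w) _)); exists i, b2, c, w.
- case=> b bP /=; have [i [b2 [c [w [b2B gb2 cB gc e]]]]] := bP.
  by rewrite -/(ctl (p^~ b) t) e (t0 i).
Qed.

Lemma eq_testA j t t' : tspan (A `&` G j) setT t -> tspan (A `&` G j) setT t' ->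
  (forall i b2 c w, B2 b2 -> G i b2 -> B1' c -> G (- j - i) c ->
     ctl (p^~ (b2 * c * K w)) t = ctl (p^~ (b2 * c * K w)) t') -> t = t'.
Proof.
move=> tA tA' tt'; apply/eqP; rewrite -subr_eq0; apply/eqP.
have e : t - t' = -1 *: t' + t by rewrite scaleN1r addrC.
apply: (testA (j := j)) => [|i b2 c w b2B gb2 cB gc]; rewrite e.
  apply: tspanD => //; have [s [Hs ->]] := tA'.
  rewrite scaler_sumr; apply: tspan_sum => q /Hs[[Aq gq] _].
  have [_ _ Z] := linP (fun c a b => bil_l (tens_bilinear D D) c a b q.2).
  by rewrite -Z; apply: tspan_tens => //; split; apply: subspZ => //; [exact: (dA H)|exact: (dG H)].
by rewrite (ctl_lin (pl _)) (tt' i) // scaleN1r addNr.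
Qed.

Lemma eq_testA2 j t t' : tspan (A2 `&` G j) setT t -> tspan (A2 `&` G j) setT t' ->
  (forall c w, B1' c -> G (- j) c ->
     ctl (p^~ (c * K w)) t = ctl (p^~ (c * K w)) t') -> t = t'.
Proof.
move=> tA tA' tt'; apply: (eq_testA (j := j)).
- by apply: tspan_sub tA => // x [? ?]; split=> //; exact: (dA2A H).
- by apply: tspan_sub tA' => // x [? ?]; split=> //; exact: (dA2A H).
move=> i b2 c w b2B gb2 cB gc.
have cK : B1 (c * K w) := B1_M H (dB1'B H cB) (dKB H w).
have red t1 : tspan (A2 `&` G j) setT t1 -> ctl (p^~ (b2 * c * K w)) t1 =
    eps b2 *: ctl (p^~ (c * K w)) t1.
  move=> tA1; rewrite -mulrA /ctl.
  rewrite [RHS](linear_tlift (h := fun z => eps b2 *: z)); last 2 first.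
  - by move=> k x y; rewrite scalerDr !scalerA mulrC.
  - exact: ctl_bil.
  apply: (tlift_eq_on _ _ _ tA1) => [||x y [x2 _] _].
  - exact: ctl_bil.
  - apply: bil_post (ctl_bil (pl _)) _.
    by move=> k x y; rewrite scalerDr !scalerA mulrC.
  - by rewrite (p_A2 H) // scalerA.
rewrite !red //; have [e|ne] := eqVneq i 0; last by rewrite (depsdeg H gb2) // !scale0r.
by rewrite tt' //; rewrite e subr0 in gc.
Qed.

Lemma eq_testA1 j t t' : tspan (A1 `&` G j) setT t -> tspan (A1 `&` G j) setT t' ->
  (forall b, B2 b -> G (- j) b -> ctl (p^~ b) t = ctl (p^~ b) t') -> t = t'.
Proof.
move=> tA tA' tt'; apply/eqP; rewrite -subr_eq0; apply/eqP.
have e : t - t' = -1 *: t' + t by rewrite scaleN1r addrC.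
pose J := {b : D | B2 b /\ G (- j) b}.
apply: (tensor_test (S := A1 `&` G j) (phi := fun b : J => p^~ (sval b))).
- exact: subspI (dA1 H) (dG H j).
- by move=> b; exact: pl.
- move=> x [x1 gx] x0; rewrite -(dR1r H x1 gx).
  apply: (tlift_eq0 _ _ (dR1 H j)); first exact: ctr_bil.
  move=> y z _ [z2 gz]; rewrite (_ : p x z = 0) ?scale0r //.
  exact: (x0 (exist _ z (conj z2 gz))).
- rewrite e; apply: tspanD => //; have [s [Hs ->]] := tA'.
  rewrite scaler_sumr; apply: tspan_sum => q /Hs[[Aq gq] _].
  have [_ _ Z] := linP (fun c a b => bil_l (tens_bilinear D D) c a b q.2).
  by rewrite -Z; apply: tspan_tens => //; split; apply: subspZ => //;
    [exact: (dA1 H)|exact: (dG H)].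
- case=> b [b2 gb] /=; rewrite -/(ctl (p^~ b) _) e (ctl_lin (pl _)) tt' //.
  by rewrite scaleN1r addNr.
Qed.

(** A pair of weight vectors (x, y) together with the weight v of x and the
    weight u of y; its conjugate by R0 is again a tensor. *)
Definition wterm := ((D * 'rV[int]_r) * (D * 'rV[int]_r))%type.
Definition wt_ok (i j : int) (q : wterm) :=
  [/\ A q.1.1 /\ G i q.1.1, wtI q.1.2 q.1.1, A q.2.1 /\ G j q.2.1
    & wtII q.2.2 q.2.1].
Definition wt_tens (q : wterm) : tensor D D := tens q.1.1 q.2.1.
Definition wt_conj (q : wterm) : tensor D D :=
  tens (q.1.1 * K (- q.2.2)) (K (- q.1.2) * q.2.1).

Definition wt_spanned (S : set D) := forall i (Q : set D), subsp Q ->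
  (forall v y, S y -> G i y -> wtI v y -> Q y) -> forall x, S x -> G i x -> Q x.

(** Both legs split into weight vectors. The expansion of 0 is chosen empty
    so that conjugation by R0 does not enlarge the support of a family of
    tensors. *)
Lemma wt_expansion (S : set D) i j t : wt_spanned S -> subsp S -> S `<=` A ->
  tspan (S `&` G i) (A `&` G j) t -> exists s : seq wterm,
  [/\ forall q, q \in s -> wt_ok i j q /\ S q.1.1,
      t = \sum_(q <- s) wt_tens q & t = 0 -> s = [::]].
Proof.
move=> wS SS SA.
pose P := [set t | exists s : seq wterm,
  (forall q, q \in s -> wt_ok i j q /\ S q.1.1) /\ t = \sum_(q <- s) wt_tens q].
move=> tA; suff [s [Hs sE]] : P t.
  have [t0|t0] := eqVneq t 0; last by exists s; split=> // /eqP; rewrite (negbTE t0).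
  by exists [::]; split=> //; rewrite big_nil.
have tb := tens_bilinear D D.
have P0 : P 0 by exists [::]; rewrite big_nil.
have PD t1 t2 : P t1 -> P t2 -> P (t1 + t2).
  move=> [s [Hs ->]] [s' [Hs' ->]]; exists (s ++ s'); rewrite big_cat; split=> // q.
  by rewrite mem_cat => /orP[/Hs|/Hs'].
have PZ c t1 : P t1 -> P (c *: t1).
  move=> [s [Hs ->]].
  exists [seq ((c *: q.1.1, q.1.2), q.2) | q <- s]; split=> [q /mapP[q' /Hs H' ->]|].
    case: H' => -[[Aq gq] wq ? ?] Sq; split=> //=; last exact: subspZ.
    split=> //=.
      by split; apply: subspZ => //; [exact: (dA H)|exact: (dG H)].
    by move=> w; rewrite -scalerAl wq -scalerAr !scalerA mulrC.
  rewrite big_map scaler_sumr; apply: eq_bigr => q _; rewrite /wt_tens /=.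
  by have [_ _ ->] := linP (fun c a b => bil_l tb c a b q.2.1).
move: tA => [s [Hs ->]]; rewrite big_seq; apply: big_ind => // q /Hs[[Aq gq] [Aq' gq']].
have P0l y : P (tens 0 y).
  by have [-> _ _] := linP (fun c a b => bil_l tb c a b y).
have P0r y : P (tens y 0).
  by have [-> _ _] := linP (fun c a b => bil_r tb c a b y).
apply: (wS i [set x | P (tens x q.2)]) (gq) => //.
  split=> [|c x y /= Px Py]; first exact: P0l.
  by rewrite /= (bil_l tb); apply: PD => //; exact: PZ.
move=> v x Sx gx wx; apply: (A_wtII H (Q := [set y | P (tens x y)])) (gq') => //.
  split=> [|c y z /= Px Py]; first exact: P0r.
  by rewrite /= (bil_r tb); apply: PD => //; exact: PZ.
move=> u y Ay gy wy; exists [:: ((x, v), (y, u))]; rewrite big_seq1; split=> // q'.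
by rewrite inE => /eqP -> /=; split=> //; split=> //=; split=> //; exact: SA.
Qed.

Lemma Delta_wt_expansion (S : set D) n a : wt_spanned S -> subsp S -> S `<=` A ->
  (forall i, tspan (S `&` G i) (A `&` G (n - i)) (Delta a i (n - i))) ->
  exists la : int -> seq wterm, (forall i,
  [/\ forall q, q \in la i -> wt_ok i (n - i) q,
      Delta a i (n - i) = \sum_(q <- la i) wt_tens q &
      Delta a i (n - i) = 0 -> la i = [::]]) /\
  forall i q, q \in la i -> S q.1.1.
Proof.
move=> wS SS SA aS; have /choice[la Hla] : forall i, exists s : seq wterm,
  [/\ forall q, q \in s -> wt_ok i (n - i) q /\ S q.1.1,
      Delta a i (n - i) = \sum_(q <- s) wt_tens q &
      Delta a i (n - i) = 0 -> s = [::]].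
  by move=> i; exact: wt_expansion.
exists la; split=> [i|i q qi]; have [h1 h2 h3] := Hla i; last by case: (h1 q qi).
by split=> // q /h1[].
Qed.

Lemma A_spanned : wt_spanned A.
Proof. by move=> i Q; exact: (A_wtI H). Qed.

Lemma A2_spanned : wt_spanned A2.
Proof. by move=> i Q; exact: (A2_wtI H). Qed.

Lemma lwB_LB i m x b v w : A x -> G i x -> wtI v x -> B b -> G m b -> lwB w b ->
  lwB (w - v) (LB i m x b).
Proof.
move=> Ax gx vx Bb gb wb k a u Aa ga.
rewrite (LB_adj H Bb gb Ax gx (A_M H Aa (KA H u)) (GMK H u ga)).
rewrite (LB_adj H Bb gb Ax gx Aa ga).
rewrite -mulrA (_ : K u * x = chi u (- v) *: (x * K u)); last first.
  by rewrite vx scalerA (chiNr H) scale1r.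
rewrite -scalerAr (pZl H) mulrA (wb _ _ _ (A_M H Aa Ax) (dGM H ga gx)).
by rewrite (chiDr H) mulrA [chi u w * _]mulrC.
Qed.

Lemma lwB_MK m b w v : B b -> G m b -> lwB w b -> lwB (w + v) (b * K v).
Proof.
move=> Bb gb wb k a u Aa ga.
have [e|ne] := eqVneq (k + m) 0; last first.
  rewrite (pdeg H (A_M H Aa (KA H u)) (GMK H u ga) (B_M H Bb (KB H v)) (GMK H v gb) ne).
  by rewrite (pdeg H Aa ga (B_M H Bb (KB H v)) (GMK H v gb) ne) mulr0.
rewrite (dpmulr H Bb gb (KB H v) (dKG H v) (A_M H Aa (KA H u)) (GMK H u ga)).
rewrite (dpmulr H Bb gb (KB H v) (dKG H v) Aa ga).
have bF : bilinear_map (fun x y => p x b * p y (K v) : F^o).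
  exact: (bil_mulF (pl b) (pl (K v))).
rewrite (DeltaMK H u ga); last lia.
rewrite tlift_tmul //.
rewrite [RHS](linear_tlift (h := fun z : F^o => chi u (w + v) * z : F^o)) //; last first.
  by move=> c x y; rewrite mulrDr; congr (_ + _); rewrite mulrCA.
transitivity (tlift (fun x y => p (x * K u) b * p (y * K u) (K v) : F^o)
   (Delta a (- m) (- 0))).
  apply: (tlift_eq (U := F^o)) => x y; rewrite tlift_tens //.
  exact: bil_comp bF (lin_mull x) (lin_mull y).
apply: (tlift_eq_on (U := F^o) _ _ _ (dDA H (- m) (- 0) Aa)).
- exact: (bil_mulF (lin_comp (pl b) (lin_mulr _)) (lin_comp (pl (K v)) (lin_mulr _))).
- apply: (bil_post (h := fun z : F^o => chi u (w + v) * z : F^o) bF).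
  by move=> c x y; rewrite mulrDr; congr (_ + _); rewrite mulrCA.
move=> x y [Ax gx] [Ay gy]; rewrite (wb _ _ _ Ax gx).
have Kv : lwB v (K v).
  rewrite -[K v]mul1r -[1]mul1r; apply: (lwB_prod H); [exact: (B2_1 H)|exact: (B1'_1 H)].
by rewrite (Kv _ _ _ Ay gy) (chiDr H); ring.
Qed.

End Brackets.
(** * Contractions with the canonical elements *)

Section Twisted.
Variables (F : fieldType) (D : algType F) (G : int -> set D).
Variables (Delta : D -> ctens D) (eps : D -> F).
Variables (r : nat) (K : 'rV[int]_r -> D) (p : D -> D -> F).
Variables (A A1 A2 A2' B B2 B1 B1' : set D) (R1 R2 : int -> tensor D D).
Hypothesis H : double_data G Delta eps K p A A1 A2 A2' B B2 B1 B1' R1 R2.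

Local Notation chi u v := (p (K u) (K v)).
Local Notation LB := (LB Delta p).
Local Notation RB := (RB Delta p).
Local Notation lwB := (lwB G K p A).
Local Notation cR1 := (cR1 p R1).
Local Notation cR2 := (cR2 p R2).
Local Notation cR2K := (cR2K G p A2 B1).
Let pl := dpl H.
Let pr := dpr H.

Lemma tens0l (y : D) : tens 0 y = 0 :> tensor D D.
Proof. by have [-> _ _] := linP (fun c a b => bil_l (tens_bilinear D D) c a b y). Qed.

Lemma tspan_0l (S T : set D) t : (forall x, S x -> x = 0) -> tspan S T t -> t = 0.
Proof.
move=> S0 [s [Hs ->]]; rewrite big_seq big1 // => q /Hs[/S0 -> _].
exact: tens0l.
Qed.

Lemma tens0r (x : D) : tens x 0 = 0 :> tensor D D.
Proof. by have [-> _ _] := linP (fun c a b => bil_r (tens_bilinear D D) c a b x). Qed.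

Lemma tspan_0r (S T : set D) t : (forall x, T x -> x = 0) -> tspan S T t -> t = 0.
Proof.
move=> S0 [s [Hs ->]]; rewrite big_seq big1 // => q /Hs[_ /S0 ->].
exact: tens0r.
Qed.

Lemma R1_neg k : k < 0 -> R1 k = 0.
Proof.
by move=> k0; apply: tspan_0l (dR1 H k) => x [x1 gx]; exact: (dA1n H k0).
Qed.

Lemma R2_pos k : 0 < k -> R2 k = 0.
Proof.
by move=> k0; apply: tspan_0l (dR2 H k) => x [/(dA2'A H) x1 gx]; exact: (dA2n H k0).
Qed.

Variables (n : int) (a : D) (la : int -> seq (wterm D r)).
Hypothesis Aa : A a.
Hypothesis ga : G n a.
Hypothesis Hla : forall i, [/\ forall q, q \in la i -> wt_ok G K p A i (n - i) q,
  Delta a i (n - i) = \sum_(q <- la i) wt_tens q &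
  Delta a i (n - i) = 0 -> la i = [::]].

(** The components, indexed by the degree of the left leg, of R0 Delta(a)
    R0^-1, of the flipped coproduct Delta(a)^(2,1), of R2' R0 Delta(a) R0^-1
    and of Delta(a)^(2,1) R1. *)
Definition conjDelta (i : int) : tensor D D := \sum_(q <- la i) wt_conj K q.
Definition flipDelta (i : int) : tensor D D := tflip (Delta a (n - i) i).
Definition R2Delta := tconv R2 conjDelta.
Definition DeltaR1 := tconv flipDelta R1.

(** The contraction of R2 Delta(a) with b. *)
Definition PhiK (m : int) b := \sum_(i \in [set: int])
  \sum_(q <- la i) cR2K (m + i) (LB i m q.1.1 b) * q.2.1.

Lemma la_ok i q : q \in la i -> wt_ok G K p A i (n - i) q.
Proof. by move=> qi; have [+ _ _] := Hla i; exact. Qed.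

Lemma la_sup : exists c : int, forall i, c < i -> la i = [::].
Proof.
have [c Hc] := DeltaA_sup H ga; exists (n - c) => i ic.
by have [_ _] := Hla i; apply; apply: Hc; lia.
Qed.

Lemma conjDelta_A i : tspan (A `&` G i) (A `&` G (n - i)) (conjDelta i).
Proof.
apply: tspan_sum => q /la_ok[[Aq gq] _ [Aq' gq'] _]; apply: tspan_tens.
  by split; [exact: (A_M H) Aq (KA H _)|exact: (GMK H)].
by split; [exact: (A_M H) (KA H _) Aq'|exact: (GKM H)].
Qed.

Lemma R2Delta_sup j : exists s : seq int, forall i,
  tmul (R2 i) (conjDelta (j - i)) != 0 -> i \in s.
Proof.
have [c Hc] := la_sup; exists (zwin (j - c) 0) => i; apply: contraR => nsi.
have [i0|i0] := ltP 0 i; first by rewrite R2_pos // tmul0t.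
have [ic|ic] := ltP c (j - i); first by rewrite /conjDelta Hc // big_nil tmult0.
by rewrite mem_zwin // in nsi; lia.
Qed.

Lemma DeltaR1_sup j : exists s : seq int, forall i,
  tmul (flipDelta i) (R1 (j - i)) != 0 -> i \in s.
Proof.
have [c Hc] := DeltaA_sup H ga; exists (zwin c j) => i; apply: contraR => nsi.
have [ic|ic] := ltP i c; first by rewrite /flipDelta Hc ?tflip0 ?tmul0t //; lia.
have [ij|ij] := ltP (j - i) 0; first by rewrite R1_neg // tmult0.
by rewrite mem_zwin // in nsi; lia.
Qed.

(** R2 Delta(a) = (R2' R0 Delta(a) R0^-1) R0, and against an element b of
    weight w the right factor R0 contributes K_w. *)
Lemma R2Delta_formula m b w : B b -> G m b -> lwB w b ->
  ctl (p^~ b) (R2Delta (- m)) * K w = PhiK m b.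
Proof.
move=> Bb gb wb.
have hl : linear (fun t : tensor D D => ctl (p^~ b) t * K w).
  exact: lin_comp (lin_mulr _) (ctl_lin (pl b)).
have [h0 hD _] := linP hl.
rewrite /R2Delta /tconv (fsum_morph h0 hD); last exact: R2Delta_sup.
rewrite (fsum_refl _ (- m)); apply: eq_fsum => i.
rewrite (_ : - m - (- m - i) = i); last by ring.
rewrite /conjDelta (linear_bigsum _ _ _ (lin_comp hl (tmul_linr _))).
rewrite big_seq [RHS]big_seq; apply: eq_bigr => q /la_ok.
case: q => [[x v] [y u]] /= [/= [Ax gx] vx [Ay gy] uy].
rewrite /wt_conj /= ctl_tmul_tens //.
have -> : ctl (fun x0 => p (x0 * (x * K (- u))) b) (R2 (- m - i)) =
    chi (- u) w *: cR2 (m + i) (LB i m x b).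
  rewrite /cR2 opprD /ctl.
  rewrite [RHS](linear_tlift (h := fun z => chi (- u) w *: z)); last 2 first.
  - by move=> k z z'; rewrite scalerDr !scalerA mulrC.
  - exact: ctl_bil.
  apply: (tlift_eq_on _ _ _ (dR2 H _)) => [||x2 z [x2A gx2] _].
  - exact: ctl_bil (lin_comp (pl b) (lin_mulr _)).
  - apply: bil_post (ctl_bil (pl _)) _.
    by move=> k z z'; rewrite scalerDr !scalerA mulrC.
  - have x2A' := A2'A H x2A.
    rewrite mulrA (wb _ _ _ (A_M H x2A' Ax) (dGM H gx2 gx)) scalerA.
    by rewrite (LB_adj H Bb gb Ax gx x2A' gx2).
have lwL := lwB_LB H Ax gx vx Bb gb wb.
rewrite (cR2K_lw H (LB_B H _ _ _ Bb) (LB_G H _ _ _ Bb) lwL).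
rewrite -!mulrA uy -!scalerAr -scalerAl scalerA [chi u w * _]mulrC (chiNl H) scale1r.
by rewrite [w - v]addrC (dKD H) !mulrA.
Qed.

Lemma DeltaR1_formula m b : B b -> G m b ->
  ctl (p^~ b) (DeltaR1 (- m)) = \sum_(i \in [set: int])
    tlift (fun x1 x2 => x1 * cR1 (m + i) (RB i m x2 b)) (Delta a (n - i) i).
Proof.
move=> Bb gb; have hl := ctl_lin (pl b); have [h0 hD _] := linP hl.
rewrite /DeltaR1 /tconv (fsum_morph h0 hD); last exact: DeltaR1_sup.
apply: eq_fsum => i; rewrite /flipDelta.
have [s [Hs ->]] := dDA H (n - i) i Aa; rewrite tflip_list tlift_list; last first.
  apply: bil_mul (@lin_id _ _) _.
  exact: lin_comp (cR1_lin H _) (linRB H _ _ _).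
rewrite (linear_bigsum _ _ _ (lin_comp hl (tmul_linl _))).
rewrite big_seq [RHS]big_seq; apply: eq_bigr => q /Hs[[Aq gq] [Aq' gq']].
rewrite ctl_tens_tmul //; congr (_ * _); rewrite /cR1 opprD.
apply: (ctl_ext _ (pl _) _ (dR1 H _)) => [|x [xA gx]].
  exact: lin_comp (pl b) (lin_mull _).
by rewrite (RB_adj H Bb gb Aq' gq' (dA1A H xA) gx).
Qed.

End Twisted.

Section BracketIdentities.
Variables (F : fieldType) (D : algType F) (G : int -> set D).
Variables (Delta : D -> ctens D) (eps : D -> F).
Variables (r : nat) (K : 'rV[int]_r -> D) (p : D -> D -> F).
Variables (A A1 A2 A2' B B2 B1 B1' : set D) (R1 R2 : int -> tensor D D).
Hypothesis H : double_data G Delta eps K p A A1 A2 A2' B B2 B1 B1' R1 R2.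

Local Notation chi u v := (p (K u) (K v)).
Local Notation LB := (LB Delta p).
Local Notation RB := (RB Delta p).
Local Notation rwA := (rwA G K p B).
Local Notation lwB := (lwB G K p A).
Local Notation wtI := (wtI K p).
Local Notation cR1 := (cR1 p R1).
Local Notation cR2 := (cR2 p R2).
Let pl := dpl H.
Let pr := dpr H.

(** The pieces, with the right leg of the coproduct of b in degree - i, of
    the contractions of R1 R2' (x (x) K_(-v)) and of (x (x) 1) R1 R2' with
    b. The product R1 R2' makes no sense in either completion, but for fixed
    b only finitely many pieces are nonzero. *)
Definition contrL (k m i : int) x v b := tlift (fun y1 y2 =>
  cR1 (- i) y2 * (cR2 (m + i + k) (LB k (m + i) x y1) * K (- v)))
  (Delta b (m + i) (- i)).
Definition contrR (k m i : int) x b := tlift (fun y1 y2 =>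
  cR1 (k - i) (RB k (- i) x y2) * cR2 (m + i) y1) (Delta b (m + i) (- i)).

Lemma contrL_bil k m i x v : bilinear_map (fun y1 y2 =>
  cR1 (- i) y2 * (cR2 (m + i + k) (LB k (m + i) x y1) * K (- v))).
Proof.
apply: bil_mul' (cR1_lin H _) (lin_comp (lin_mulr _) (lin_comp (cR2_lin H _) _)).
exact: (linLBb H).
Qed.

Lemma contrR_bil k m i x : bilinear_map (fun y1 y2 =>
  cR1 (k - i) (RB k (- i) x y2) * cR2 (m + i) y1).
Proof.
apply: bil_mul' (lin_comp (cR1_lin H _) _) (cR2_lin H _).
exact: (linRBb H).
Qed.

Lemma contrL_sup m b : B b -> G m b -> exists c : int,
  forall k i x v, contrL k m i x v b != 0 -> 0 <= i <= c /\ - m - k <= i.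
Proof.
move=> Bb gb; have [c Hc] := DeltaA_sup H gb.
exists (- c) => k i x v bn; have [ic|ic] := ltP (- i) c.
  by move: bn; rewrite /contrL Hc ?tlift0 ?eqxx //; [exact: contrL_bil|lia].
have [mi|mi] := ltP (m + i + k) 0.
  move: bn; rewrite /contrL (tlift_eq0 (contrL_bil k m i x v) _ (dDB H _ _ Bb)) ?eqxx // => y1 y2 _ _.
  by rewrite (cR2_0 H) // mul0r mulr0.
have [i0|i0] := ltP 0 (- i); last lia.
move: bn; rewrite /contrL (tlift_eq0 (contrL_bil k m i x v) _ (dDB H _ _ Bb)) ?eqxx // => y1 y2 _ _.
by rewrite (cR1_0 H) // mul0r.
Qed.

Lemma contrR_sup m b : B b -> G m b -> exists c : int,
  forall k i x, contrR k m i x b != 0 -> - m <= i <= c /\ k <= i.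
Proof.
move=> Bb gb; have [c Hc] := DeltaA_sup H gb.
exists (- c) => k i x bn; have [ic|ic] := ltP (- i) c.
  by move: bn; rewrite /contrR Hc ?tlift0 ?eqxx //; [exact: contrR_bil|lia].
have [mi|mi] := ltP (m + i) 0.
  move: bn; rewrite /contrR (tlift_eq0 (contrR_bil k m i x) _ (dDB H _ _ Bb)) ?eqxx // => y1 y2 _ _.
  by rewrite (cR2_0 H) // mulr0.
have [i0|i0] := ltP 0 (k - i); last lia.
move: bn; rewrite /contrR (tlift_eq0 (contrR_bil k m i x) _ (dDB H _ _ Bb)) ?eqxx // => y1 y2 _ _.
by rewrite (cR1_0 H) // mul0r.
Qed.

(** Since p (a1 a2) (b2 b1) = p a1 b2 * p a2 b1, the formal product R1 R2 is
    the canonical element of the whole pairing, whose contraction with b is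
    b. The factor x only makes x act on b, and K_(-v) compensates its
    weight. *)
Lemma contrL_sum k m x v b : A x -> G k x -> wtI v x -> B b -> G m b -> lwB 0 b ->
  \sum_(i \in [set: int]) contrL k m i x v b = LB k m x b.
Proof.
move=> Ax gx vx Bb gb wb.
have brB i : (B `&` G (m + k)) (contrL k m i x v b).
  apply: (tlift_subsp (contrL_bil k m i x v) _ _ (dDB H _ _ Bb)).
    exact: subspI (dB H) (dG H _).
  move=> y1 y2 [By1 gy1] [By2 gy2]; split.
    apply: (B_M H); first exact: (dB2B H (cR1_B2 H _ _)).
    by apply: (B_M H); [exact: (B1'B H (cR2_B1' H _ _))|exact: (KB H)].
  apply: (GM H (cR1_G H _ _) (GMK H _ (cR2_G H _ _))); lia.
have [BS gS] := subsp_fsum (subspI (dB H) (dG H (m + k))) brB.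
apply: (pairing_eqB H BS gS (LB_B H _ _ _ Bb) (LB_G H _ _ _ Bb)).
move=> i1 a1 a2 u a1A ga1 a2A ga2.
have Aa1 := dA1A H a1A; have Aa2 := A2'A H a2A.
have Aa12 := A_M H Aa1 Aa2.
have ga12 := dGM H ga1 ga2.
have [p0 pD _] := linP (pr (a1 * a2 * K u)).
have [cb Hcb] := contrL_sup Bb gb.
rewrite (fsum_morph p0 pD); last first.
  by exists (zwin 0 cb) => i /Hcb[/andP[? ?] _]; exact: mem_zwin.
have bF : bilinear_map (fun y1 y2 =>
    chi u (- v) * (p (a2 * x) y1 * p a1 y2) : F^o).
  apply: (bil_post (bil_mulF (pr _) (pr _)) (h := fun z : F^o => chi u (- v) * z : F^o)).
  by move=> c z z'; rewrite mulrDr; congr (_ + _); rewrite mulrCA.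
have pE i : p (a1 * a2 * K u) (contrL k m i x v b) =
    chi u (- v) * tlift (fun y1 y2 => p (a2 * x) y1 * p a1 y2 : F^o)
      (Delta b (m + i) (- i)).
  rewrite /contrL [LHS](linear_tlift (h := p _ : D -> F^o)) //; last exact: contrL_bil.
  rewrite [RHS](linear_tlift (h := fun z : F^o => chi u (- v) * z : F^o)); last 2 first.
  - by move=> c z z'; rewrite mulrDr; congr (_ + _); rewrite mulrCA.
  - exact: (bil_mulF (pr _) (pr _)).
  apply: (tlift_eq_on (U := F^o) _ bF _ (dDB H _ _ Bb)).
    exact: (bil_post (contrL_bil k m i x v) (h := p _ : D -> F^o)).
  move=> y1 y2 [By1 gy1] [By2 gy2].
  have a2K : A2 (a2 * K u) := A2_M H (dA2'A H a2A) (dKA H u).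
  have cB := cR2_B1' H (m + i + k) (LB k (m + i) x y1).
  rewrite -mulrA (dpfac H a1A a2K (cR1_B2 H _ _)); last first.
    exact: (B1_M H) (dB1'B H cB) (dKB H _).
  rewrite (dpfac2 H) // (p_cR1 H a1A ga1 By2 gy2).
  rewrite (p_cR2 H a2A ga2 (LB_B H _ _ _ By1) (LB_G H _ _ _ By1)).
  by rewrite (LB_adj H By1 gy1 Ax gx Aa2 ga2); ring.
rewrite (eq_fsum pE) (fsum_single (i0 := i1)) => [|i ii]; last first.
  rewrite (tlift_eq0 (U := F^o) _ _ (dDB H _ _ Bb)) ?mulr0 //.
    exact: (bil_mulF (pr _) (pr _)).
  move=> y1 y2 _ [By2 gy2]; rewrite (pdeg H Aa1 ga1 By2 gy2) ?mulr0 //; lia.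
rewrite (LB_adj H Bb gb Ax gx (A_M H Aa12 (KA H u)) (GMK H u ga12)).
rewrite -mulrA (_ : K u * x = chi u (- v) *: (x * K u)); last first.
  by rewrite vx scalerA (chiNr H) scale1r.
rewrite -scalerAr (pZl H) mulrA (wb _ _ _ (A_M H Aa12 Ax) (dGM H ga12 gx)).
rewrite (chi0r H) mul1r -mulrA; congr (_ * _).
have x2A' := A_M H Aa2 Ax.
rewrite (dpmull H Aa1 ga1 x2A' (dGM H ga2 gx) Bb gb).
by rewrite (_ : - (- (m + k) - i1 + k) = m + i1) //; ring.
Qed.

Lemma contrR_sum k m x w b : A x -> G k x -> B b -> G m b -> lwB w b ->
  \sum_(i \in [set: int]) contrR k m i x b = RB k m x b * K (- w).
Proof.
move=> Ax gx Bb gb wb.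
have brB i : (B `&` G (m + k)) (contrR k m i x b).
  apply: (tlift_subsp (contrR_bil k m i x) _ _ (dDB H _ _ Bb)).
    exact: subspI (dB H) (dG H _).
  move=> y1 y2 [By1 gy1] [By2 gy2]; split.
    apply: (B_M H); first exact: (dB2B H (cR1_B2 H _ _)).
    exact: (B1'B H (cR2_B1' H _ _)).
  apply: (GM H (cR1_G H _ _) (cR2_G H _ _)); lia.
have [BS gS] := subsp_fsum (subspI (dB H) (dG H (m + k))) brB.
have BL := LB_B H k m x Bb; have BR := RB_B H k m x Bb.
have gR := RB_G H k m x Bb.
have lwR : lwB w (RB k m x b).
  move=> k' a' u' Aa' ga'.
  rewrite (RB_adj H Bb gb Ax gx (A_M H Aa' (KA H _)) (GMK H _ ga')).
  rewrite (RB_adj H Bb gb Ax gx Aa' ga') mulrA.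
  exact: wb (A_M H Ax Aa') (dGM H gx ga').
have lwRK := lwB_MK H (- w) BR gR lwR; rewrite subrr in lwRK.
have BRK := B_M H BR (KB H (- w)).
apply: (pairing_eqB H BS gS BRK (GMK H _ gR)).
move=> i1 a1 a2 u a1A ga1 a2A ga2.
have Aa1 := dA1A H a1A; have Aa2 := A2'A H a2A.
have Aa12 := A_M H Aa1 Aa2.
have ga12 := dGM H ga1 ga2.
have [p0 pD _] := linP (pr (a1 * a2 * K u)).
have [cb Hcb] := contrR_sup Bb gb.
rewrite (fsum_morph p0 pD); last first.
  by exists (zwin (- m) cb) => i /Hcb[/andP[? ?] _]; exact: mem_zwin.
have bF : bilinear_map (fun y1 y2 => p a2 y1 * p (x * a1) y2 : F^o).
  exact: (bil_mulF (pr _) (pr _)).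
have pE i : p (a1 * a2 * K u) (contrR k m i x b) =
    tlift (fun y1 y2 => p a2 y1 * p (x * a1) y2 : F^o) (Delta b (m + i) (- i)).
  rewrite /contrR [LHS](linear_tlift (h := p _ : D -> F^o)) //; last exact: contrR_bil.
  apply: (tlift_eq_on (U := F^o) _ bF _ (dDB H _ _ Bb)).
    exact: (bil_post (contrR_bil k m i x) (h := p _ : D -> F^o)).
  move=> y1 y2 [By1 gy1] [By2 gy2].
  have a2K : A2 (a2 * K u) := A2_M H (dA2'A H a2A) (dKA H u).
  have cB := cR2_B1' H (m + i) y1.
  rewrite -mulrA (dpfac H a1A a2K (cR1_B2 H _ _) (dB1'B H cB)).
  rewrite -[cR2 _ _]mulr1 -(dK0 H) (dpfac2 H) // (chi0r H) mulr1.
  rewrite [k - i]addrC (p_cR1 H a1A ga1 (RB_B H _ _ _ By2) (RB_G H _ _ _ By2)).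
  rewrite (p_cR2 H a2A ga2 By1 gy1).
  by rewrite (RB_adj H By2 gy2 Ax gx Aa1 ga1) mulrC.
rewrite (eq_fsum pE) (fsum_single (i0 := k + i1)) => [|i ii]; last first.
  apply: (tlift_eq0 (U := F^o) bF _ (dDB H _ _ Bb)) => y1 y2 _ [By2 gy2].
  rewrite (pdeg H (A_M H Ax Aa1) (dGM H gx ga1) By2 gy2) ?mulr0 //; lia.
rewrite (lwRK _ _ _ Aa12 ga12) (chi0r H) mul1r.
have rw12 : rwA 0 (a1 * a2).
  by rewrite -[a1 * a2]mulr1 -(dK0 H); exact: (rwA_prod H).
rewrite (rw12 _ _ _ BR gR) (chi0l H) mul1r (RB_adj H Bb gb Ax gx Aa12 ga12).
rewrite mulrA (dpmull H (A_M H Ax Aa1) (dGM H gx ga1) Aa2 ga2 Bb gb).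
by rewrite (_ : - (- (m + k) - i1) = m + (k + i1)) //; ring.
Qed.

Lemma ctl_tmul m b i k t t' : B b -> G m b ->
  tspan (A `&` G i) setT t -> tspan (A `&` G k) setT t' ->
  ctl (p^~ b) (tmul t t') =
  tlift (fun y1 y2 => ctl (p^~ y2) t * ctl (p^~ y1) t') (Delta b (- k) (- i)).
Proof.
move=> Bb gb [s [Hs ->]] [s' [Hs' ->]].
rewrite (linear_bigsum _ _ _ (lin_comp (ctl_lin (pl b)) (tmul_linl _))).
have bil : bilinear_map (fun y1 y2 : D =>
    ctl (p^~ y2) (\sum_(q <- s) tens q.1 q.2) *
    ctl (p^~ y1) (\sum_(q <- s') tens q.1 q.2)).
  by apply: bil_mul'; apply: (ctl_linphi (phi := fun x => p^~ x)).
have [sb [Hsb sbE]] := dDB H (- k) (- i) Bb.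
rewrite sbE tlift_list //.
under [RHS]eq_bigr => qb _ do rewrite !ctl_list // mulr_suml.
rewrite exchange_big big_seq [RHS]big_seq; apply: eq_bigr => q /Hs[[Aq gq] _].
rewrite (linear_bigsum _ _ _ (lin_comp (ctl_lin (pl b)) (tmul_linr _))).
under [RHS]eq_bigr => qb _ do rewrite mulr_sumr.
rewrite exchange_big big_seq [RHS]big_seq; apply: eq_bigr => q' /Hs'[[Aq' gq'] _].
rewrite tmul_tens /ctl tlift_tens; last exact: ctl_bil.
rewrite (dpmull H Aq gq Aq' gq' Bb gb) sbE (tlift_list (U := F^o)); last first.
  exact: (bil_mulF (pr _) (pr _)).
rewrite scaler_suml; apply: eq_bigr => qb _.
by rewrite -scalerAl -scalerAr scalerA mulrC.
Qed.

(** The factorization of the pairing, for tensors: a product with left legs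
    in A1 and A2 is contracted factor by factor. *)
Lemma ctl_tmul_fac b2 b1 (t t' : tensor D D) : B2 b2 -> B1 b1 ->
  tspan A1 setT t -> tspan A2 setT t' ->
  ctl (p^~ (b2 * b1)) (tmul t t') = ctl (p^~ b2) t * ctl (p^~ b1) t'.
Proof.
move=> b2B b1B [s [Hs ->]] [s' [Hs' ->]].
rewrite (linear_bigsum _ _ _ (lin_comp (ctl_lin (pl _)) (tmul_linl _))).
rewrite !ctl_list // mulr_suml big_seq [RHS]big_seq; apply: eq_bigr => q /Hs[Aq _].
rewrite (linear_bigsum _ _ _ (lin_comp (ctl_lin (pl _)) (tmul_linr _))) mulr_sumr.
rewrite big_seq [RHS]big_seq; apply: eq_bigr => q' /Hs'[Aq' _].
rewrite tmul_tens /ctl tlift_tens; last exact: ctl_bil.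
by rewrite (dpfac H) // -scalerAl -scalerAr scalerA.
Qed.

End BracketIdentities.
(** * The intertwiner of an element of A2 *)

Section SwapContractions.
Variables (F : fieldType) (D : algType F) (p : D -> D -> F).
Hypothesis pl : forall b, linear (p^~ b : D -> F^o).
Hypothesis pr : forall a, linear (p a : D -> F^o).

Lemma swap_ctr (h : D -> D) (ta tb : tensor D D) : linear h ->
  tlift (fun x1 x2 => x1 * h (ctr (p x2) tb)) ta =
  tlift (fun y1 y2 => ctr (p^~ y2) ta * h y1) tb.
Proof.
move=> hl; transitivity (tlift (fun x1 x2 => tlift (fun y1 y2 =>
    p x2 y2 *: (x1 * h y1)) tb) ta).
  apply: tlift_eq => x y.
  rewrite [LHS](linear_tlift (h := fun z => x * h z)); last 2 first.
  - exact: lin_comp (lin_mull _) hl.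
  - exact: ctr_bil.
  by apply: tlift_eq => x' y'; have [_ _ ->] := linP hl; rewrite scalerAr.
rewrite tlift_exch; last 2 first.
- by move=> x y; exact: (bil_scr (pr y) (lin_comp (lin_mull x) hl)).
- by move=> x y; exact: (bil_scr (pl y) (lin_mulr (h x))).
apply: tlift_eq => x y.
rewrite [RHS](linear_tlift (h := fun z => z * h x)); last 2 first.
- exact: lin_mulr.
- exact: ctr_bil.
by apply: tlift_eq => x' y'; rewrite scalerAl.
Qed.

End SwapContractions.

Section CoproductOfProduct.
Variables (F : fieldType) (D : algType F) (G : int -> set D).
Variables (Delta : D -> ctens D) (eps : D -> F).
Variables (r : nat) (K : 'rV[int]_r -> D) (p : D -> D -> F).
Variables (A A1 A2 A2' B B2 B1 B1' : set D) (R1 R2 : int -> tensor D D).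
Hypothesis H : double_data G Delta eps K p A A1 A2 A2' B B2 B1 B1' R1 R2.

Lemma DeltaMr m n x y i : G m x -> G n y -> Delta (x * y) (m + n + i) (- i) =
  \sum_(j \in [set: int])
    tmul (Delta x (m + j) (- j)) (Delta y (n + (i - j)) (- (i - j))).
Proof.
move=> gx gy; have := dDM H gx gy (m + n + i).
rewrite (_ : m + n - (m + n + i) = - i); last by ring.
move=> ->; rewrite (fsum_shift _ (- m)); apply: eq_fsum => j.
by congr (tmul (Delta x _ _) (Delta y _ _)); ring.
Qed.

Lemma DeltaMl m n x y i : G m x -> G n y -> Delta (x * y) (- i) (m + n + i) =
  \sum_(j \in [set: int])
    tmul (Delta x (- j) (m + j)) (Delta y (- (i - j)) (n + (i - j))).
Proof.
move=> gx gy; have := dDM H gx gy (- i).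
rewrite (_ : m + n - (- i) = m + n + i); last by ring.
move=> ->; rewrite (fsum_refl _ 0); apply: eq_fsum => j.
by congr (tmul (Delta x _ _) (Delta y _ _)); ring.
Qed.

End CoproductOfProduct.

Section CaseA2.
Variables (F : fieldType) (D : algType F) (G : int -> set D).
Variables (Delta : D -> ctens D) (eps : D -> F).
Variables (r : nat) (K : 'rV[int]_r -> D) (p : D -> D -> F).
Variables (A A1 A2 A2' B B2 B1 B1' : set D) (R1 R2 : int -> tensor D D).
Hypothesis H : double_data G Delta eps K p A A1 A2 A2' B B2 B1 B1' R1 R2.

Local Notation chi u v := (p (K u) (K v)).
Local Notation RA := (RA Delta p).
Local Notation RB := (RB Delta p).
Local Notation rwA := (rwA G K p B).
Local Notation lwB := (lwB G K p A).
Local Notation cR1 := (cR1 p R1).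
Local Notation cR2 := (cR2 p R2).
Let pl := dpl H.
Let pr := dpr H.

Variables (n : int) (a : D) (u : 'rV[int]_r).
Hypothesis a2 : A2 a.
Hypothesis ga : G n a.
Hypothesis ua : rwA u a.
Let Aa := dA2A H a2.

Local Notation V := (DeltaR1 Delta R1 n a).

(** The contraction Phi of Delta(a)^(2,1) R1 with b. The solution X of the
    equation R1 X = Delta(a)^(2,1) R1 is X = (id (x) Phi)(R2') (K_u (x) 1):
    against b2 b1 the left side gives b2 <X, b1>, so that X has to be read
    off from the restriction of Phi to B1, where the right weight u of a
    accounts for the group-like elements. *)
Definition Phi2 (m : int) b := ctl (p^~ b) (V (- m)).
Definition X2 (i : int) := tlift (fun x z => tens (x * K u) (Phi2 (- i) z)) (R2 i).

Lemma Phi2_lin m : linear (Phi2 m).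
Proof. by apply: (ctl_linphi (phi := fun x => p^~ x)). Qed.

Let term_bil i m : bilinear_map (fun y1 y2 => RA (- i) n y2 a * cR1 (m + i) y1).
Proof. exact: bil_mul' (linRA H _ _ _) (cR1_lin H _). Qed.

Lemma Phi2_RA m b : B b -> G m b -> Phi2 m b = \sum_(i \in [set: int])
  tlift (fun y1 y2 => RA (- i) n y2 a * cR1 (m + i) y1) (Delta b (m + i) (- i)).
Proof.
move=> Bb gb; rewrite /Phi2 (DeltaR1_formula H Aa ga Bb gb); apply: eq_fsum => i.
rewrite /RB (swap_ctr pl pr); last exact: (cR1_lin H).
by apply: tlift_eq => x y; rewrite /RA opprK.
Qed.

Lemma Phi2_sup m b : B b -> G m b -> exists s : seq int, forall i,
  tlift (fun y1 y2 => RA (- i) n y2 a * cR1 (m + i) y1) (Delta b (m + i) (- i)) != 0 ->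
  i \in s /\ n <= i <= - m.
Proof.
move=> Bb gb; exists (zwin n (- m)) => i.
suff : ~~ (n <= i <= - m) -> tlift (fun y1 y2 => RA (- i) n y2 a * cR1 (m + i) y1)
    (Delta b (m + i) (- i)) = 0.
  move=> h; case/boolP: (n <= i <= - m) => [/andP[ni im] _|/h ->].
    by split=> //; exact: mem_zwin.
  by rewrite eqxx.
move=> ni; apply: (tlift_eq0 (term_bil i m) _ (dDB H _ _ Bb)) => y1 y2 _ _.
have [im|im] := ltP 0 (m + i); first by rewrite (cR1_0 H) // mulr0.
rewrite (_ : RA _ _ _ _ = 0) ?mul0r //; apply: (dA2n H) (RA_G H _ _ _ Aa).
  lia.
exact: (RA_A2 H).
Qed.

Lemma Phi2_G m b : B b -> G m b -> G (n + m) (Phi2 m b).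
Proof.
move=> Bb gb; rewrite (Phi2_RA Bb gb); apply: subsp_fsum (dG H _) _ => i.
apply: (tlift_subsp (term_bil i m) (dG H _) _ (dDB H _ _ Bb)) => y1 y2 _ _.
apply: (GM H (RA_G H _ _ _ Aa) (cR1_G H _ _)); ring.
Qed.

Lemma Phi2_0 m b : B b -> G m b -> - m < n -> Phi2 m b = 0.
Proof.
move=> Bb gb mn; rewrite (Phi2_RA Bb gb); apply: fsum0 => i.
have [s Hs] := Phi2_sup Bb gb; apply/eqP/negPn/negP => /Hs[_]; lia.
Qed.

Lemma Phi2_K m b w : B b -> G m b -> Phi2 m (b * K w) = chi u w *: Phi2 m b.
Proof.
move=> Bb gb; have BbK := B_M H Bb (KB H w); have gbK := GMK H w gb.
rewrite (Phi2_RA BbK gbK) (Phi2_RA Bb gb).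
have hl : linear (fun z : D => chi u w *: z).
  by move=> k x y; rewrite scalerDr !scalerA mulrC.
have [h0 hD _] := linP hl.
rewrite (fsum_morph h0 hD); last first.
  by have [s Hs] := Phi2_sup Bb gb; exists s => i /Hs[].
apply: eq_fsum => i; rewrite (DeltaMK H w gb); last by rewrite -addrA subrr addr0.
rewrite tlift_tmul // (linear_tlift _ hl) //.
have bil2 : bilinear_map (fun x y => RA (- i) n (y * K w) a * cR1 (m + i) (x * K w)).
  exact: bil_mul' (lin_comp (linRA H _ _ _) (lin_mulr _)) (lin_comp (cR1_lin H _) (lin_mulr _)).
transitivity (tlift (fun x y => RA (- i) n (y * K w) a * cR1 (m + i) (x * K w))
    (Delta b (m + i) (- i))).
  apply: tlift_eq => x y; rewrite tlift_tens //.
  exact: bil_comp (term_bil i m) (lin_mull _) (lin_mull _).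
apply: (tlift_eq_on bil2 (bil_post (term_bil i m) hl) _ (dDB H (m + i) (- i) Bb)).
move=> x y [Bx gx] [By gy].
have := RA_mul H By gy (KB H w) (dKG H w) Aa ga; rewrite !addr0 => ->.
rewrite (RA_rw H w Aa ga ua) (cR1_K H _ Bx gx).
by have [_ _ ->] := linP (linRAa H (- i) n y); rewrite -!scalerAl.
Qed.

(** After expanding Delta(b2 b), the part that depends on b2 is psi(a'', b2)
    for elements a'' of A2 obtained by letting b act on a. By psi_A2B2 it is
    b2 a''. *)
Lemma Phi2_mul m2 m b2 b : B2 b2 -> G m2 b2 -> B b -> G m b ->
  Phi2 (m2 + m) (b2 * b) = b2 * Phi2 m b.
Proof.
move=> b2B gb2 Bb gb; have Bb2 := dB2B H b2B.
rewrite (Phi2_RA (B_M H Bb2 Bb) (dGM H gb2 gb)) (Phi2_RA Bb gb).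
pose X i := Delta b2 (m2 + i) (- i); pose Y i := Delta b (m + i) (- i).
pose T i := tlift (fun y1 y2 => RA (- i) n y2 a * cR1 (m2 + m + i) y1).
have Tl i : linear (T i) by apply: tlift_linear; exact: term_bil.
(* The term of the double sum with right legs of degrees - i2 in the
   coproduct of b2 and - i1 in that of b. *)
pose f i2 i1 := T (i1 + i2) (tmul (X i2) (Y i1)).
pose psit i1 i2 a' := tlift (fun y1 y2 => RA (- i2) (n - i1) y2 a' * y1) (X i2).
have psit_bil i1 i2 a' : bilinear_map (fun y1 y2 => RA (- i2) (n - i1) y2 a' * y1).
  exact: bil_mul' (linRA H _ _ _) (@lin_id _ _).
have a'A2 i1 y : A2 (RA (- i1) n y a) by exact: (RA_A2 H).
have a'G i1 y : G (n - i1) (RA (- i1) n y a) by exact: (RA_G H _ _ _ Aa).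
have fE i1 i2 s : (forall q, q \in s -> (B `&` G (m + i1)) q.1 /\ (B `&` G (- i1)) q.2) ->
    Y i1 = \sum_(q <- s) tens q.1 q.2 ->
    f i2 i1 = \sum_(q <- s) psit i1 i2 (RA (- i1) n q.2 a) * cR1 (m + i1) q.1.
  move=> Hs sE; rewrite /f sE (linear_bigsum _ _ _ (lin_comp (Tl _) (tmul_linr _))).
  rewrite big_seq [RHS]big_seq; apply: eq_bigr => q /Hs[[Bq gq] [Bq' gq']].
  rewrite /T tlift_tmul //.
  rewrite /psit [RHS](linear_tlift (h := fun z => z * cR1 (m + i1) q.1)) //; last exact: lin_mulr.
  have bil1 : bilinear_map (fun x y => RA (- (i1 + i2)) n (y * q.2) a *
      cR1 (m2 + m + (i1 + i2)) (x * q.1)).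
    exact: bil_mul' (lin_comp (linRA H _ _ _) (lin_mulr _)) (lin_comp (cR1_lin H _) (lin_mulr _)).
  transitivity (tlift (fun x y => RA (- (i1 + i2)) n (y * q.2) a *
      cR1 (m2 + m + (i1 + i2)) (x * q.1)) (X i2)).
    apply: tlift_eq => x y; rewrite tlift_tens //.
    exact: bil_comp (term_bil _ _) (lin_mull _) (lin_mull _).
  apply: (tlift_eq_on bil1 _ _ (dDB2 H _ _ b2B)) => [|x y [xB gx] [By gy]].
    by apply: bil_post (psit_bil _ _ _) (lin_mulr _).
  have := RA_mul H By gy Bq' gq' Aa ga; rewrite addrC -opprD => ->.
  have := cR1_mul H xB gx Bq gq.
  rewrite (_ : m2 + i2 + (m + i1) = m2 + m + (i1 + i2)); last by ring.
  by move=> ->; rewrite mulrA.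
have psit0 i1 i2 a' : A2 a' -> G (n - i1) a' -> ~~ ((n <= i1) && (n - i1 <= i2 <= - m2)) ->
    psit i1 i2 a' = 0.
  move=> a'2 ga' ni; apply: (tlift_eq0 (psit_bil i1 i2 a') _ (dDB2 H _ _ b2B)).
  move=> y1 y2 [y1B gy1] _.
  have [h1|h1] := ltP 0 (m2 + i2); first by rewrite (dB2n H h1 y1B gy1) mulr0.
  have Aa' := dA2A H a'2.
  have [h2|h2] := ltP 0 (n - i1).
    rewrite (dA2n H h2 a'2 ga'); have [-> _ _] := linP (linRAa H (- i2) (n - i1) y2).
    by rewrite mul0r.
  rewrite (_ : RA _ _ _ _ = 0) ?mul0r //.
  by apply: (dA2n H) (RA_A2 H _ _ _ a'2) (RA_G H _ _ _ Aa'); lia.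
have f0 i2 i1 : f i2 i1 != 0 -> (i2 \in zwin (n + m) (- m2)) && (i1 \in zwin n (- m)).
  have [s [Hs sE]] := dDB H (m + i1) (- i1) Bb.
  rewrite (fE _ _ _ Hs sE); apply: contraR => ni; apply/eqP.
  apply: big1_seq => q /Hs _.
  have [h1|h1] := ltP 0 (m + i1); first by rewrite (cR1_0 H) // mulr0.
  rewrite psit0 ?mul0r //; apply: contra ni => /andP[h2 /andP[h3 h4]].
  by rewrite !mem_zwin //; lia.
transitivity (\sum_(i \in [set: int]) \sum_(i2 \in [set: int]) f i2 (i - i2)).
  apply: eq_fsum => i; rewrite (DeltaMr H _ gb2 gb).
  rewrite -/(T i _); have [T0 TD _] := linP (Tl i).
  rewrite (fsum_morph T0 TD).
    by apply: eq_fsum => j; rewrite /f addrAC -addrA addrN addr0.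
  have [c2 Hc2] := DeltaA_sup H gb2; have [c Hc] := DeltaA_sup H gb.
  exists (zwin (i + c) (- c2)) => j; apply: contraR => nj.
  have [h1|h1] := ltP (- j) c2; first by rewrite Hc2 ?tmul0t //; lia.
  have [h2|h2] := ltP (- (i - j)) c; first by rewrite Hc ?tmult0 //; lia.
  by rewrite mem_zwin // in nj; lia.
rewrite (fsum_conv f0) (fsum_exch f0).
have [h0 hD _] := linP (@lin_mull F D b2).
rewrite (fsum_morph h0 hD); last first.
  by have [s Hs] := Phi2_sup Bb gb; exists s => i /Hs[].
apply: eq_fsum => i1.
have [s [Hs sE]] := dDB H (m + i1) (- i1) Bb.
under eq_fsum => i2 do rewrite (fE _ _ _ Hs sE).
have psit_sup q : fsup (fun i2 => psit i1 i2 (RA (- i1) n q a)).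
  exists (zwin (n - i1) (- m2)) => i2; apply: contraR => ni.
  rewrite psit0 //; apply: contra ni => /andP[_ /andP[h1 h2]].
  by rewrite mem_zwin.
rewrite fsum_big => [|q _]; last first.
  have [t Ht] := psit_sup q.2; exists t => i2; apply: contraR => /(contra (Ht i2)).
  by rewrite negbK => /eqP ->; rewrite mul0r.
rewrite sE tlift_list ?(linear_bigsum _ _ _ (lin_mull b2)); last exact: term_bil.
rewrite big_seq [RHS]big_seq; apply: eq_bigr => q /Hs[[Bq gq] [Bq' gq']].
have [k0 kD _] := linP (@lin_mulr F D (cR1 (m + i1) q.1)).
rewrite -(fsum_morph k0 kD); last exact: psit_sup.
rewrite mulrA; congr (_ * _).
have psiE := psi_A2B2 H (a'A2 i1 q.2) (a'G i1 q.2) b2B gb2.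
by rewrite -psiE (psi_RA H (dA2A H (a'A2 _ _)) (a'G _ _) Bb2 gb2).
Qed.

Lemma X2_bil i : bilinear_map (fun x z => tens (x * K u) (Phi2 (- i) z)).
Proof. exact: bil_comp (tens_bilinear D D) (lin_mulr _) (Phi2_lin _). Qed.

Lemma X2_span i : tspan (A2 `&` G i) (G (n - i)) (X2 i).
Proof.
have [s [Hs sE]] := dR2 H i; rewrite /X2 sE tlift_list; last exact: X2_bil.
apply: tspan_sum => q /Hs[[q2 gq] [q1 gq']]; apply: tspan_tens.
  by split; [apply: (A2_M H) (dA2'A H q2) (dKA H u)|exact: (GMK H)].
by have := Phi2_G (B1'B H q1) gq'.
Qed.

(** X has finitely many components: A2 has no positive degrees, and Phi
    kills the elements of B of degree greater than - n. *)
Lemma X2_sup i : X2 i != 0 -> n <= i <= 0.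
Proof.
apply: contraR => ni; have [i0|i0] := ltP 0 i.
  by rewrite /X2 (R2_pos H i0) tlift0 //; exact: X2_bil.
apply/eqP/(tlift_eq0 (X2_bil i) _ (dR2 H i)) => x z _ [z1 gz].
rewrite Phi2_0 ?opprK //; first by have [-> _ _] := linP (fun c a b => bil_r (tens_bilinear D D) c a b (x * K u)).
- exact: (B1'B H).
- lia.
Qed.

Lemma X2_ctl i b : B1 b -> G (- i) b -> ctl (p^~ b) (X2 i) = Phi2 (- i) b.
Proof.
apply: (dB1_ind H (P := [set b | ctl (p^~ b) (X2 i) = Phi2 (- i) b])).
  apply: subsp_eq; first exact: (ctl_linphi (phi := fun x => p^~ x)).
  exact: Phi2_lin.
move=> c w c1 gc /=; rewrite (Phi2_K w (B1'B H c1) gc).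
have [_ _ <-] := linP (Phi2_lin (- i)).
rewrite -{2}(dR2l H c1 gc) /X2.
have [_ _ Z] := linP (Phi2_lin (- i)); rewrite Z.
rewrite (linear_tlift _ (Phi2_lin _) (ctl_bil (pl c))).
rewrite (linear_tlift _ (ctl_lin (pl _)) (X2_bil i)).
rewrite [RHS](linear_tlift (h := fun z => chi u w *: z)); last 2 first.
- by move=> k x y; rewrite scalerDr !scalerA mulrC.
- exact: bil_post (ctl_bil (pl c)) (Phi2_lin _).
apply: (tlift_eq_on _ _ _ (dR2 H i)) => [||x z [x2 gx] _].
- exact: bil_post (X2_bil i) (ctl_lin (pl _)).
- apply: bil_post (bil_post (ctl_bil (pl c)) (Phi2_lin _)) _.
  by move=> k x y; rewrite scalerDr !scalerA mulrC.
rewrite /ctl tlift_tens; last exact: ctl_bil.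
by have [_ _ ->] := linP (Phi2_lin (- i)); rewrite (dpfac2 H) // scalerA mulrC.
Qed.

Lemma R1X2_sup j : fsup (fun i => tmul (R1 i) (X2 (j - i))).
Proof.
exists (zwin 0 (j - n)) => i; apply: contraR => ni.
have [i0|i0] := ltP i 0; first by rewrite (R1_neg H i0) tmul0t.
have [->|/X2_sup h] := eqVneq (X2 (j - i)) 0; first by rewrite tmult0.
by rewrite mem_zwin // in ni; lia.
Qed.

Lemma X2R2_sup j : fsup (fun i => tmul (X2 i) (R2 (j - i))).
Proof.
exists (zwin n 0) => i; apply: contraR => ni.
have [->|/X2_sup h] := eqVneq (X2 i) 0; first by rewrite tmul0t.
by rewrite mem_zwin // in ni; lia.
Qed.

Lemma DeltaR1_span j : tspan (A `&` G j) setT (V j).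
Proof.
apply: tspan_fsum => i; apply: (tspan_tmul (S := A `&` G i) (T := setT)
  (S' := A `&` G (j - i)) (T' := setT)) => //.
- move=> x y [Ax gx] [Ay gy]; split; first exact: (A_M H).
  apply: (GM H gx gy); ring.
- apply: tspan_tflip; apply: tspan_sub (dDA H (n - i) i Aa) => //.
- apply: tspan_sub (dR1 H (j - i)) => // x [x1 gx]; split=> //; exact: (dA1A H).
Qed.

(** Against b2 c K_w, with b2 in B2 and c in B1', the left side is b2 Phi(c
    K_w) and the right side is Phi(b2 c K_w). *)
Lemma R1X2 j : tconv R1 X2 j = V j.
Proof.
apply: (eq_testA H (j := j)) => [||i b2 c w b2B gb2 cB gc].
- apply: tspan_fsum => i; apply: (tspan_tmul (S := A1 `&` G i) (T := setT)
    (S' := A2 `&` G (j - i)) (T' := setT)) => //.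
  + move=> x y [x1 gx] [y2 gy]; split.
      by apply: (A_M H); [exact: (dA1A H)|exact: (dA2A H)].
    apply: (GM H gx gy); ring.
  + exact: tspan_sub (dR1 H i).
  + exact: tspan_sub (X2_span (j - i)).
- exact: DeltaR1_span.
have Bc := B1'B H cB.
have cK : B1 (c * K w) := B1_M H (dB1'B H cB) (dKB H w).
have gcK := GMK H w gc.
have <- : Phi2 (- j) (b2 * (c * K w)) = ctl (p^~ (b2 * c * K w)) (V j).
  by rewrite /Phi2 opprK mulrA.
have e1 : - j = i + (- j - i) by ring.
have e2 : - (j + i) = - j - i by ring.
rewrite {1}e1 (Phi2_mul b2B gb2 (dB1B H cK) gcK).
have [h0 hD _] := linP (ctl_lin (pl (b2 * c * K w))).
rewrite /tconv (fsum_morph h0 hD); last exact: R1X2_sup.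
have tE k : ctl (p^~ (b2 * c * K w)) (tmul (R1 k) (X2 (j - k))) =
    ctl (p^~ b2) (R1 k) * ctl (p^~ (c * K w)) (X2 (j - k)).
  rewrite -mulrA; apply: (ctl_tmul_fac H) => //.
    by apply: tspan_sub (dR1 H k) => // x [].
  by apply: tspan_sub (X2_span (j - k)) => // x [].
rewrite (eq_fsum tE) (fsum_single (i0 := - i)) => [|k ki]; last first.
  rewrite (_ : ctl (p^~ b2) (R1 k) = 0) ?mul0r //.
  apply: (tlift_eq0 (ctl_bil (pl b2)) _ (dR1 H k)) => x y [x1 gx] _.
  by rewrite (pdeg H (dA1A H x1) gx (dB2B H b2B) gb2) ?scale0r //; lia.
by rewrite (dR1l H) ?opprK // X2_ctl // e2 //; exact: (GMK H).
Qed.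

Variable la : int -> seq (wterm D r).
Hypothesis Hla : forall i, [/\ forall q, q \in la i -> wt_ok G K p A i (n - i) q,
  Delta a i (n - i) = \sum_(q <- la i) wt_tens q &
  Delta a i (n - i) = 0 -> la i = [::]].

Hypothesis la2 : forall i q, q \in la i -> A2 q.1.1.

Local Notation W := (R2Delta K R2 la).

Let twD2 i : tspan (A2 `&` G i) setT (conjDelta K la i).
Proof.
apply: tspan_sum => q qi; have [[Aq gq] _ _ _] := la_ok Hla qi.
apply: tspan_tens => //; split; last exact: (GMK H).
exact: (A2_M H) (la2 qi) (dKA H _).
Qed.

Lemma R2Delta_span2 j : tspan (A2 `&` G j) setT (W j).
Proof.
apply: tspan_fsum => i; apply: (tspan_tmul (S := A2 `&` G i) (T := setT)
  (S' := A2 `&` G (j - i)) (T' := setT)) => //.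
- move=> x y [Ax gx] [Ay gy]; split; first exact: (A2_M H).
  apply: (GM H gx gy); ring.
- apply: tspan_sub (dR2 H i) => // x [x2 gx]; split=> //; exact: (dA2'A H).
Qed.

Lemma psi_RB_sup m b : B b -> G m b -> exists s : seq int, forall i,
  tlift (fun x1 x2 => x1 * RB i m x2 b) (Delta a (n - i) i) != 0 -> i \in s.
Proof.
move=> Bb gb; have [ca Ha] := DeltaA_sup H ga; have [cb Hb] := DeltaA_sup H gb.
have bil i : bilinear_map (fun x1 x2 => x1 * RB i m x2 b).
  exact: bil_mul (@lin_id _ _) (linRB H _ _ _).
exists (zwin ca (- cb)) => i; apply: contraR => ni.
have [h1|h1] := ltP i ca; first by rewrite Ha ?tlift0 //; lia.
have [h2|h2] := ltP (- i) cb; last by rewrite mem_zwin // in ni; lia.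
apply/eqP; apply: (tlift_eq0 (bil i) _ (dDA H _ _ Aa)) => x y _ _.
by rewrite /RB Hb; [have [-> _ _] := linP (ctr_lin (pr y)); rewrite mulr0|lia|].
Qed.

Lemma PhiK_psi m b : B1 b -> G m b ->
  PhiK G Delta p A2 B1 la m b = psi Delta p n m a b.
Proof.
move=> b1 gb; apply: eq_fsum => i; have [_ -> _] := Hla i.
rewrite tlift_sum; last exact: bil_mul (linLB H _ _ _) (@lin_id _ _).
apply: eq_bigr => q _; rewrite /wt_tens tlift_tens; last first.
  exact: bil_mul (linLB H _ _ _) (@lin_id _ _).
rewrite (cR2K_B1 H (LB_B1 H _ _ _ b1)) //.
exact: (LB_G H _ _ _ (dB1B H b1)).
Qed.

Let g_bil2 (i k : int) y : bilinear_map (fun x1 x2 =>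
  x1 * cR1 (- i + k) (RB k (- i) x2 y)).
Proof. exact: bil_mul (@lin_id _ _) (lin_comp (cR1_lin H _) (linRB H _ _ _)). Qed.

(** It is enough to contract with B1. The right side gives psi(a, b) K_(-w)
    because the projection onto B1 is the identity there. On the left side
    Phi is written out; then (x (x) 1) R1 R2' appears for the right legs x
    of Delta(a), and its contraction with b is that of x acting on b, so
    that the other side of the exchange relation emerges. *)
Lemma X2R2 j : tconv X2 R2 j = W j.
Proof.
apply: (eq_testA2 H (j := j)) => [||c w cB gc].
- apply: tspan_fsum => i; apply: (tspan_tmul (S := A2 `&` G i) (T := setT)
    (S' := A2 `&` G (j - i)) (T' := setT)) => //.
  + move=> x y [x1 gx] [y2 gy]; split; first exact: (A2_M H).
    apply: (GM H gx gy); ring.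
  + exact: tspan_sub (X2_span i).
  + apply: tspan_sub (dR2 H (j - i)) => // x [x2 gx]; split=> //; exact: (dA2'A H).
- exact: R2Delta_span2.
pose b := c * K w; pose m := - j.
have b1 : B1 b := B1_M H (dB1'B H cB) (dKB H w).
have gb : G m b := GMK H w gc.
have Bb := dB1B H b1.
have wb : lwB w b := lwB1 H w cB.
have WE := R2Delta_formula H ga Hla Bb gb wb.
have -> : ctl (p^~ b) (W j) = psi Delta p n m a b * K (- w).
  by rewrite -(PhiK_psi b1 gb) -WE -mulrA (KN H) mulr1 opprK.
have [h0 hD _] := linP (ctl_lin (pl b)).
rewrite -/b /tconv (fsum_morph h0 hD); last exact: X2R2_sup.
(* The term where the right legs of the coproducts of b and of a have
   degrees - i and k. Summing over k first gives the left side, summing over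
   i first gives contrR. *)
pose g i k := tlift (fun y1 y2 => tlift (fun x1 x2 =>
  x1 * cR1 (- i + k) (RB k (- i) x2 y2)) (Delta a (n - k) k) * cR2 (m + i) y1)
  (Delta b (m + i) (- i)).
have g_bil i k : bilinear_map (fun y1 y2 => tlift (fun x1 x2 =>
    x1 * cR1 (- i + k) (RB k (- i) x2 y2)) (Delta a (n - k) k) * cR2 (m + i) y1).
  apply: bil_mul' _ (cR2_lin H _); apply: tlift_linl => [z|x y]; first exact: g_bil2.
  exact: lin_comp (lin_mull _) (lin_comp (cR1_lin H _) (linRBb H _ _ _)).
have gE i k : g i k = tlift (fun x1 x2 => x1 * contrR Delta p R1 R2 k m i x2 b)
    (Delta a (n - k) k).
  rewrite /g; transitivity (tlift (fun y1 y2 => tlift (fun x1 x2 =>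
      x1 * cR1 (- i + k) (RB k (- i) x2 y2) * cR2 (m + i) y1) (Delta a (n - k) k))
      (Delta b (m + i) (- i))).
    apply: tlift_eq => x y; rewrite (linear_tlift (h := fun z => z * _)) //.
    exact: lin_mulr.
  rewrite tlift_exch; last 2 first.
  - by move=> x y; exact: bil_post (g_bil2 _ _ _) (lin_mulr _).
  - move=> x y; apply: bil_mul' _ (cR2_lin H _).
    exact: lin_comp (lin_mull _) (lin_comp (cR1_lin H _) (linRBb H _ _ _)).
  apply: tlift_eq => x y; rewrite /contrR.
  rewrite [RHS](linear_tlift (h := fun z => x * z)); last 2 first.
  - exact: lin_mull.
  - exact: (contrR_bil H).
  by apply: tlift_eq => x' y'; rewrite mulrA [- i + k]addrC.
have brk_bil i k : bilinear_map (fun x1 x2 => x1 * contrR Delta p R1 R2 k m i x2 b).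
  apply: bil_mul (@lin_id _ _) _; apply: tlift_linl => [z|x y]; first exact: (contrR_bil H).
  exact: lin_comp (lin_mulr _) (lin_comp (cR1_lin H _) (linRB H _ _ _)).
have [ca Ha] := DeltaA_sup H ga; have [cb Hb] := contrR_sup H Bb gb.
have tE i : ctl (p^~ b) (tmul (X2 i) (R2 (j - i))) = \sum_(k \in [set: int]) g i k.
  rewrite (ctl_tmul H (i := i) (k := j - i) Bb gb); last 2 first.
  - by apply: tspan_sub (X2_span i) => // x [x2 gx]; split=> //; exact: (dA2A H).
  - by apply: tspan_sub (dR2 H (j - i)) => // x [x2 gx]; split=> //; exact: (A2'A H).
  have [s [Hs sE]] := dDB1 H (- (j - i)) (- i) b1.
  have e : - (j - i) = m + i by rewrite /m; ring.
  rewrite /g -e sE tlift_list; last first.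
    by apply: bil_mul'; apply: (ctl_linphi (phi := fun x => p^~ x)).
  under [RHS]eq_fsum => k.
    rewrite tlift_list; last by rewrite e; exact: g_bil.
    over.
  rewrite fsum_big => [|q qs]; last first.
    exists (zwin ca i) => k; apply: contraR => nk.
    have [h1|h1] := ltP k ca; first by rewrite Ha ?tlift0 ?mul0r //; lia.
    have [h2|h2] := ltP 0 (- i + k); last by rewrite mem_zwin // in nk; lia.
    rewrite (tlift_eq0 (g_bil2 _ _ _) _ (dDA H _ _ Aa)) ?mul0r // => x y _ _.
    by rewrite (cR1_0 H) // mulr0.
  rewrite big_seq [RHS]big_seq; apply: eq_bigr => q qs.
  have [[Bq gq] [q1 gq']] := Hs q qs.
  rewrite (X2_ctl q1 gq') /Phi2 (DeltaR1_formula H Aa ga (dB1B H q1) gq').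
  have [k0 kD _] := linP (@lin_mulr F D (ctl (p^~ q.1) (R2 (j - i)))).
  rewrite (fsum_morph k0 kD).
    by apply: eq_fsum => k; rewrite /cR2 opprK.
  exists (zwin ca i) => k; apply: contraR => nk.
  have [h1|h1] := ltP k ca; first by rewrite Ha ?tlift0 //; lia.
  have [h2|h2] := ltP 0 (- i + k); last by rewrite mem_zwin // in nk; lia.
  rewrite (tlift_eq0 (g_bil2 _ _ _) _ (dDA H _ _ Aa)) // => x y _ _.
  by rewrite (cR1_0 H) // mulr0.
rewrite (eq_fsum tE) (fsum_exch (s := zwin (- m) cb) (t := zwin ca cb)) => [|i k]; last first.
  apply: contraR => ni; apply/eqP; rewrite gE.
  have [h1|h1] := ltP k ca; first by rewrite Ha ?tlift0 //; lia.
  apply: (tlift_eq0 (brk_bil i k) _ (dDA H _ _ Aa)) => x y _ _.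
  have [->|/Hb[/andP[h2 h3] h4]] := eqVneq (contrR Delta p R1 R2 k m i y b) 0.
    by rewrite mulr0.
  by move: ni; rewrite !mem_zwin //; lia.
rewrite (psi_RB H Aa ga Bb gb).
have [k0 kD _] := linP (@lin_mulr F D (K (- w))).
rewrite (fsum_morph k0 kD); last exact: psi_RB_sup.
apply: eq_fsum => k; under eq_fsum => i do rewrite gE.
have [s [Hs sE]] := dDA H (n - k) k Aa; rewrite sE.
under eq_fsum => i do rewrite tlift_list //.
rewrite fsum_big => [|q _]; last first.
  exists (zwin (- m) cb) => i; apply: contraR => ni.
  have [->|/Hb[/andP[h1 h2] _]] := eqVneq (contrR Delta p R1 R2 k m i q.2 b) 0.
    by rewrite mulr0.
  by rewrite mem_zwin in ni.
rewrite tlift_list; last exact: bil_mul (@lin_id _ _) (linRB H _ _ _).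
rewrite mulr_suml big_seq [RHS]big_seq; apply: eq_bigr => q /Hs[_ [Aq gq]].
have [l0 lD _] := linP (@lin_mull F D q.1).
rewrite -(fsum_morph l0 lD) ?(contrR_sum H Aq gq Bb gb wb) ?mulrA //.
by exists (zwin (- m) cb) => i /Hb[/andP[h1 h2] _]; exact: mem_zwin.
Qed.

End CaseA2.
(** * The intertwiner of an element of A1 *)

Section CaseA1.
Variables (F : fieldType) (D : algType F) (G : int -> set D).
Variables (Delta : D -> ctens D) (eps : D -> F).
Variables (r : nat) (K : 'rV[int]_r -> D) (p : D -> D -> F).
Variables (A A1 A2 A2' B B2 B1 B1' : set D) (R1 R2 : int -> tensor D D).
Hypothesis H : double_data G Delta eps K p A A1 A2 A2' B B2 B1 B1' R1 R2.

Local Notation LA := (LA Delta p).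
Local Notation LB := (LB Delta p).
Local Notation RB := (RB Delta p).
Local Notation cR1 := (cR1 p R1).
Local Notation cR2 := (cR2 p R2).
Local Notation cR2K := (cR2K G p A2 B1).
Local Notation contrL := (contrL Delta K p R1 R2).
Let pl := dpl H.
Let pr := dpr H.

Variables (n : int) (a : D).
Hypothesis a1 : A1 a.
Hypothesis ga : G n a.
Let Aa := dA1A H a1.

Variable la : int -> seq (wterm D r).
Hypothesis Hla : forall i, [/\ forall q, q \in la i -> wt_ok G K p A i (n - i) q,
  Delta a i (n - i) = \sum_(q <- la i) wt_tens q &
  Delta a i (n - i) = 0 -> la i = [::]].

Local Notation V := (DeltaR1 Delta R1 n a).
Local Notation W := (R2Delta K R2 la).
Local Notation PhiK := (PhiK G Delta p A2 B1 la).

Let la_n i : n < i -> la i = [::].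
Proof.
move=> ni; have [_ _ ->] := Hla i => //.
by apply: tspan_0r (dDA1 H i (n - i) a1) => x [x1 gx]; apply: (dA1n H) x1 gx; lia.
Qed.

(* The i-th term of PhiK as a function of the component t of the coproduct
   of b. *)
Let Om (i d : int) (t : tensor D D) :=
  \sum_(q <- la i) cR2K d (ctl (p q.1.1) t) * q.2.1.

Let Om_list i d s : (forall q, q \in s -> (B `&` G d) q.2) ->
  Om i d (\sum_(q <- s) tens q.1 q.2) =
  \sum_(q <- s) cR2K d q.2 * LA (- i) n q.1 a.
Proof.
move=> Hs; transitivity (\sum_(q <- la i) \sum_(q' <- s)
    (p q.1.1 q'.1 *: cR2K d q'.2) * q.2.1).
  apply: eq_bigr => q _; rewrite ctl_list // -mulr_suml; congr (_ * _).
  rewrite big_seq (cR2K_sum H) => [|q' /Hs[Bq gq]]; last first.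
    by split; apply: subspZ => //; [exact: (dB H)|exact: (dG H)].
  rewrite [RHS]big_seq; apply: eq_bigr => q' /Hs[Bq gq].
  have := cR2K_D H (p q.1.1 q'.1) Bq gq (dB H).1 (dG H d).1.
  by rewrite !addr0 (cR2K_zero H) addr0.
rewrite exchange_big; apply: eq_bigr => q' _.
rewrite /LA opprK; have [_ -> _] := Hla i.
rewrite (linear_bigsum _ _ _ (ctl_lin (pl _))) mulr_sumr; apply: eq_bigr => q _.
rewrite /ctl tlift_tens; last exact: ctl_bil.
by rewrite -scalerAl -scalerAr.
Qed.

Let Om_sum i d (I : eqType) (s : seq I) (t : I -> tensor D D) :
  (forall j, j \in s -> tspan setT (B `&` G d) (t j)) ->
  Om i d (\sum_(j <- s) t j) = \sum_(j <- s) Om i d (t j).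
Proof.
move=> Hs; rewrite /Om exchange_big; apply: eq_bigr => q _.
rewrite (linear_bigsum _ _ _ (ctl_lin (pr _))) -[RHS]mulr_suml; congr (_ * _).
rewrite big_seq [RHS]big_seq (cR2K_sum H) // => j js.
by have [] := ctl_subsp (pr q.1.1) (subspI (dB H) (dG H d)) (Hs j js).
Qed.

Let Om0 i d : Om i d 0 = 0.
Proof. by rewrite -(big_nil 0 +%R xpredT (fun j : int => 0)) Om_sum ?big_nil. Qed.

(** The mirror image of Phi2_mul: after expanding Delta(b c), the part that
    depends on c is psi(a'', c) for elements a'' of A1, and by psi_A1B1 it
    is a'' c. *)
Lemma PhiK_mul m k b c : B b -> G m b -> B1 c -> G k c ->
  PhiK (m + k) (b * c) = PhiK m b * c.
Proof.
move=> Bb gb c1 gc; have Bc := dB1B H c1.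
pose X i := Delta b (- i) (m + i); pose Y i := Delta c (- i) (k + i).
have -> : PhiK m b = \sum_(i \in [set: int]) Om i (m + i) (X i) by [].
have -> : PhiK (m + k) (b * c) =
  \sum_(i \in [set: int]) Om i (m + k + i) (Delta (b * c) (- i) (m + k + i)) by [].
(* The term of the double sum with left legs of degrees - i2 in the
   coproduct of b and - i1 in that of c. *)
pose f i2 i1 := Om (i1 + i2) (m + k + (i1 + i2)) (tmul (X i2) (Y i1)).
pose psit i1 i2 a' := tlift (fun y1 y2 => y2 * LA (- i1) (n - i2) y1 a') (Y i1).
have psit_bil i1 i2 a' : bilinear_map (fun y1 y2 => y2 * LA (- i1) (n - i2) y1 a').
  exact: bil_mul' (@lin_id _ _) (linLA H _ _ _).
have a'1 i2 y : A1 (LA (- i2) n y a) by exact: (LA_A1 H).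
have a'G i2 y : G (n - i2) (LA (- i2) n y a) by exact: (LA_G H _ _ _ Aa).
have fE i1 i2 s : (forall q, q \in s -> (B `&` G (- i2)) q.1 /\ (B `&` G (m + i2)) q.2) ->
    X i2 = \sum_(q <- s) tens q.1 q.2 ->
    f i2 i1 = \sum_(q <- s) cR2K (m + i2) q.2 * psit i1 i2 (LA (- i2) n q.1 a).
  move=> Hs sE; have [s' [Hs' sE']] := dDB1 H (- i1) (k + i1) c1.
  rewrite /f sE /Y sE' tmul_list.
  have -> : \sum_(q <- s) \sum_(q' <- s') tens (q.1 * q'.1) (q.2 * q'.2) =
    \sum_(z <- [seq (q.1 * q'.1, q.2 * q'.2) | q <- s, q' <- s']) tens z.1 z.2.
    by rewrite big_allpairs_dep.
  rewrite Om_list => [|_ /allpairsP[[q q'] /= [/Hs[_ [Bq gq]] /Hs'[_ [q1 gq']] ->]]]; last first.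
    by split=> /=; [apply: (B_M H) => //; exact: (dB1B H)|apply: (GM H gq gq'); ring].
  rewrite big_allpairs_dep big_seq [RHS]big_seq; apply: eq_bigr => q /Hs[[Bq gq] [Bq2 gq2]] /=.
  rewrite /psit /Y sE' tlift_list // mulr_sumr big_seq [RHS]big_seq.
  apply: eq_bigr => q' /Hs'[[Bq' gq'] [q1 gq1]].
  have -> : m + k + (i1 + i2) = m + i2 + (k + i1) by ring.
  rewrite (cR2K_mul H Bq2 gq2 q1 gq1) opprD [- i1 - i2]addrC.
  by rewrite (LA_mul H Bq gq Bq' gq' Aa ga) mulrA.
have psit0 i1 i2 a' : A1 a' -> G (n - i2) a' -> ~~ ((i2 <= n) && (- k <= i1 <= n - i2)) ->
    psit i1 i2 a' = 0.
  move=> a'A ga' ni; apply: (tlift_eq0 (psit_bil i1 i2 a') _ (dDB1 H _ _ c1)).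
  move=> y1 y2 _ [y2B gy2].
  have [h1|h1] := ltP (k + i1) 0; first by rewrite (dB1n H h1 y2B gy2) mul0r.
  have Aa' := dA1A H a'A.
  have [h2|h2] := ltP (n - i2) 0.
    rewrite (dA1n H h2 a'A ga'); have [-> _ _] := linP (linLAa H (- i1) (n - i2) y1).
    by rewrite mulr0.
  rewrite (_ : LA _ _ _ _ = 0) ?mulr0 //.
  by apply: (dA1n H) (LA_A1 H _ _ _ a'A) (LA_G H _ _ _ Aa'); lia.
have f0 i2 i1 : f i2 i1 != 0 -> (i2 \in zwin (- m) n) && (i1 \in zwin (- k) (n + m)).
  have [s [Hs sE]] := dDB H (- i2) (m + i2) Bb.
  rewrite (fE _ _ _ Hs sE); apply: contraR => ni; apply/eqP.
  apply: big1_seq => q /Hs[_ [Bq gq]].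
  have [h1|h1] := ltP (m + i2) 0; first by rewrite (cR2K_neg H) // mul0r.
  rewrite psit0 ?mulr0 //; apply: contra ni => /andP[h2 /andP[h3 h4]].
  by rewrite !mem_zwin //; lia.
transitivity (\sum_(i \in [set: int]) \sum_(i2 \in [set: int]) f i2 (i - i2)).
  apply: eq_fsum => i; rewrite (DeltaMl H _ gb gc).
  have [c2 Hc2] := DeltaA_sup H gb; have [c' Hc'] := DeltaA_sup H gc.
  rewrite (fsum_undup (s := zwin (c2 - m) (i - c' + k))) => [|j]; last first.
    apply: contraR => nj.
    have [h1|h1] := ltP (m + j) c2; first by rewrite Hc2 ?tmul0t //; lia.
    have [h2|h2] := ltP (k + (i - j)) c'; first by rewrite Hc' ?tmult0 //; lia.
    by rewrite mem_zwin // in nj; lia.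
  rewrite Om_sum => [|j _]; last first.
    apply: (tspan_tmul (S := setT) (S' := setT)
      (T := B `&` G (m + j)) (T' := B `&` G (k + (i - j)))) => //.
    - move=> x y [Bx gx] [By gy]; split; first exact: (B_M H).
      apply: (GM H gx gy); ring.
    - exact: tspan_sub (dDB H _ _ Bb).
    - exact: tspan_sub (dDB H _ _ Bc).
  rewrite [RHS](fsum_undup (s := zwin (c2 - m) (i - c' + k))) => [|j]; last first.
    apply: contraR => nj; rewrite /f /X /Y.
    have [h1|h1] := ltP (m + j) c2; first by rewrite Hc2 ?tmul0t ?Om0 //; lia.
    have [h2|h2] := ltP (k + (i - j)) c'; first by rewrite Hc' ?tmult0 ?Om0 //; lia.
    by rewrite mem_zwin // in nj; lia.
  by apply: eq_bigr => j _; rewrite /f subrK.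
rewrite (fsum_conv f0).
have [h0 hD _] := linP (@lin_mulr F D c).
rewrite (fsum_morph h0 hD); last first.
  exists (zwin (- m) n) => i; apply: contraR => ni.
  have [h1|h1] := ltP n i; first by rewrite /Om la_n // big_nil.
  have [h2|h2] := ltP (m + i) 0; last by rewrite mem_zwin // in ni; lia.
  rewrite /Om big1 // => q _; rewrite (cR2K_neg H h2) ?mul0r //.
    exact: (LB_B H _ _ _ Bb).
  exact: (LB_G H _ _ _ Bb).
apply: eq_fsum => i2.
have [s [Hs sE]] := dDB H (- i2) (m + i2) Bb.
under eq_fsum => i1 do rewrite (fE _ _ _ Hs sE).
have psit_sup q : fsup (fun i1 => psit i1 i2 (LA (- i2) n q a)).
  exists (zwin (- k) (n - i2)) => i1; apply: contraR => ni.
  rewrite psit0 //; apply: contra ni => /andP[_ /andP[h1 h2]].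
  by rewrite mem_zwin.
rewrite fsum_big => [|q _]; last first.
  have [t Ht] := psit_sup q.1; exists t => i1; apply: contraR => /(contra (Ht i1)).
  by rewrite negbK => /eqP ->; rewrite mulr0.
rewrite /X sE Om_list => [|q /Hs[]] //.
rewrite mulr_suml; apply: eq_bigr => q _.
have [k0 kD _] := linP (@lin_mull F D (cR2K (m + i2) q.2)).
rewrite -(fsum_morph k0 kD); last exact: psit_sup.
rewrite -mulrA; congr (_ * _).
by rewrite -(psi_A1B1 H (a'1 i2 q.1) (a'G i2 q.1) c1 gc) (psi_LA H).
Qed.

(** The contraction Phi of R2' R0 Delta(a) R0^-1 with b. The solution X of
    the equation X R2' = R2' R0 Delta(a) R0^-1 is X = (id (x) Phi)(R1), read
    off from the restriction of Phi to B2. *)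
Definition Phi1 (m : int) b := ctl (p^~ b) (W (- m)).
Definition X1 (i : int) := tlift (fun x z => tens x (Phi1 (- i) z)) (R1 i).

Lemma Phi1_lin m : linear (Phi1 m).
Proof. by apply: (ctl_linphi (phi := fun x => p^~ x)). Qed.

Lemma Phi1_PhiK m b : B2 b -> G m b -> Phi1 m b = PhiK m b.
Proof.
move=> b2 gb; rewrite -(R2Delta_formula H ga Hla (dB2B H b2) gb (lwB2 H b2)).
by rewrite (dK0 H) mulr1.
Qed.

Lemma Phi1_G m b : B2 b -> G m b -> G (n + m) (Phi1 m b).
Proof.
move=> b2 gb; rewrite (Phi1_PhiK b2 gb); apply: subsp_fsum (dG H _) _ => i.
have Bb := dB2B H b2.
apply: subsp_sum (dG H _) _ => q qi; have [_ _ [_ gy] _] := la_ok Hla qi.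
have [_ gq _] := cR2K_spec H (LB_B H i m q.1.1 Bb) (LB_G H i m q.1.1 Bb).
apply: (GM H gq gy); ring.
Qed.

Lemma Phi1_0 m b : B2 b -> G m b -> n < - m -> Phi1 m b = 0.
Proof.
move=> b2 gb nm; rewrite (Phi1_PhiK b2 gb); apply: fsum0 => i.
have Bb := dB2B H b2.
have [h1|h1] := ltP n i; first by rewrite la_n // big_nil.
rewrite big1 // => q _; rewrite (cR2K_neg H) ?mul0r //; first lia.
- exact: (LB_B H).
- exact: (LB_G H).
Qed.

Lemma X1_bil i : bilinear_map (fun x z : D => tens x (Phi1 (- i) z)).
Proof.
by apply: (bil_comp (g := fun x : D => x) (h := Phi1 (- i)) (tens_bilinear D D));
  last exact: Phi1_lin.
Qed.

Lemma X1_span i : tspan (A1 `&` G i) (G (n - i)) (X1 i).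
Proof.
have [s [Hs sE]] := dR1 H i; rewrite /X1 sE tlift_list; last exact: X1_bil.
apply: tspan_sum => q /Hs[[q2 gq] [q1 gq']]; apply: tspan_tens => //.
exact: Phi1_G q1 gq'.
Qed.

(** X has finitely many components: A1 has no negative degrees, and Phi
    kills the elements of B2 of degree less than - n. *)
Lemma X1_sup i : X1 i != 0 -> 0 <= i <= n.
Proof.
apply: contraR => ni; have [i0|i0] := ltP i 0.
  by rewrite /X1 (R1_neg H i0) tlift0 //; exact: X1_bil.
apply/eqP/(tlift_eq0 (X1_bil i) _ (dR1 H i)) => x z _ [z1 gz].
rewrite (Phi1_0 z1 gz) ?tens0r //; lia.
Qed.

Lemma X1_ctl i b : B2 b -> G (- i) b -> ctl (p^~ b) (X1 i) = Phi1 (- i) b.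
Proof.
move=> b2 gb; rewrite -[in RHS](dR1l H b2 gb) /X1.
rewrite [RHS](linear_tlift _ (Phi1_lin _) (ctl_bil (pl b))).
rewrite (linear_tlift _ (ctl_lin (pl _)) (X1_bil i)).
apply: tlift_eq => x z; rewrite /ctl tlift_tens; last exact: ctl_bil.
by have [_ _ ->] := linP (Phi1_lin (- i)).
Qed.

Lemma X1R2_sup j : fsup (fun i => tmul (X1 i) (R2 (j - i))).
Proof.
exists (zwin 0 n) => i; apply: contraR => ni.
have [->|/X1_sup h] := eqVneq (X1 i) 0; first by rewrite tmul0t.
by rewrite mem_zwin // in ni; lia.
Qed.

Lemma R1X1_sup j : fsup (fun i => tmul (R1 i) (X1 (j - i))).
Proof.
exists (zwin 0 j) => i; apply: contraR => ni.
have [i0|i0] := ltP i 0; first by rewrite (R1_neg H i0) tmul0t.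
have [->|/X1_sup h] := eqVneq (X1 (j - i)) 0; first by rewrite tmult0.
by rewrite mem_zwin // in ni; lia.
Qed.

Lemma R2Delta_span j : tspan (A `&` G j) setT (W j).
Proof.
apply: tspan_fsum => i; apply: (tspan_tmul (S := A `&` G i) (T := setT)
  (S' := A `&` G (j - i)) (T' := setT)) => //.
- move=> x y [Ax gx] [Ay gy]; split; first exact: (A_M H).
  apply: (GM H gx gy); ring.
- apply: tspan_sub (dR2 H i) => // x [x2 gx]; split=> //; exact: (A2'A H).
- by apply: tspan_sub (conjDelta_A H Hla (j - i)).
Qed.

(** Against b2 c K_w, with b2 in B2 and c in B1', both sides are Phi(b2) c,
    the right one by PhiK_mul. *)
Lemma X1R2 j : tconv X1 R2 j = W j.
Proof.
apply: (eq_testA H (j := j)) => [||i b2 c w b2B gb2 cB gc].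
- apply: tspan_fsum => i; apply: (tspan_tmul (S := A1 `&` G i) (T := setT)
    (S' := A2' `&` G (j - i)) (T' := setT)) => //.
  + move=> x y [x1 gx] [y2 gy]; split.
      by apply: (A_M H); [exact: (dA1A H)|exact: (A2'A H)].
    apply: (GM H gx gy); ring.
  + exact: tspan_sub (X1_span i).
  + exact: tspan_sub (dR2 H (j - i)).
- exact: R2Delta_span.
have cK : B1 (c * K w) := B1_M H (dB1'B H cB) (dKB H w).
have gcK := GMK H w gc.
have Bb2 := dB2B H b2B.
have e1 : - j = i + (- j - i) by ring.
have WE := R2Delta_formula H ga Hla
  (B_M H (B_M H Bb2 (B1'B H cB)) (KB H w))
  (GMK H w (dGM H gb2 gc)) (lwB_prod H w b2B cB).
have -> : ctl (p^~ (b2 * c * K w)) (W j) = Phi1 i b2 * c.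
  rewrite -[LHS]mulr1 -(KN H w) mulrA.
  rewrite (_ : j = - (i + (- j - i))) ?WE; last by ring.
  rewrite (Phi1_PhiK b2B gb2) -[b2 * c * _]mulrA.
  by rewrite (PhiK_mul Bb2 gb2 cK) // -!mulrA (KN H) mulr1.
have [h0 hD _] := linP (ctl_lin (pl (b2 * c * K w))).
rewrite /tconv (fsum_morph h0 hD); last exact: X1R2_sup.
have tE k : ctl (p^~ (b2 * c * K w)) (tmul (X1 k) (R2 (j - k))) =
    ctl (p^~ b2) (X1 k) * ctl (p^~ (c * K w)) (R2 (j - k)).
  rewrite -mulrA; apply: (ctl_tmul_fac H) => //.
    by apply: tspan_sub (X1_span k) => // x [].
  by apply: tspan_sub (dR2 H (j - k)) => // x [/(dA2'A H)].
rewrite (eq_fsum tE) (fsum_single (i0 := - i)) => [|k ki]; last first.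
  rewrite (_ : ctl (p^~ b2) (X1 k) = 0) ?mul0r //.
  apply: (tlift_eq0 (ctl_bil (pl b2)) _ (X1_span k)) => x y [x1 gx] _.
  by rewrite (pdeg H (dA1A H x1) gx Bb2 gb2) ?scale0r //; lia.
rewrite X1_ctl ?opprK //; congr (_ * _).
have e2 : - j - i = - (j + i) by ring.
rewrite e2 in gc; rewrite -[RHS](dR2l H cB gc).
apply: (ctl_ext (pl _) (pl _) _ (dR2 H (j + i))) => x [x2 gx].
by rewrite -[x]mulr1 -(dK0 H) (dpfac2 H) // (chi0l H) mulr1 (dK0 H) mulr1.
Qed.

(** It is enough to contract with B2. The right side gives psi(a, b) because
    R1 acts as the identity on B2. On the left side Phi is written out; then
    R1 R2' (x (x) K_(-v)) appears for the left legs x of Delta(a), of weight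
    v, and its contraction with b is that of x acting on b. *)
Lemma R1X1 j : tconv R1 X1 j = V j.
Proof.
apply: (eq_testA1 H (j := j)) => [||b b2 gb].
- apply: tspan_fsum => i; apply: (tspan_tmul (S := A1 `&` G i) (T := setT)
    (S' := A1 `&` G (j - i)) (T' := setT)) => //.
  + move=> x y [x1 gx] [y2 gy]; split; first exact: (A1_M H).
    apply: (GM H gx gy); ring.
  + exact: tspan_sub (dR1 H i).
  + exact: tspan_sub (X1_span (j - i)).
- apply: tspan_fsum => i; apply: (tspan_tmul (S := A1 `&` G i) (T := setT)
    (S' := A1 `&` G (j - i)) (T' := setT)) => //.
  + move=> x y [Ax gx] [Ay gy]; split; first exact: (A1_M H).
    apply: (GM H gx gy); ring.
  + by apply: tspan_tflip; apply: tspan_sub (dDA1 H (n - i) i a1).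
  + exact: tspan_sub (dR1 H (j - i)).
pose m := - j.
have Bb := dB2B H b2.
have -> : ctl (p^~ b) (V j) = psi Delta p n m a b.
  have := DeltaR1_formula H Aa ga Bb gb; rewrite opprK => ->.
  rewrite (psi_RB H Aa ga Bb gb); apply: eq_fsum => i.
  have bil : bilinear_map (fun x1 x2 => x1 * RB i m x2 b).
    exact: bil_mul (@lin_id _ _) (linRB H _ _ _).
  apply: (tlift_eq_on _ bil _ (dDA H _ _ Aa)) => [|x y _ _].
    exact: bil_mul (@lin_id _ _) (lin_comp (cR1_lin H _) (linRB H _ _ _)).
  rewrite (cR1_id H) //; first exact: (RB_B2 H).
  exact: (RB_G H _ _ _ Bb).
have [h0 hD _] := linP (ctl_lin (pl b)).
rewrite /tconv (fsum_morph h0 hD); last exact: R1X1_sup.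
(* The term where the right leg of the coproduct of b has degree - i and the
   left leg of Delta(a) has degree k. *)
pose g i k := \sum_(q <- la k) contrL k m i q.1.1 q.1.2 b * q.2.1.
have [cl Hl] := la_sup H ga Hla; have [cb Hb] := contrL_sup H Bb gb.
have tE i : ctl (p^~ b) (tmul (R1 i) (X1 (j - i))) = \sum_(k \in [set: int]) g i k.
  rewrite (ctl_tmul H (i := i) (k := j - i) Bb gb); last 2 first.
  - by apply: tspan_sub (dR1 H i) => // x [x2 gx]; split=> //; exact: (dA1A H).
  - by apply: tspan_sub (X1_span (j - i)) => // x [x2 gx]; split=> //; exact: (dA1A H).
  have [s [Hs sE]] := dDB2 H (- (j - i)) (- i) b2.
  have e : - (j - i) = m + i by rewrite /m; ring.
  rewrite sE tlift_list; last first.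
    by apply: bil_mul'; apply: (ctl_linphi (phi := fun x => p^~ x)).
  transitivity (\sum_(k \in [set: int]) \sum_(qb <- s) \sum_(q <- la k)
      cR1 (- i) qb.2 * (cR2 (m + i + k) (LB k (m + i) q.1.1 qb.1) * K (- q.1.2)) * q.2.1).
    rewrite fsum_big => [|qb qs]; last first.
      exists (zwin (- m - i) cl) => k; apply: contraR => nk.
      have [h1|h1] := ltP cl k; first by rewrite Hl // big_nil.
      have [h2|h2] := ltP (m + i + k) 0; last by rewrite mem_zwin // in nk; lia.
      by rewrite big1 // => q _; rewrite (cR2_0 H _ h2) mul0r mulr0 mul0r.
    rewrite big_seq [RHS]big_seq; apply: eq_bigr => qb /Hs[[q2 gq2] [Bq gq]].
    rewrite X1_ctl // Phi1_PhiK // e.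
    have [k0 kD _] := linP (@lin_mull F D (ctl (p^~ qb.2) (R1 i))).
    have Bq1 := dB2B H q2.
    rewrite e in gq2.
    rewrite (fsum_morph k0 kD); last first.
      exists (zwin (- m - i) cl) => k; apply: contraR => nk.
      have [h1|h1] := ltP cl k; first by rewrite Hl // big_nil.
      have [h2|h2] := ltP (m + i + k) 0; last by rewrite mem_zwin // in nk; lia.
      rewrite big1 // => q _; rewrite (cR2K_neg H h2) ?mul0r //.
        exact: (LB_B H).
      exact: (LB_G H).
    apply: eq_fsum => k; rewrite mulr_sumr big_seq [RHS]big_seq.
    apply: eq_bigr => q /(la_ok Hla)[[Ax gx] vx _ _].
    have lwL := lwB_LB H Ax gx vx Bq1 gq2 (lwB2 H q2).
    rewrite (cR2K_lw H (LB_B H _ _ _ Bq1) (LB_G H _ _ _ Bq1) lwL) sub0r.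
    by rewrite /cR1 opprK mulrA.
  apply: eq_fsum => k; rewrite exchange_big; apply: eq_bigr => q _.
  rewrite /contrL -e sE tlift_list; last by rewrite e; exact: (contrL_bil H).
  by rewrite mulr_suml.
rewrite (eq_fsum tE) (fsum_exch (s := zwin 0 cb) (t := zwin (- m - cb) cl)) => [|i k]; last first.
  apply: contraR => ni; apply/eqP; rewrite /g.
  have [h1|h1] := ltP cl k; first by rewrite Hl // big_nil.
  apply: big1 => q _.
  have [->|/Hb[/andP[h2 h3] h4]] := eqVneq (contrL k m i q.1.1 q.1.2 b) 0.
    by rewrite mul0r.
  by move: ni; rewrite !mem_zwin //; lia.
apply: eq_fsum => k; have [_ -> _] := Hla k.
rewrite tlift_sum; last exact: bil_mul (linLB H _ _ _) (@lin_id _ _).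
rewrite fsum_big => [|q _]; last first.
  exists (zwin 0 cb) => i; apply: contraR => ni.
  have [->|/Hb[/andP[h2 h3] h4]] := eqVneq (contrL k m i q.1.1 q.1.2 b) 0.
    by rewrite mul0r.
  by rewrite mem_zwin in ni.
rewrite big_seq [RHS]big_seq; apply: eq_bigr => q /(la_ok Hla)[[Ax gx] vx _ _].
rewrite /wt_tens tlift_tens; last exact: bil_mul (linLB H _ _ _) (@lin_id _ _).
have [k0 kD _] := linP (@lin_mulr F D q.2.1).
rewrite -(fsum_morph k0 kD) ?(contrL_sum H Ax gx vx Bb gb (lwB2 H b2)) //.
by exists (zwin 0 cb) => i /Hb[/andP[h2 h3] _]; exact: mem_zwin.
Qed.

End CaseA1.
(** * Symmetry between the two halves *)

Section Swap.
Variables (F : fieldType) (D : algType F).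

Lemma ctl_tflip (phi : D -> F) t : linear (phi : D -> F^o) ->
  ctl phi (tflip t) = ctr phi t.
Proof. by move=> pl; rewrite /ctl tlift_tflip //; exact: ctl_bil. Qed.

Lemma ctr_tflip (phi : D -> F) t : linear (phi : D -> F^o) ->
  ctr phi (tflip t) = ctl phi t.
Proof. by move=> pl; rewrite /ctr tlift_tflip //; exact: ctr_bil. Qed.

Variables (G : int -> set D) (Delta : D -> ctens D) (eps : D -> F).
Variables (r : nat) (K : 'rV[int]_r -> D) (p : D -> D -> F).
Variables (A A1 A2 A2' B B2 B1 B1' : set D) (R1 R2 : int -> tensor D D).
Hypothesis H : double_data G Delta eps K p A A1 A2 A2' B B2 B1 B1' R1 R2.

Definition swG (n : int) : set D := G (- n).
Definition swD (x : D) : ctens D := fun i j => tflip (Delta x (- j) (- i)).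
Definition swp (a b : D) : F := p b a.
Definition swR (R : int -> tensor D D) (i : int) : tensor D D := tflip (R i).

Lemma tflip_fsum (M : choiceType) (f : M -> tensor D D) :
  tflip (\sum_(i \in [set: M]) f i) = \sum_(i \in [set: M]) tflip (f i).
Proof.
have [h0 hD _] := linP (@tflip_lin F D).
case: (pselect (fsup f)) => [|nf]; first exact: fsum_morph.
rewrite !fsum_dflt ?tflip0 // => -[s fs]; apply: nf; exists s => i fi.
by apply: fs; rewrite tflip_eq0.
Qed.

Lemma tflip2_lift (U : lmodType F) (f : D -> D -> D -> D -> U) (t t' : tensor D D) :
  (forall x y, bilinear_map (f x y)) ->
  (forall x' y', bilinear_map (fun x y => f x y x' y')) ->
  tlift (fun x1 x2 => tlift (f x1 x2) (tflip t')) (tflip t) =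
  tlift (fun y2 y1 => tlift (fun x2 x1 => f x1 x2 y1 y2) t) t'.
Proof.
move=> f1 f2; rewrite tlift_tflip; last by apply: bil_tlift2.
rewrite -(tlift_exch (f := fun x2 x1 y2 y1 => f x1 x2 y1 y2)); last 2 first.
- by move=> x y; exact: bil_swap.
- by move=> x y; exact: bil_swap.
by apply: tlift_eq => x y; rewrite tlift_tflip.
Qed.

(** Exchanging A with B, so that A1 and B2 as well as A2 and B1 are
    exchanged, flipping all tensors and reversing all degrees preserves the
    whole situation. *)
Lemma double_swap : double_data swG swD eps K swp B B2 B1 B1' A A1 A2 A2'
  (swR R1) (swR R2).
Proof.
have sub_tflip (S T S' T' : set D) t : tspan T S t -> S `<=` S' -> T `<=` T' ->
    tspan S' T' (tflip t).
  by move=> tS SS TT; apply: tspan_tflip; exact: tspan_sub tS.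
split; try by case: H.
- by move=> n; exact: (dG H).
- by move=> m n x y gx gy; rewrite /swG opprD; exact: (dGM H).
- by move=> n x n0; apply: (dB2n H); rewrite oppr_gt0.
- by move=> n x n0; apply: (dB1n H); rewrite oppr_lt0.
- by move=> n x n0; apply: (dA2n H); rewrite oppr_gt0.
- by move=> n x n0; apply: (dA1n H); rewrite oppr_lt0.
- move=> n P PP HP; apply: (dB_ind H) => // i b2 b1 u b2B gb2 b1B gb1.
  by apply: (HP (- i)) => //; rewrite /swG ?opprK // opprD.
- move=> n P PP HP; apply: (dA_ind H) => // i b2 b1 u b2B gb2 b1B gb1.
  by apply: (HP (- i)) => //; rewrite /swG ?opprK // opprD.
- by move=> n P PP HP; exact: (dB1_ind H).
- by move=> n P PP HP; exact: (dA2_ind H).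
- by move=> i j c x y; rewrite /swD (dDl H) tflip_lin.
- move=> n x /(dDdeg H)[c Hc]; exists (n + c) => i j.
  by rewrite /swD tflip_eq0 => /Hc[e h]; split; lia.
- by move=> x i j /(dDB H (- j) (- i)) h; exact: sub_tflip h _ _.
- by move=> x i j /(dDB2 H (- j) (- i)) h; exact: sub_tflip h _ _.
- by move=> x i j /(dDB1 H (- j) (- i)) h; exact: sub_tflip h _ _.
- by move=> x i j /(dDA H (- j) (- i)) h; exact: sub_tflip h _ _.
- by move=> x i j /(dDA2 H (- j) (- i)) h; exact: sub_tflip h _ _.
- by move=> x i j /(dDA1 H (- j) (- i)) h; exact: sub_tflip h _ _.
- move=> m n x y gx gy k; rewrite /swD.
  have := dDM H gx gy (- (m + n - k)).
  rewrite (_ : - m - n - - (m + n - k) = - k); last by ring.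
  move=> ->; rewrite tflip_fsum.
  rewrite (fsum_shift _ m); apply: eq_fsum => i; rewrite tflip_tmul.
  by congr (tmul (tflip (Delta x _ _)) (tflip (Delta y _ _))); ring.
- move=> u; apply/funext => i; apply/funext => j; rewrite /swD (dDK H) /chom.
  by rewrite !oppr_eq0 andbC; case: ifP => _; rewrite ?tflip_tens ?tflip0.
- move=> n x gx; rewrite /swD oppr0 ctl_tflip; last exact: (depsl H).
  exact: (dcounitr H).
- move=> n x gx; rewrite /swD oppr0 ctr_tflip; last exact: (depsl H).
  exact: (dcounitl H).
- by move=> n x gx n0; apply: (depsdeg H gx); rewrite oppr_eq0.
- by move=> n a Ba ga a0; apply: (dpB H Ba ga) => b Ab gb; exact: a0.
- by move=> n a Ba ga a0; apply: (dpA H Ba ga) => b Ab gb; exact: a0.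
- move=> m n a b Ba ga Ab gb mn; apply: (dpdeg H Ab gb Ba ga); lia.
- move=> i j m a a' b Ba ga Ba' ga' Ab gb; rewrite /swp /swD.
  rewrite (dpmulr H Ba ga Ba' ga' Ab gb) tlift_tflip; last first.
    exact: (bil_mulF (phi := p^~ a') (psi := p^~ a) (dpl H _) (dpl H _)).
  by apply: (tlift_eq (U := F^o)) => x y; rewrite mulrC.
- move=> i j m a a' b Ba ga Ba' ga' Ab gb; rewrite /swp /swD.
  rewrite (dpmull H Ba ga Ba' ga' Ab gb) tlift_tflip; last first.
    exact: (bil_mulF (phi := p a) (psi := p a') (dpr H _) (dpr H _)).
  by apply: (tlift_eq (U := F^o)) => x y; rewrite mulrC.
- move=> n m a b Ba ga Ab gb; have := dexch H Ab gb Ba ga.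
  have E1 i : tlift (fun x1 x2 => tlift (fun y1 y2 => swp x1 y1 *: (y2 * x2))
      (swD b (- i) (m + i))) (swD a i (n - i)) =
    tlift (fun x1 x2 => tlift (fun y1 y2 => p x2 y2 *: (x1 * y1))
      (Delta a (- n + i) (- i))) (Delta b (- m - i) i).
    rewrite /swD /swp tflip2_lift; last 2 first.
    - by move=> x y; exact: bil_scl (dpl H _) (lin_mulr _).
    - by move=> x y; exact: bil_scl (dpr H _) (lin_mull _).
    have e1 : - (n - i) = - n + i by ring.
    have e2 : - (m + i) = - m - i by ring.
    by rewrite e1 e2 opprK.
  have E2 i : tlift (fun x1 x2 => tlift (fun y1 y2 => swp x2 y2 *: (x1 * y1))
      (swD b (m + i) (- i))) (swD a (n - i) i) =
    tlift (fun x1 x2 => tlift (fun y1 y2 => p x1 y1 *: (y2 * x2))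
      (Delta a (- i) (- n + i))) (Delta b i (- m - i)).
    rewrite /swD /swp tflip2_lift; last 2 first.
    - by move=> x y; exact: bil_scr (dpl H _) (lin_mull _).
    - by move=> x y; exact: bil_scr (dpr H _) (lin_mulr _).
    have e1 : - (n - i) = - n + i by ring.
    have e2 : - (m + i) = - m - i by ring.
    by rewrite e1 e2 opprK.
  by move=> e; rewrite (eq_fsum E1) (eq_fsum E2) e.
- by move=> a1 a2 b2 b1 ? ? ? ?; rewrite /swp (dpfac H).
- by move=> a b u v ? ?; rewrite /swp (dpfac2 H).
- by move=> i; apply: sub_tflip (dR1 H i) _ _ => // x; rewrite /swG opprK.
- by move=> i z z1; rewrite /swG opprK => gz; rewrite /swR ctl_tflip ?(dR1r H) //; exact: (dpr H).
- by move=> i x x1 gx; rewrite /swR ctr_tflip ?(dR1l H) //; exact: (dpl H).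
- by move=> i; apply: sub_tflip (dR2 H i) _ _ => // x; rewrite /swG opprK.
- by move=> i z z1; rewrite /swG opprK => gz; rewrite /swR ctl_tflip ?(dR2r H) //; exact: (dpr H).
- by move=> i x x1 gx; rewrite /swR ctr_tflip ?(dR2l H) //; exact: (dpl H).
Qed.

End Swap.
(** * Intertwiners of homogeneous generators *)

Section HalfTheorem.
Variables (F : fieldType) (D : algType F).

(** t' is the conjugate of t by R0, as witnessed by an expansion of t into
    pairs of weight vectors. *)
Definition wconj (G : int -> set D) (r : nat) (K : 'rV[int]_r -> D)
    (p : D -> D -> F) (i j : int) (t t' : tensor D D) : Prop :=
  exists s : seq (wterm D r), [/\
    forall q, q \in s -> [/\ G i q.1.1, wtI K p q.1.2 q.1.1, G j q.2.1
      & wtII K p q.2.2 q.2.1],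
    t = \sum_(q <- s) wt_tens q, t' = \sum_(q <- s) wt_conj K q & t = 0 -> t' = 0].

(** A finite homogeneous X with R1 X = Delta(a)^(2,1) R1 and X R2' = R2' R0
    Delta(a) R0^-1. *)
Definition intertwiner (G : int -> set D) (Delta : D -> ctens D) (r : nat)
    (K : 'rV[int]_r -> D) (p : D -> D -> F) (R1 R2 : int -> tensor D D)
    (n : int) (a : D) : Prop :=
  exists X tw : int -> tensor D D, [/\
    forall i, tspan (G i) (G (n - i)) (X i),
    exists s : seq int, forall i, X i != 0 -> i \in s,
    forall i, wconj G K p i (n - i) (Delta a i (n - i)) (tw i),
    forall j, tconv R1 X j = tconv (flipDelta Delta n a) R1 j &
    forall j, tconv X R2 j = tconv R2 tw j].

Variables (G : int -> set D) (Delta : D -> ctens D) (eps : D -> F).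
Variables (r : nat) (K : 'rV[int]_r -> D) (p : D -> D -> F).
Variables (A A1 A2 A2' B B2 B1 B1' : set D) (R1 R2 : int -> tensor D D).
Hypothesis H : double_data G Delta eps K p A A1 A2 A2' B B2 B1 B1' R1 R2.

Lemma wconj_Delta n a la i :
  [/\ forall q, q \in la i -> wt_ok G K p A i (n - i) q,
     Delta a i (n - i) = \sum_(q <- la i) wt_tens q &
     Delta a i (n - i) = 0 -> la i = [::]] ->
  wconj G K p i (n - i) (Delta a i (n - i)) (conjDelta K la i).
Proof.
move=> [h1 h2 h3]; exists (la i); split=> // [q /h1[[? ?] ? [? ?] ?] //|/h3 la0].
by rewrite /conjDelta la0 big_nil.
Qed.

Lemma intertwiner_A1 n a : A1 a -> G n a -> intertwiner G Delta K p R1 R2 n a.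
Proof.
move=> a1 ga; have Aa := dA1A H a1.
have [la [Hla _]] := Delta_wt_expansion H (A_spanned H) (dA H) (fun x h => h)
  (fun i => dDA H i (n - i) Aa).
exists (X1 K p R1 R2 la), (conjDelta K la); split.
- move=> i; apply: tspan_sub (X1_span H ga Hla i) => // x [_ gx].
- by exists (zwin 0 n) => i /(X1_sup H a1 ga Hla)/andP[? ?]; exact: mem_zwin.
- by move=> i; exact: wconj_Delta.
- by move=> j; exact: (R1X1 H a1 ga Hla).
- by move=> j; exact: (X1R2 H a1 ga Hla).
Qed.

Lemma intertwiner_A2 n a u : A2 a -> G n a -> rwA G K p B u a ->
  intertwiner G Delta K p R1 R2 n a.
Proof.
move=> a2 ga ua.
have [la [Hla la2]] := Delta_wt_expansion H (A2_spanned H) (dA2 H) (dA2A H)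
  (fun i => dDA2 H i (n - i) a2).
exists (X2 Delta K p R1 R2 n a u), (conjDelta K la); split.
- move=> i; apply: tspan_sub (X2_span H u a2 ga i) => // x [_ gx].
- by exists (zwin n 0) => i /(X2_sup H a2 ga)/andP[? ?]; exact: mem_zwin.
- by move=> i; exact: wconj_Delta.
- by move=> j; exact: (R1X2 H a2 ga ua).
- by move=> j; exact: (X2R2 H a2 ga ua Hla la2).
Qed.

Lemma wconj_swap i j t t' : wconj (swG G) K (swp p) (- j) (- i) (tflip t) t' ->
  wconj G K p i j t (tflip t').
Proof.
move=> [s [Hs tE tE' t0]].
exists [seq (q.2, q.1) | q <- s]; split.
- move=> _ /mapP[q /Hs[gx wx gy wy] ->] /=; split=> //.
  by move: gy; rewrite /swG opprK.
  by move: gx; rewrite /swG opprK.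
- rewrite -[t]tflipK tE (linear_bigsum _ _ _ (@tflip_lin F D)) big_map.
  by apply: eq_bigr => q _; rewrite tflip_tens.
- rewrite tE' (linear_bigsum _ _ _ (@tflip_lin F D)) big_map big_seq [RHS]big_seq.
  apply: eq_bigr => -[[x v] [y u]] /Hs[/= gx wx gy wy].
  rewrite /wt_conj tflip_tens /=.
  have [_ _ Zl] := linP (fun c a b => bil_l (tens_bilinear D D) c a b (K (- u) * x)).
  have [_ _ Zr] := linP (fun c a b => bil_r (tens_bilinear D D) c a b (K (- v) * y)).
  by rewrite (wy (- v)) (wx (- u)) Zl Zr /swp -(chiNN H).
- by move=> te; rewrite t0 ?te tflip0.
Qed.

(** The flip carries the two equations for the swapped data into the
    original ones; each keeps its place since R1 and R2' are also flipped. *)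
Lemma intertwiner_swap n a :
  intertwiner (swG G) (swD Delta) K (swp p) (swR R1) (swR R2) (- n) a ->
  intertwiner G Delta K p R1 R2 n a.
Proof.
move=> [X [tw [Xs [s Hs] Xw X1 X2]]].
exists (fun j => tflip (X (j - n))), (fun j => tflip (tw (j - n))); split.
- move=> i; apply: tspan_tflip; apply: tspan_sub (Xs (i - n)) => x.
    by rewrite /swG opprB.
  by rewrite /swG (_ : - (- n - (i - n)) = i) //; ring.
- exists [seq i + n | i <- s] => i; rewrite tflip_eq0 => /Hs h.
  by apply/mapP; exists (i - n); rewrite ?subrK.
- move=> i; apply: wconj_swap; have := Xw (i - n).
  rewrite /swD (_ : - (i - n) = n - i); last by ring.
  rewrite (_ : - n + (n - i) = - i); last by ring.
  by rewrite opprK (_ : i - n = - (n - i)) //; ring.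
- move=> j; transitivity (tflip (tconv (swR R1) X (j - n))).
    rewrite /tconv tflip_fsum; apply: eq_fsum => k.
    by rewrite tflip_tmul tflipK addrAC.
  rewrite X1 /tconv tflip_fsum (fsum_shift _ n); apply: eq_fsum => k.
  rewrite tflip_tmul /swR tflipK /flipDelta /swD tflipK.
  by congr (tmul (tflip (Delta a _ _)) (R1 _)); ring.
- move=> j; transitivity (tflip (tconv X (swR R2) (j - n))).
    rewrite /tconv tflip_fsum [RHS](fsum_shift _ n); apply: eq_fsum => k.
    rewrite tflip_tmul tflipK; congr (tmul _ (R2 _)); ring.
  rewrite X2 /tconv tflip_fsum; apply: eq_fsum => k.
  by rewrite tflip_tmul tflipK addrAC.
Qed.

End HalfTheorem.
(** * Associativity of the product on one completion *)

Section Families.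
Variables (F : fieldType) (D : algType F).
Implicit Types (X Y Z : ctens D).

Definition fam (n : int) (X : int -> tensor D D) : ctens D :=
  fun n1 n2 => if n1 + n2 == n then X n1 else 0.

Lemma cmul_fam m n (X Y : int -> tensor D D) : cmul (fam m X) (fam n Y) = fam (m + n) (tconv X Y).
Proof.
apply/funext => n1; apply/funext => n2; rewrite /cmul /fam.
case: eqP => [e|ne]; last first.
  apply: fsum0 => l; case: eqP => [e1|_]; last by rewrite tmul0t.
  case: eqP => [e2|_]; last by rewrite tmult0.
  by exfalso; apply: ne; lia.
have hI : injective (fun i : int => (i, m - i)) by move=> i j [].
rewrite (fsum_inj hI) => [|[i j] /=].
  apply: eq_fsum => i /=; rewrite (_ : i + (m - i) == m); last by apply/eqP; ring.
  by rewrite (_ : n1 - i + (n2 - (m - i)) == n) //; lia.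
have [e1 _|_] := eqVneq (i + j) m; last by rewrite tmul0t eqxx.
by exists i; congr (_, _); lia.
Qed.

(** The support condition of the completion D (x)_> D. Among families that
    satisfy it, each component of a product is a finite sum, which is what
    associativity needs. *)
Definition gt_bounded X := exists (c1 : int) (c2 : int -> int),
  forall n1 n2, X n1 n2 != 0 -> c1 <= n1 /\ c2 n1 <= n2.

Lemma lower_bound (f : int -> int) (s : seq int) :
  exists L : int, forall i, i \in s -> L <= f i.
Proof.
elim: s => [|x s [L HL]]; first by exists 0.
exists (Num.min L (f x)) => i; rewrite inE => /orP[/eqP ->|/HL h].
  by rewrite ge_min lexx orbT.
by rewrite ge_min h.
Qed.

Lemma tmul_neq0 (t u : tensor D D) : tmul t u != 0 -> t != 0 /\ u != 0.
Proof.
move=> h; split; apply: contraNneq h => ->; first by rewrite tmul0t.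
by rewrite tmult0.
Qed.

Lemma fsum_neq0 (M : choiceType) (V : nmodType) (f : M -> V) :
  \sum_(i \in [set: M]) f i != 0 -> exists i, f i != 0.
Proof.
move=> h; apply: contrapT => nf; move: h; rewrite fsum0 ?eqxx // => i.
by apply/eqP/negPn/negP => fi; apply: nf; exists i.
Qed.

Lemma gt_bounded2 X Y n1 n2 : gt_bounded X -> gt_bounded Y -> exists s : seq (int * int),
  forall l, X l.1 l.2 != 0 -> Y (n1 - l.1) (n2 - l.2) != 0 -> l \in s.
Proof.
move=> [cx [dx Hx]] [cy [dy Hy]].
pose w := zwin cx (n1 - cy).
have [Lx HLx] := lower_bound dx w.
have [Ly HLy] := lower_bound (fun i => dy (n1 - i)) w.
pose s := [seq (i, j) | i <- w, j <- zwin Lx (n2 - Ly)].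
exists s => -[i j] /= /Hx[h1 h2] /Hy[h3 h4].
have iw : i \in w by apply: mem_zwin => //; lia.
apply/allpairsPdep; exists i, j; split=> //=.
by have := HLx i iw; have := HLy i iw => h5 h6; apply: mem_zwin; lia.
Qed.

Lemma gt_bounded3 X Y Z n1 n2 : gt_bounded X -> gt_bounded Y -> gt_bounded Z ->
  exists sx sy : seq (int * int), forall l m, X l.1 l.2 != 0 -> Y m.1 m.2 != 0 ->
    Z (n1 - l.1 - m.1) (n2 - l.2 - m.2) != 0 -> (l \in sx) && (m \in sy).
Proof.
move=> [cx [dx Hx]] [cy [dy Hy]] [cz [dz Hz]].
pose wx := zwin cx (n1 - cy - cz); pose wy := zwin cy (n1 - cx - cz).
pose wz := zwin cz (n1 - cx - cy).
have [Lx HLx] := lower_bound dx wx.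
have [Ly HLy] := lower_bound dy wy.
have [Lz HLz] := lower_bound dz wz.
pose sx := [seq (i, j) | i <- wx, j <- zwin Lx (n2 - Ly - Lz)].
pose sy := [seq (i, j) | i <- wy, j <- zwin Ly (n2 - Lx - Lz)].
exists sx, sy.
move=> [i j] [i' j'] /= /Hx[h1 h2] /Hy[h3 h4] /Hz[h5 h6].
have iw : i \in wx by apply: mem_zwin => //; lia.
have iw' : i' \in wy by apply: mem_zwin => //; lia.
have iw2 : n1 - i - i' \in wz by apply: mem_zwin => //; lia.
have := HLx i iw; have := HLy i' iw'; have := HLz _ iw2 => h7 h8 h9.
apply/andP; split; apply/allpairsPdep; [exists i, j|exists i', j']; split=> //=;
  by apply: mem_zwin; lia.
Qed.

Lemma cmulA X Y Z : gt_bounded X -> gt_bounded Y -> gt_bounded Z ->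
  cmul X (cmul Y Z) = cmul (cmul X Y) Z.
Proof.
move=> gX gY gZ; apply/funext => n1; apply/funext => n2; rewrite {1 3}/cmul.
have [sx [sy Hs]] := gt_bounded3 n1 n2 gX gY gZ.
pose f (l m : int * int) := tmul (X l.1 l.2)
  (tmul (Y m.1 m.2) (Z (n1 - l.1 - m.1) (n2 - l.2 - m.2))).
have f0 l m : f l m != 0 -> (l \in sx) && (m \in sy).
  by move=> /tmul_neq0[h1 /tmul_neq0[h2 h3]]; exact: Hs.
transitivity (\sum_(l \in [set: int * int]) \sum_(m \in [set: int * int]) f l m).
  apply: eq_fsum => l; rewrite /cmul.
  have [Xl|Xl] := eqVneq (X l.1 l.2) 0.
    by rewrite Xl tmul0t fsum0 // => m; rewrite /f Xl tmul0t.
  rewrite (fsum_morph (tmult0 _) (tmulDr _)) //.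
  by exists sy => m /tmul_neq0[h1 h2]; case/andP: (Hs l m Xl h1 h2).
rewrite -(fsum_conv f0); apply: eq_fsum => k; rewrite /cmul.
have fE l : f l (k - l) = tmul (tmul (X l.1 l.2) (Y (k.1 - l.1) (k.2 - l.2)))
    (Z (n1 - k.1) (n2 - k.2)).
  rewrite -tmulA; congr (tmul _ (tmul _ (Z _ _))) => /=; ring.
have [Zk|Zk] := eqVneq (Z (n1 - k.1) (n2 - k.2)) 0.
  by rewrite Zk tmult0 fsum0 // => l; rewrite fE Zk tmult0.
rewrite (eq_fsum fE).
rewrite (fsum_morph (h := fun t => tmul t _) (tmul0t _) (tmulDl _)) //.
exists sx => l /tmul_neq0[h1 h2]; have := Hs l (k - l) h1 h2.
rewrite (_ : n1 - l.1 - (k - l).1 = n1 - k.1); last by rewrite /=; ring.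
rewrite (_ : n2 - l.2 - (k - l).2 = n2 - k.2); last by rewrite /=; ring.
by move=> /(_ Zk)/andP[].
Qed.

Lemma cmul_linr X Y Y' c : gt_bounded X -> gt_bounded Y -> gt_bounded Y' ->
  cmul X (fun n1 n2 => c *: Y n1 n2 + Y' n1 n2) =
  (fun n1 n2 => c *: cmul X Y n1 n2 + cmul X Y' n1 n2).
Proof.
move=> gX gY gY'; apply/funext => n1; apply/funext => n2; rewrite /cmul.
have [s Hs] := gt_bounded2 n1 n2 gX gY; have [s' Hs'] := gt_bounded2 n1 n2 gX gY'.
rewrite (fsum_undup (s := s ++ s')) => [|l]; last first.
  rewrite mem_cat; apply: contraR => /norP[h h'].
  have [->|Xl] := eqVneq (X l.1 l.2) 0; first by rewrite tmul0t.
  have [e|/(Hs _ Xl)] := eqVneq (Y (n1 - l.1) (n2 - l.2)) 0; last by rewrite (negbTE h).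
  have [e'|/(Hs' _ Xl)] := eqVneq (Y' (n1 - l.1) (n2 - l.2)) 0; last by rewrite (negbTE h').
  by rewrite e e' scaler0 addr0 tmult0.
rewrite (fsum_undup (s := s ++ s')
  (f := fun m => tmul (X m.1 m.2) (Y (n1 - m.1) (n2 - m.2)))) => [|l]; last first.
  by move=> /tmul_neq0[h1 h2]; rewrite mem_cat Hs.
rewrite (fsum_undup (s := s ++ s')
  (f := fun m => tmul (X m.1 m.2) (Y' (n1 - m.1) (n2 - m.2)))) => [|l]; last first.
  by move=> /tmul_neq0[h1 h2]; rewrite mem_cat Hs' ?orbT.
rewrite scaler_sumr -big_split; apply: eq_bigr => l _; exact: tmul_linr.
Qed.

Lemma cmul_linl X X' Y c : gt_bounded X -> gt_bounded X' -> gt_bounded Y ->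
  cmul (fun n1 n2 => c *: X n1 n2 + X' n1 n2) Y =
  (fun n1 n2 => c *: cmul X Y n1 n2 + cmul X' Y n1 n2).
Proof.
move=> gX gX' gY; apply/funext => n1; apply/funext => n2; rewrite /cmul.
have [s Hs] := gt_bounded2 n1 n2 gX gY; have [s' Hs'] := gt_bounded2 n1 n2 gX' gY.
rewrite (fsum_undup (s := s ++ s')) => [|l]; last first.
  rewrite mem_cat; apply: contraR => /norP[h h'].
  have [->|Yl] := eqVneq (Y (n1 - l.1) (n2 - l.2)) 0; first by rewrite tmult0.
  have [e|Xl] := eqVneq (X l.1 l.2) 0; last by rewrite Hs in h.
  have [e'|Xl] := eqVneq (X' l.1 l.2) 0; last by rewrite Hs' in h'.
  by rewrite e e' scaler0 addr0 tmul0t.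
rewrite (fsum_undup (s := s ++ s')
  (f := fun m => tmul (X m.1 m.2) (Y (n1 - m.1) (n2 - m.2)))) => [|l]; last first.
  by move=> /tmul_neq0[h1 h2]; rewrite mem_cat Hs.
rewrite (fsum_undup (s := s ++ s')
  (f := fun m => tmul (X' m.1 m.2) (Y (n1 - m.1) (n2 - m.2)))) => [|l]; last first.
  by move=> /tmul_neq0[h1 h2]; rewrite mem_cat Hs' ?orbT.
by rewrite scaler_sumr -big_split; apply: eq_bigr => l _; rewrite tmul_linl.
Qed.

Lemma cmul1 X : cmul (@cone F D) X = X.
Proof.
apply/funext => n1; apply/funext => n2; rewrite /cmul /cone /chom.
rewrite (fsum_single (i0 := (0, 0))) => [|[i j] ij] /=.
  by rewrite tmul1t !subr0.
case: ifP => [/andP[/eqP e1 /eqP e2]|_]; last by rewrite tmul0t.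
by rewrite e1 e2 eqxx in ij.
Qed.

Lemma cflip_cmul X Y : cflip (cmul X Y) = cmul (cflip X) (cflip Y).
Proof.
apply/funext => n1; apply/funext => n2; rewrite /cflip /cmul tflip_fsum.
have hI : injective (fun l : int * int => (l.2, l.1)).
  by move=> [i j] [i' j'] [-> ->].
rewrite (fsum_inj hI) => [|[i j] _]; last by exists (j, i).
by apply: eq_fsum => l; rewrite tflip_tmul.
Qed.

Variable G : int -> set D.
Hypothesis Gsub : forall n, subsp (G n).
Hypothesis GGM : forall m n x y, G m x -> G n y -> G (m + n) (x * y).

(** The flip exchanges the two completions; hence the flipped coproduct can
    be multiplied by R1. *)
Lemma clt_gt_bounded_cflip S T X : clt G S T X -> gt_bounded (cflip X).
Proof.
move=> [_ [c1 [c2 Hc]]]; exists c1, c2 => n1 n2.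
by rewrite /cflip tflip_eq0 => /Hc.
Qed.

Lemma cgt_gt_bounded S T X : cgt G S T X -> gt_bounded X.
Proof. by case. Qed.

Lemma clt_sub S T S' T' X : S `<=` S' -> T `<=` T' -> clt G S T X -> clt G S' T' X.
Proof.
move=> SS TT [Xs Xc]; split=> // n1 n2; apply: tspan_sub (Xs n1 n2).
  by move=> x [? ?]; split=> //; exact: SS.
by move=> x [? ?]; split=> //; exact: TT.
Qed.

Lemma calg_bounds X : calg G X -> exists c1 c2 : int,
  forall n1 n2, X n1 n2 != 0 -> c1 <= n1 /\ c2 <= n2.
Proof.
move=> [_ [s Hs]].
have [c1 H1] := lower_bound id (map fst s); have [c2 H2] := lower_bound id (map snd s).
exists c1, c2 => n1 n2 /Hs ns; split; first exact: (H1 n1 (map_f fst ns)).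
exact: (H2 n2 (map_f snd ns)).
Qed.

Lemma calg_gt_bounded X : calg G X -> gt_bounded X.
Proof. by move=> /calg_bounds[c1 [c2 Hc]]; exists c1, (fun=> c2). Qed.

Lemma calg_clt X : calg G X -> clt G setT setT X.
Proof.
move=> aX; split; first by case: aX.
have [c1 [c2 Hc]] := calg_bounds aX; exists c2, (fun=> c1) => n1 n2 /Hc[].
by [].
Qed.

Lemma cbar_lin c X Y : cbar G setT setT X -> cbar G setT setT Y ->
  cbar G setT setT (fun n1 n2 => c *: X n1 n2 + Y n1 n2).
Proof.
move=> bX bY n1 n2; apply: tspanD => //; have [s [Hs ->]] := bX n1 n2.
rewrite scaler_sumr; apply: tspan_sum => q /Hs[[_ gq] gq'].
have [_ _ <-] := linP (fun c a b => bil_l (tens_bilinear D D) c a b q.2).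
by apply: tspan_tens => //; split=> //; exact: subspZ.
Qed.

Lemma calg_lin c X Y : calg G X -> calg G Y ->
  calg G (fun n1 n2 => c *: X n1 n2 + Y n1 n2).
Proof.
move=> [bX [s Hs]] [bY [s' Hs']]; split; first exact: cbar_lin.
exists (s ++ s') => n1 n2; rewrite mem_cat; apply: contraR => /norP[h h'].
have [e|/Hs] := eqVneq (X n1 n2) 0; last by rewrite (negbTE h).
have [e'|/Hs'] := eqVneq (Y n1 n2) 0; last by rewrite (negbTE h').
by rewrite e e' scaler0 addr0.
Qed.

Lemma calg_cmul X Y : calg G X -> calg G Y -> calg G (cmul X Y).
Proof.
move=> [bX [s Hs]] [bY [s' Hs']]; split=> [n1 n2|].
  apply: tspan_fsum => l; apply: (tspan_tmul _ _ (bX _ _) (bY _ _)) => x y.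
    by move=> [_ gx] [_ gy]; split=> //; rewrite -[n1](subrKC l.1); exact: GGM.
  by move=> [_ gx] [_ gy]; split=> //; rewrite -[n2](subrKC l.2); exact: GGM.
exists [seq (q.1 + q'.1, q.2 + q'.2) | q <- s, q' <- s'] => n1 n2.
move=> /fsum_neq0[l /tmul_neq0[/Hs h /Hs' h']]; apply/allpairsPdep.
exists l, (n1 - l.1, n2 - l.2); split=> //=; first by case: (l) h.
by congr (_, _); ring.
Qed.

End Families.
(** * Homogeneous elements and their factorizations *)

Section GradedDecomposition.
Variables (F : fieldType) (D : algType F) (G : int -> set D).
Variables (Delta : D -> ctens D) (eps : D -> F).
Hypothesis DB : topological_bialgebra G Delta eps.

Lemma submod_subsp (S : set D) : GRing.submod_closed [in S] -> subsp S.
Proof.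
move=> [S0 Sl]; split=> [|c x y Sx Sy]; first by have := S0; rewrite inE.
by have := Sl c x y; rewrite !inE; exact.
Qed.

Lemma subalg_subsp (S : set D) : GRing.subalg_closed [in S] -> subsp S /\ submon S.
Proof.
move=> [S1 Sl SM].
have S1' : S 1 by have := S1; rewrite inE.
have Sl' c x y : S x -> S y -> S (c *: x + y).
  by move=> Sx Sy; have := Sl c x y; rewrite !inE; exact.
split; split=> //; first by have := Sl' (-1) 1 1 S1' S1'; rewrite scaleN1r addNr.
by move=> x y Sx Sy; have := SM x y; rewrite !inE; exact.
Qed.

Let Gs n : subsp (G n).
Proof. by have [Gs _ _ _ _] := tb_graded DB; exact: submod_subsp. Qed.

(** Directness of the grading: the terms of the other degrees cancel among
    themselves. *)
Lemma homogeneous_part (I : eqType) (s : seq I) (d : I -> int) (y : I -> D) n x :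
  G n x -> (forall i, i \in s -> G (d i) (y i)) -> x = \sum_(i <- s) y i ->
  x = \sum_(i <- s | d i == n) y i.
Proof.
move=> gx gy xE; have [_ _ Gu _ _] := tb_graded DB.
pose f m := \sum_(i <- s | d i == m) y i - (if m == n then x else 0).
have fG m : G m (f m).
  have e : f m = -1 *: (if m == n then x else 0) + \sum_(i <- s | d i == m) y i.
    by rewrite /f scaleN1r addrC.
  rewrite e; apply: (Gs m).2; first by case: eqP => [->|_] //; case: (Gs m).
  rewrite -big_filter; apply: subsp_sum => // i; rewrite mem_filter => /andP[/eqP <-].
  exact: gy.
pose S := undup (n :: map d s).
have fS : \sum_(m <- S) f m = 0.
  have nS : n \in S by rewrite mem_undup mem_head.
  rewrite /f sumrB -[X in _ - X]big_mkcond -big_filter.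
  rewrite (_ : [seq i <- S | i == n] = [:: n]); last first.
    by rewrite filter_pred1_uniq ?undup_uniq.
  rewrite big_seq1 [X in _ - X]xE; apply/eqP; rewrite subr_eq0; apply/eqP.
  rewrite (exchange_big_dep xpredT) //=; apply: eq_big_seq => i si.
  rewrite big_mkcond (bigD1_seq (d i)) ?undup_uniq //=; last first.
    by rewrite mem_undup inE map_f ?orbT.
  by rewrite eqxx big1 ?addr0 // => m; rewrite eq_sym => /negbTE ->.
have := Gu S f (undup_uniq _) fG fS n.
rewrite mem_undup mem_head => /(_ isT)/eqP; rewrite /f eqxx subr_eq0 => /eqP.
by move=> ->.
Qed.

Lemma degree_uniq m n x : G m x -> G n x -> m != n -> x = 0.
Proof.
move=> gm gn mn; rewrite (@homogeneous_part unit [:: tt] (fun=> m) (fun=> x) n x) //.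
  by rewrite big_cons (negbTE mn) big_nil.
by rewrite big_seq1.
Qed.

Definition graded_dec (S : set D) := forall x, S x -> exists (s : seq int) (f : int -> D),
  (forall n, (S `&` G n) (f n)) /\ x = \sum_(n <- s) f n.

(** The factors of a homogeneous element of S T can be taken homogeneous.
    This is phrased as an induction principle for subspaces P, which avoids
    carrying decompositions around. *)
Lemma graded_span (S T U : set D) : graded_dec S -> graded_dec T -> @tmulr F D @` tspan S T = U ->
  forall n (P : set D), subsp P ->
  (forall i s t, S s -> G i s -> T t -> G (n - i) t -> P (s * t)) ->
  forall x, U x -> G n x -> P x.
Proof.
move=> gS gT <- n P PP HP x [t [l [Hl ->]] <-] {t} gx.
pose ok (z : (D * D) * (int * int)) :=
  [/\ S z.1.1, G z.2.1 z.1.1, T z.1.2 & G z.2.2 z.1.2].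
have [L [HL LE]] : exists L : seq ((D * D) * (int * int)),
    (forall z, z \in L -> ok z) /\
    tmulr (\sum_(q <- l) tens q.1 q.2) = \sum_(z <- L) z.1.1 * z.1.2.
  rewrite /tmulr tlift_list; last exact: (bil_mul (@lin_id _ _) (@lin_id _ _)).
  elim: l Hl {gx} => [|q l IHl] Hl; first by exists [::]; rewrite !big_nil.
  have [|L [HL LE]] := IHl _.
    by move=> q' q'l; apply: Hl; rewrite inE q'l orbT.
  have [Sq Tq] := Hl q (mem_head _ _).
  have [sa [fa [Hfa qa]]] := gS _ Sq; have [sb [fb [Hfb qb]]] := gT _ Tq.
  exists ([seq ((fa i, fb j), (i, j)) | i <- sa, j <- sb] ++ L); split=> [z|].
    rewrite mem_cat => /orP[/allpairsPdep[i [j [_ _ ->]]]|/HL //].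
    by have [? ?] := Hfa i; have [? ?] := Hfb j.
  rewrite big_cons big_cat LE big_allpairs_dep; congr (_ + _).
  rewrite qa qb mulr_suml; apply: eq_bigr => i _; rewrite mulr_sumr.
  by apply: eq_bigr.
rewrite LE in gx *.
have := homogeneous_part (d := fun z : (D * D) * (int * int) => z.2.1 + z.2.2) gx _ (erefl _).
move=> ->; last first.
  move=> z /HL[_ g1 _ g2]; have [_ _ _ _ GM] := tb_graded DB; exact: GM.
rewrite -big_filter; apply: subsp_sum => // z; rewrite mem_filter => /andP[/eqP e /HL[? g1 ? g2]].
by apply: (HP z.2.1) => //; rewrite -e addrAC subrr add0r.
Qed.

End GradedDecomposition.

(** * From the topological bialgebra to homogeneous components *)

Section Build.
Variables (F : fieldType) (D : algType F) (G : int -> set D).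
Variables (Delta : D -> ctens D) (eps : D -> F).
Hypothesis DB : topological_bialgebra G Delta eps.
Variables (r : nat) (K : 'rV[int]_r -> D).
Hypothesis KE : group_algebra_embedding G K Delta eps.

Let Gs n : subsp (G n).
Proof. by have [Gs _ _ _ _] := tb_graded DB; exact: submod_subsp. Qed.

Lemma ga_sub (P : set D) : subsp P -> (forall u, P (K u)) -> group_algebra K `<=` P.
Proof. by move=> PP PK x [s ->]; apply: subsp_sum => // q _; exact: subspZ. Qed.

Lemma ga_K u : group_algebra K (K u).
Proof. by exists [:: (1, u)]; rewrite big_seq1 scale1r. Qed.

Lemma ga_G0 : group_algebra K `<=` G 0.
Proof. by apply: ga_sub => // u; exact: (ga_degree KE). Qed.

Lemma ga_graded_dec : graded_dec G (group_algebra K).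
Proof.
move=> x Kx; exists [:: 0], (fun n => if n == 0 then x else 0).
split=> [n|]; last by rewrite big_seq1.
case: eqP => [->|_]; split=> //; first exact: ga_G0.
  by exists [::]; rewrite big_nil.
by case: (Gs n).
Qed.

Lemma span_group (S' S : set D) : graded_dec G S' -> @tmulr F D @` tspan S' (group_algebra K) = S ->
  forall n (P : set D), subsp P ->
  (forall a u, S' a -> G n a -> P (a * K u)) -> forall x, S x -> G n x -> P x.
Proof.
move=> gS' iso n P PP HP; apply: (graded_span DB gS' ga_graded_dec iso PP).
move=> i s t Ss gs Kt gt; have [e|ne] := eqVneq i n.
  rewrite e in gs; have [c ->] := Kt; rewrite mulr_sumr; apply: subsp_sum => // q _.
  by rewrite -scalerAr; apply: subspZ => //; exact: HP.
rewrite (degree_uniq DB (ga_G0 Kt) gt) ?mulr0; first by case: PP.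
by rewrite eq_sym subr_eq0 eq_sym.
Qed.

Lemma span_group3 (S1 S2 S2' S : set D) : graded_dec G S1 -> graded_dec G S2 -> graded_dec G S2' ->
  @tmulr F D @` tspan S1 S2 = S -> @tmulr F D @` tspan S2' (group_algebra K) = S2 ->
  forall n (P : set D), subsp P ->
  (forall i s t u, S1 s -> G i s -> S2' t -> G (n - i) t -> P (s * t * K u)) ->
  forall x, S x -> G n x -> P x.
Proof.
move=> g1 g2 g2' iso iso2 n P PP HP; apply: (graded_span DB g1 g2 iso PP).
move=> i s t Ss gs; apply: (span_group g2' iso2 (P := fun y => P (s * y))).
  split=> [|c x y Px Py]; first by rewrite mulr0; case: PP.
  by rewrite mulrDr -scalerAr; apply: PP.2.
by move=> a u Sa ga; rewrite mulrA; exact: HP Ss gs Sa ga.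
Qed.

Variables (A B : set D) (p : D -> D -> F).
Hypothesis As : subbialgebra G Delta A.
Hypothesis Bs : subbialgebra G Delta B.
Hypothesis PP : bialgebra_pairing G Delta eps A B p.

Let pl b : linear (p^~ b : D -> F^o).
Proof. exact: (bp_bilinear PP).2. Qed.

Let pr a : linear (p a : D -> F^o).
Proof. exact: (bp_bilinear PP).1. Qed.

(** An element of degree n is only paired with degree - n, so the
    nondegeneracy of the pairing holds degree by degree. *)
Lemma pairing_sepl n a : A a -> G n a ->
  (forall b, B b -> G (- n) b -> p a b = 0) -> a = 0.
Proof.
move=> Aa ga h; apply: (bp_nondegenerate PP).1 => // b Bb.
have [s [f [Hf ->]]] := Bs.1.2.2 _ Bb.
rewrite (linear_bigsum _ _ _ (pr a)) big1 // => m _; have [fB fG] := Hf m.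
have [e|ne] := eqVneq m (- n); first by apply: h => //; rewrite -e.
by apply: (bp_degree PP (conj Aa ga) (conj fB fG)); rewrite addrC addr_eq0.
Qed.

Lemma pairing_sepr n b : B b -> G n b ->
  (forall a, A a -> G (- n) a -> p a b = 0) -> b = 0.
Proof.
move=> Bb gb h; apply: (bp_nondegenerate PP).2 => // a Aa.
have [s [f [Hf ->]]] := As.1.2.2 _ Aa.
rewrite (linear_bigsum _ _ _ (pl b)) big1 // => m _; have [fA fG] := Hf m.
have [e|ne] := eqVneq m (- n); first by apply: h => //; rewrite -e.
by apply: (bp_degree PP (conj fA fG) (conj Bb gb)); rewrite addr_eq0.
Qed.

Lemma pairing_mull i j m a a' b : A a -> G i a -> A a' -> G j a' ->
  B b -> G m b -> p (a * a') b =
    tlift (fun y1 y2 => p a' y1 * p a y2 : F^o) (Delta b (- j) (- i)).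
Proof.
move=> Aa ga Aa' ga' Bb gb; rewrite (bp_mull PP) // /csum.
rewrite (fsum_single (i0 := (- j, - i))) => [/=|[n1 n2] ne].
  by apply: (@tlift_eq F D D F^o) => x y; rewrite mulrC.
apply: tlift_eq0 (((Bs.2 _ Bb).1) n1 n2); first exact: bil_mulF' (pr a) (pr a').
move=> x y [Bx gx] [By gy]; have [e|n1j] := eqVneq n1 (- j).
  rewrite [p a y](bp_degree PP (conj Aa ga) (conj By gy)) ?mul0r //.
  apply: contraNneq ne => h; apply/eqP; congr pair; first exact: e.
  by lia.
rewrite [p a' x](bp_degree PP (conj Aa' ga') (conj Bx gx)) ?mulr0 //.
by apply: contraNneq n1j => h; apply/eqP; lia.
Qed.

Lemma pairing_mulr i j m b b' a : B b -> G i b -> B b' -> G j b' ->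
  A a -> G m a -> p a (b * b') =
    tlift (fun x1 x2 => p x1 b * p x2 b' : F^o) (Delta a (- i) (- j)).
Proof.
move=> Bb gb Bb' gb' Aa ga; rewrite (bp_mulr PP) // /csum.
rewrite (fsum_single (i0 := (- i, - j))) // => -[n1 n2] ne.
apply: tlift_eq0 (((As.2 _ Aa).1) n1 n2); first exact: bil_mulF (pl b) (pl b').
move=> x y [Ax gx] [Ay gy]; have [e|n1i] := eqVneq n1 (- i).
  rewrite [p y b'](bp_degree PP (conj Ay gy) (conj Bb' gb')) ?mulr0 //.
  apply: contraNneq ne => h; apply/eqP; congr pair; first exact: e.
  by lia.
rewrite [p x b](bp_degree PP (conj Ax gx) (conj Bb gb)) ?mul0r //.
by apply: contraNneq n1i => h; apply/eqP; lia.
Qed.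

Lemma Delta_mul_comp m n x y : G m x -> G n y -> forall k,
    Delta (x * y) k (m + n - k) =
    \sum_(i \in [set: int])
      tmul (Delta x i (m - i)) (Delta y (k - i) (n - (k - i))).
Proof.
move=> gx gy k; rewrite (tb_mul DB) /cmul.
have hI : injective (fun i : int => (i, m - i)) by move=> i j [].
rewrite (fsum_inj hI) => [|[i j] /= /tmul_neq0[h _]]; last first.
  by exists i; congr pair; have := tb_degree DB gx h; lia.
by apply: eq_fsum => i /=; congr (tmul _ (Delta _ _ _)); lia.
Qed.

(** A double contraction of two coproducts is reduced to a sum over one
    index: the total degrees of a and b and the degree of the pairing leave
    one free parameter. *)
Lemma csum2_fsum (U : lmodType F) (f : D -> D -> D -> D -> U) n m a b
    (e1 e2 e3 e4 : int -> int) :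
  (forall x y, bilinear_map (f x y)) ->
  (forall x' y', bilinear_map (fun x y => f x y x' y')) ->
  A a -> G n a -> B b -> G m b -> injective (fun i => (e1 i, e2 i, (e3 i, e4 i))) ->
  (forall i j k l x1 x2 y1 y2, i + j = n -> k + l = m -> A x1 -> G i x1 -> A x2 -> G j x2 ->
     B y1 -> G k y1 -> B y2 -> G l y2 ->
     f x1 x2 y1 y2 != 0 -> exists z, (i, j, (k, l)) = (e1 z, e2 z, (e3 z, e4 z))) ->
  csum2 f (Delta a) (Delta b) =
  \sum_(i \in [set: int]) tlift (fun x1 x2 => tlift (f x1 x2) (Delta b (e3 i) (e4 i)))
     (Delta a (e1 i) (e2 i)).
Proof.
move=> f1 f2 Aa ga Bb gb hI Hf; rewrite /csum2 (fsum_inj hI) // => -[[i j] [k l]] /= h.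
apply: contrapT => nz; move: h; apply/negP; rewrite negbK; apply/eqP.
have [a0|/(tb_degree DB ga) ij] := eqVneq (Delta a i j) 0.
  by rewrite a0 tlift0 //; exact: bil_tlift2.
have [b0|/(tb_degree DB gb) kl] := eqVneq (Delta b k l) 0.
  rewrite b0 (@tlift_eq _ _ _ _ _ (fun _ _ => 0)).
    apply: tlift_eq0 ((As.2 _ Aa).1 i j) => //.
    by apply: bilP => *; rewrite scaler0 addr0.
  by move=> x y; rewrite tlift0.
apply: tlift_eq0 ((As.2 _ Aa).1 i j); first exact: bil_tlift2.
move=> x1 x2 [? ?] [? ?]; apply: tlift_eq0 ((Bs.2 _ Bb).1 k l) => //.
move=> y1 y2 [? ?] [? ?]; apply/eqP; apply: contrapT => /negP h; apply: nz.
by apply: (Hf i j k l x1 x2 y1 y2).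
Qed.

Lemma exchange_comp n m a b : A a -> G n a -> B b -> G m b ->
    \sum_(i \in [set: int]) tlift (fun x1 x2 => tlift (fun y1 y2 =>
        p x1 y1 *: (y2 * x2)) (Delta b (- i) (m + i))) (Delta a i (n - i)) =
    \sum_(i \in [set: int]) tlift (fun x1 x2 => tlift (fun y1 y2 =>
        p x2 y2 *: (x1 * y1)) (Delta b (m + i) (- i))) (Delta a (n - i) i).
Proof.
move=> Aa ga Bb gb; have := bp_exchange PP Aa Bb.
rewrite (csum2_fsum (n := n) (m := m) (e1 := id) (e2 := fun i => n - i)
  (e3 := fun i => - i) (e4 := fun i => m + i)) //; first last.
- move=> i j k l x1 x2 y1 y2 ij kl A1 g1 _ _ B1 h1 _ _ h; exists i => /=.
  have e : i + k = 0.
    apply/eqP/negPn/negP => ik; move/negP: h; apply.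
    by rewrite (bp_degree PP (conj A1 g1) (conj B1 h1) ik) scale0r.
  by congr (_, _, (_, _)); lia.
- by move=> i j [].
- move=> y1 y2; exact: bil_scl (pl y1) (lin_mull y2).
- move=> x1 x2; exact: bil_scl (pr x1) (lin_mulr x2).
rewrite (csum2_fsum (n := n) (m := m) (e2 := id) (e1 := fun i => n - i)
  (e4 := fun i => - i) (e3 := fun i => m + i)) //; first last.
- move=> i j k l x1 x2 y1 y2 ij kl _ _ A1 g1 _ _ B1 h1 h; exists j => /=.
  have e : j + l = 0.
    apply/eqP/negPn/negP => ik; move/negP: h; apply.
    by rewrite (bp_degree PP (conj A1 g1) (conj B1 h1) ik) scale0r.
  by congr (_, _, (_, _)); lia.
- by move=> i j [].
- move=> y1 y2; exact: bil_scr (pl y2) (lin_mulr y1).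
- by move=> x1 x2; exact: bil_scr (pr x2) (lin_mull x1).
Qed.

Variables (A1 A2 B1 B2 A2' B1' : set D).
Hypotheses (A1g : graded_subalgebra G A1) (A2g : graded_subalgebra G A2).
Hypotheses (B1g : graded_subalgebra G B1) (B2g : graded_subalgebra G B2).
Hypotheses (A2'g : graded_subalgebra G A2') (B1'g : graded_subalgebra G B1').
Hypotheses (A1A : A1 `<=` A) (A2A : A2 `<=` A) (A2'A : A2' `<=` A2).
Hypotheses (B1B : B1 `<=` B) (B2B : B2 `<=` B) (B1'B : B1' `<=` B1).
Hypotheses (A1n : forall n, n < 0 -> A1 `&` G n `<=` [set 0])
  (A2n : forall n, 0 < n -> A2 `&` G n `<=` [set 0])
  (B1n : forall n, n < 0 -> B1 `&` G n `<=` [set 0])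
  (B2n : forall n, 0 < n -> B2 `&` G n `<=` [set 0]).
Hypotheses (A_iso : product_iso A1 A2 A) (B_iso : product_iso B2 B1 B)
  (A2_iso : product_iso A2' (group_algebra K) A2)
  (B1_iso : product_iso B1' (group_algebra K) B1).
Hypotheses (A1D : forall x, A1 x -> clt G A A1 (Delta x))
  (A2D : forall x, A2 x -> clt G A2 A (Delta x))
  (B1D : forall x, B1 x -> clt G B B1 (Delta x))
  (B2D : forall x, B2 x -> clt G B2 B (Delta x)).
Hypothesis p_factor : forall a1 a2 b1 b2, A1 a1 -> A2 a2 -> B1 b1 -> B2 b2 ->
  p (a1 * a2) (b2 * b1) = p a1 b2 * p a2 b1.
Hypotheses (A2_0 : A2 `&` G 0 = group_algebra K)
  (B1_0 : B1 `&` G 0 = group_algebra K).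
Hypothesis p_factor2 : forall a a0 b b0,
  A2' a -> (A2 `&` G 0) a0 -> B1' b -> (B1 `&` G 0) b0 ->
  p (a * a0) (b * b0) = p a b * p a0 b0.

Let AK u : A2 (K u).
Proof. by have := ga_K u; rewrite -A2_0 => -[]. Qed.
Let BK u : B1 (K u).
Proof. by have := ga_K u; rewrite -B1_0 => -[]. Qed.

Let sA := subalg_subsp As.1.1.
Let sB := subalg_subsp Bs.1.1.
Let sA1 := subalg_subsp A1g.1.
Let sA2 := subalg_subsp A2g.1.
Let sA2' := subalg_subsp A2'g.1.
Let sB1 := subalg_subsp B1g.1.
Let sB2 := subalg_subsp B2g.1.
Let sB1' := subalg_subsp B1'g.1.

Lemma factorK a b u v : A2' a -> B1' b ->
  p (a * K u) (b * K v) = p a b * p (K u) (K v).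
Proof.
move=> a2 b1; apply: p_factor2 => //; split=> //; exact: (ga_degree KE).
Qed.

Lemma K_inj u v : K u = K v -> u = v.
Proof.
move=> e; apply/eqP/negPn/negP => uv.
have := ga_free KE (s := [:: u; v]) (c := fun w => if w == u then 1 else -1) _ _ (u := u).
rewrite /= inE uv mem_head big_cons big_seq1 eqxx eq_sym (negbTE uv).
rewrite e scale1r scaleN1r subrr => /(_ isT erefl isT)/eqP.
by rewrite oner_eq0.
Qed.

(** By the factorizations of the pairing, a1 a2 K_w and K_v pair through a
    scalar times p (K w) (K v); so these numbers determine K_v, and then v
    since the K_v are linearly independent. *)
Lemma chi_injr v v' :
  (forall w, p (K w) (K v) = p (K w) (K v')) -> v = v'.
Proof.
move=> h; apply: K_inj; apply/eqP; rewrite -subr_eq0; apply/eqP.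
have K0 w : G 0 (K w) by exact: (ga_degree KE).
apply: (pairing_sepr (n := 0)).
- by rewrite -scaleN1r addrC; apply: sB.1.2; exact: B1B.
- by rewrite -scaleN1r addrC; apply: (Gs 0).2.
move=> a Aa; rewrite oppr0 => ga; rewrite -scaleN1r addrC (pr a) [_ *: _]mulN1r.
apply/eqP; rewrite addrC subr_eq0; apply/eqP.
apply: (span_group3 A1g.2.2 A2g.2.2 A2'g.2.2 A_iso.1 A2_iso.1
  (P := fun a => p a (K v) = p a (K v'))) Aa ga.
  split=> [|c x y hx hy]; last by rewrite !pl hx hy.
  by have [-> _ _] := linP (pl (K v)); have [-> _ _] := linP (pl (K v')).
move=> i s t u Ss gs St gt; rewrite -mulrA.
have E w : p (s * (t * K u)) (K w) = p s 1 * (p t 1 * p (K u) (K w)).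
  rewrite -(factorK u w St sB1'.2.1) !mul1r -{1}[K w]mul1r p_factor //.
    by apply: sA2.2.2 => //; exact: A2'A.
  exact: sB2.2.1.
by rewrite !E h.
Qed.

Lemma chi_injl v v' :
  (forall w, p (K v) (K w) = p (K v') (K w)) -> v = v'.
Proof.
move=> h; apply: K_inj; apply/eqP; rewrite -subr_eq0; apply/eqP.
have K0 w : G 0 (K w) by exact: (ga_degree KE).
apply: (pairing_sepl (n := 0)).
- by rewrite -scaleN1r addrC; apply: sA.1.2; exact: A2A.
- by rewrite -scaleN1r addrC; apply: (Gs 0).2.
move=> b Bb; rewrite oppr0 => gb; rewrite -scaleN1r addrC (pl b) [_ *: _]mulN1r.
apply/eqP; rewrite addrC subr_eq0; apply/eqP.
apply: (span_group3 B2g.2.2 B1g.2.2 B1'g.2.2 B_iso.1 B1_iso.1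
  (P := fun b => p (K v) b = p (K v') b)) Bb gb.
  split=> [|c x y hx hy]; last by rewrite !pr hx hy.
  by have [-> _ _] := linP (pr (K v)); have [-> _ _] := linP (pr (K v')).
move=> i s t u Ss gs St gt; rewrite -mulrA.
have E w : p (K w) (s * (t * K u)) = p 1 s * (p 1 t * p (K w) (K u)).
  rewrite -(factorK w u sA2'.2.1 St) !mul1r -{1}[K w]mul1r p_factor //.
    exact: sA1.2.1.
  by apply: sB1.2.2 => //; exact: B1'B.
by rewrite !E h.
Qed.

Variables (R1 R2 : ctens D).
Hypotheses (R1s : cbar G A1 B2 R1) (R1t : pairing_tensor G p A1 B2 R1).
Hypotheses (R2s : cbar G A2' B1' R2) (R2t : pairing_tensor G p A2' B1' R2).

Lemma double_of_bialgebra : double_data G Delta eps K p A A1 A2 A2' B B2 B1 B1'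
  (fun i => R1 i (- i)) (fun i => R2 i (- i)).
Proof.
have [_ _ _ G1 GM] := tb_graded DB.
have [epsM1 epsM] := tb_eps_monoid DB.
have [_ R1l R1r] := R1t; have [_ R2l R2r] := R2t.
split; try by [case: sA|case: sA1|case: sA2|case: sA2'|case: sB|case: sB1
  |case: sB2|case: sB1'].
all: try by [].
- exact: ga_degree KE.
- exact: ga_one KE.
- exact: ga_mul KE.
- by move=> n x n0 ? ?; apply: (A1n n0).
- by move=> n x n0 ? ?; apply: (A2n n0).
- by move=> n x n0 ? ?; apply: (B1n n0).
- by move=> n x n0 ? ?; apply: (B2n n0).
- exact: span_group3 A1g.2.2 A2g.2.2 A2'g.2.2 A_iso.1 A2_iso.1.
- exact: span_group3 B2g.2.2 B1g.2.2 B1'g.2.2 B_iso.1 B1_iso.1.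
- exact: span_group A2'g.2.2 A2_iso.1.
- exact: span_group B1'g.2.2 B1_iso.1.
- exact: tb_linear DB.
- move=> n x gx; have [_ [c1 [c2 Hc]]] := tb_clt DB x; exists c1 => i j h.
  by split; [exact: (tb_degree DB gx h)|case: (Hc _ _ h)].
- by move=> x i j Ax; exact: (As.2 _ Ax).1.
- by move=> x i j Ax; exact: (A1D Ax).1.
- by move=> x i j Ax; exact: (A2D Ax).1.
- by move=> x i j Ax; exact: (Bs.2 _ Ax).1.
- by move=> x i j Ax; exact: (B1D Ax).1.
- by move=> x i j Ax; exact: (B2D Ax).1.
- exact: Delta_mul_comp.
- exact: ga_Delta KE.
- exact: tb_counitl DB.
- exact: tb_counitr DB.
- exact: tb_eps_scalar DB.
- exact: tb_eps_degree DB.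
- exact: ga_eps KE.
- exact: pairing_sepl.
- exact: pairing_sepr.
- by move=> m n a b Aa ga Bb gb; exact: (bp_degree PP (conj Aa ga) (conj Bb gb)).
- exact: pairing_mull.
- exact: pairing_mulr.
- exact: bp_oner PP.
- exact: bp_onel PP.
- exact: exchange_comp.
- by move=> a1 a2 b2 b1 *; exact: p_factor.
- by move=> a b u v; exact: factorK.
- exact: chi_injr.
- exact: chi_injl.
- by move=> i z Bz gz; exact: R1l.
- by move=> i x Ax gx; exact: R1r.
- by move=> i z Bz gz; exact: R2l.
- by move=> i x Ax gx; exact: R2r.
Qed.

End Build.

(** * Conjugation by R0 *)

Section ComplexPowers.
Variables (R : realType).

Lemma cexp0 : cexp (0 : R[i]) = 1.
Proof. by rewrite /cexp /= expR0 cos0 sin0 mulr1 mulr0. Qed.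

Lemma cexpD (z w : R[i]) : cexp (z + w) = cexp z * cexp w.
Proof.
case: z w => [a b] [c d]; rewrite /cexp /= expRD cosD sinD.
by apply/eqP; rewrite eq_complex /=; apply/andP; split; apply/eqP; ring.
Qed.

Variables (r : nat) (lq : R[i]).

Lemma qpowD (z w : R[i]) : qpow lq (z + w) = qpow lq z * qpow lq w.
Proof. by rewrite /qpow mulrDl cexpD. Qed.

Lemma qpow0 : qpow lq (0 : R[i]) = 1.
Proof. by rewrite /qpow mul0r cexp0. Qed.

Lemma qpowN (z : R[i]) : qpow lq (- z) * qpow lq z = 1.
Proof. by rewrite -qpowD addNr qpow0. Qed.

(** A character of Z^r is determined by its values on the basis vectors. *)
Lemma char_qpow (f : 'rV[int]_r -> R[i]) (l : 'I_r -> R[i]) :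
  f 0 = 1 -> (forall u v, f (u + v) = f u * f v) ->
  (forall j, f (delta_mx 0 j) = qpow lq (l j)) ->
  forall w, f w = qpow lq (\sum_j l j * (w 0 j)%:~R).
Proof.
move=> f0 fD fl w; pose g (w : 'rV[int]_r) := qpow lq (\sum_j l j * (w 0 j)%:~R).
have g0 : g 0 = 1.
  by rewrite /g big1 ?qpow0 // => j _; rewrite mxE mulr0.
have gD u v : g (u + v) = g u * g v.
  rewrite /g -qpowD; congr qpow; rewrite -big_split.
  by apply: eq_bigr => j _ /=; rewrite mxE rmorphD mulrDr.
rewrite -/(g w).
have fgD u v : f u = g u -> f v = g v -> f (u + v) = g (u + v).
  by rewrite fD gD => -> ->.
have fgN u : f u = g u -> f (- u) = g (- u).
  move=> fu; have f1 : f (- u) * f u = 1 by rewrite -fD addNr.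
  have g1 : g (- u) * g u = 1 by rewrite -gD addNr.
  have nz : g u != 0.
    by apply/negP => /eqP z; have := oner_neq0 R[i]; rewrite -g1 z mulr0 eqxx.
  by apply: (mulIf nz); rewrite -{1}fu f1 g1.
rewrite (row_sum_delta w).
apply: (big_ind (fun u => f u = g u)) => [|u v|j _]; first by rewrite f0 g0.
  exact: fgD.
have fgd : f (delta_mx 0 j) = g (delta_mx 0 j).
  rewrite fl /g (bigD1 j) //= mxE !eqxx mulr1 big1 ?addr0 // => i ij.
  by rewrite mxE (negbTE ij) mulr0.
have fgn n : f (delta_mx 0 j *+ n) = g (delta_mx 0 j *+ n).
  elim: n => [|n IHn]; first by rewrite mulr0n f0 g0.
  by rewrite mulrS; exact: fgD.
case: (w 0 j) => n.
  by rewrite -natz scaler_nat; exact: fgn.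
by rewrite NegzE scaleNr -natz scaler_nat; apply: fgN; exact: fgn.
Qed.

End ComplexPowers.

Section CartanConjugation.
Variables (R : realType) (D : algType R[i]) (G : int -> set D).
Variables (Delta : D -> ctens D) (eps : D -> R[i]).
Variables (r : nat) (K : 'rV[int]_r -> D) (p : D -> D -> R[i]).
Variables (A A1 A2 A2' B B2 B1 B1' : set D) (R1 R2 : int -> tensor D D).
Hypothesis H : double_data G Delta eps K p A A1 A2 A2' B B2 B1 B1' R1 R2.
Variables (lq : R[i]) (alpha : 'M[R[i]]_r).
Hypothesis alpha_unit : alpha \in unitmx.
Hypothesis p_alpha : forall i j,
  p (K (delta_mx 0 i)) (K (delta_mx 0 j)) = qpow lq (alpha i j).

Lemma wtI_weight v x : wtI K p v x -> weight K lq (zvec R (- v) *m alpha^T) x.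
Proof.
move=> wx i; rewrite (wx (delta_mx 0 i)) scalerA.
rewrite (char_qpow (f := fun w => p (K (delta_mx 0 i)) (K w)) (chi0r H _)
  (chiDr H _) (p_alpha i)).
rewrite (_ : (zvec R (- v) *m alpha^T) 0 i = - \sum_j alpha i j * (v 0 j)%:~R).
  by rewrite qpowN scale1r.
rewrite mxE -sumrN; apply: eq_bigr => j _.
by rewrite !mxE rmorphN mulNr mulrC.
Qed.

Lemma wtII_weight u y : wtII K p u y -> weight K lq (zvec R (- u) *m alpha) y.
Proof.
move=> wy i; rewrite (wy (delta_mx 0 i)) scalerA.
rewrite (char_qpow (f := fun w => p (K w) (K (delta_mx 0 i))) (chi0l H _)
  (fun u u' => chiDl H u u' _) (p_alpha^~ i)).
rewrite (_ : (zvec R (- u) *m alpha) 0 i = - \sum_j alpha j i * (u 0 j)%:~R).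
  by rewrite qpowN scale1r.
rewrite mxE -sumrN; apply: eq_bigr => j _.
by rewrite !mxE rmorphN mulNr mulrC.
Qed.

Variables (E : unitAlgType R[i]) (iota : ctens D -> E) (R0 : E).
Hypothesis X0 : q_r0_extension G K lq alpha iota R0.

Lemma clt_chom m n t : tspan (G m) (G n) t -> clt G setT setT (chom m n t).
Proof.
move=> ts; split=> [n1 n2|]; rewrite /chom.
  case: ifP => [/andP[/eqP -> /eqP ->]|_]; last exact: tspan0.
  by apply: tspan_sub ts.
exists n, (fun=> m) => n1 n2; case: ifP => [/andP[/eqP -> /eqP ->]|_] //.
by rewrite eqxx.
Qed.

Lemma cmul_chom m n m' n' (t t' : tensor D D) :
  cmul (chom m n t) (chom m' n' t') = chom (m + m') (n + n') (tmul t t').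
Proof.
apply/funext => n1; apply/funext => n2; rewrite /cmul /chom.
rewrite (fsum_single (i0 := (m, n))) /= => [|[i j] ij] /=; last first.
  case: ifP => [/andP[/eqP e1 /eqP e2]|_]; last by rewrite tmul0t.
  by rewrite e1 e2 eqxx in ij.
rewrite !eqxx /= !subr_eq [_ + m']addrC [n' + n]addrC [m' + m]addrC.
by case: ifP => _ //; rewrite tmult0.
Qed.

Lemma iota_zero : iota (fun _ _ => 0) = 0.
Proof.
have c0 : clt G setT setT (fun _ _ => 0).
  by split=> [n1 n2|]; [exact: tspan0|exists 0, (fun=> 0) => ? ?; rewrite eqxx].
have e := ext_linear X0 (-1) c0 c0.
rewrite scaler0 addr0 in e; rewrite e; apply/eqP.
by rewrite addrC scaleN1r subrr.
Qed.

Lemma iotaD X Y : clt G setT setT X -> clt G setT setT Y ->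
  iota (fun n1 n2 => X n1 n2 + Y n1 n2) = iota X + iota Y.
Proof.
move=> cX cY; rewrite -[iota X]scale1r -(ext_linear X0 1 cX cY).
by congr (iota _); apply/funext => i; apply/funext => j; rewrite scale1r.
Qed.

(** The defining relations of R0 for x (x) 1 and for 1 (x) y. Their
    exponents are the integral vectors - v and - u, because the weight of x
    is - v times the transpose of alpha, the weight of y is - u times alpha,
    and r0 is the inverse of alpha. *)
Lemma R0_tens i j x v y u : G i x -> wtI K p v x -> G j y -> wtII K p u y ->
  R0 * iota (chom i j (tens x y)) =
  iota (chom i j (tens (x * K (- u)) (K (- v) * y))) * R0.
Proof.
move=> gx wx gy wy.
have G01 := dG1 H; have GK := dKG H.
have -> : chom i j (tens x y) = cmul (chom i 0 (tens x 1)) (chom 0 j (tens 1 y)).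
  by rewrite cmul_chom tmul_tens addr0 add0r mulr1 mul1r.
have -> : chom i j (tens (x * K (- u)) (K (- v) * y)) =
    cmul (chom i 0 (tens x (K (- v)))) (chom 0 j (tens (K (- u)) y)).
  by rewrite cmul_chom tmul_tens addr0 add0r.
rewrite !(ext_mul X0); try by apply: clt_chom; exact: tspan_tens.
rewrite mulrA (ext_weightl X0 gx (wtI_weight wx) (u := - v)); last first.
  by rewrite /r0mx -mulmxA -trmx_mul mulVmx // trmx1 mulmx1.
rewrite -mulrA (ext_weightr X0 gy (wtII_weight wy) (u := - u)); last first.
  by rewrite /r0mx trmxK -mulmxA mulmxV // mulmx1.
by rewrite mulrA.
Qed.

Lemma tspan_wt_conj i j (q : wterm D r) : G i q.1.1 -> G j q.2.1 ->
  tspan (G i) (G j) (wt_conj K q).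
Proof.
move=> gx gy; apply: tspan_tens.
  by rewrite -(addr0 i); exact: (dGM H gx (dKG H _)).
by rewrite -(add0r j); exact: (dGM H (dKG H _) gy).
Qed.

Lemma wconj_span i j t t' : wconj G K p i j t t' -> tspan (G i) (G j) t'.
Proof.
move=> [s [Hs _ -> _]]; apply: tspan_sum => q /Hs[gx _ gy _].
exact: tspan_wt_conj.
Qed.

Lemma R0_wconj i j t t' : wconj G K p i j t t' ->
  R0 * iota (chom i j t) = iota (chom i j t') * R0.
Proof.
move=> [s [Hs -> -> _]].
have c0 : chom i j (0 : tensor D D) = fun _ _ => 0.
  by apply/funext => k; apply/funext => l; rewrite /chom; case: ifP.
have cD t1 t2 : chom i j (t1 + t2 : tensor D D) = fun k l => chom i j t1 k l + chom i j t2 k l.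
  by apply/funext => k; apply/funext => l; rewrite /chom; case: ifP; rewrite ?addr0.
elim: s Hs => [|q s IHs] Hs; first by rewrite !big_nil c0 iota_zero mulr0 mul0r.
have {}IHs := IHs (fun z zs => Hs z (mem_behead (s := q :: s) zs)).
have Hw z : z \in q :: s -> tspan (G i) (G j) (wt_tens z).
  by move=> /Hs[gx _ gy _]; exact: tspan_tens.
have Hw' z : z \in q :: s -> tspan (G i) (G j) (wt_conj K z).
  by move=> /Hs[gx wx gy wy]; exact: tspan_wt_conj.
have Hws : tspan (G i) (G j) (\sum_(z <- s) wt_tens z).
  by apply: tspan_sum => z zs; apply: Hw; rewrite inE zs orbT.
have Hws' : tspan (G i) (G j) (\sum_(z <- s) wt_conj K z).
  by apply: tspan_sum => z zs; apply: Hw'; rewrite inE zs orbT.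
have [gx wx gy wy] := Hs q (mem_head _ _).
rewrite !big_cons !cD !iotaD; try by apply: clt_chom; first
  [exact: Hws | exact: Hws' | exact: (Hw _ (mem_head _ _)) | exact: (Hw' _ (mem_head _ _))].
by rewrite mulrDr mulrDl IHs (R0_tens gx wx gy wy).
Qed.

End CartanConjugation.

(** * The two coproducts agree *)

Section Assembly.
Variables (R : realType) (D : algType R[i]) (G : int -> set D).
Variables (Delta : D -> ctens D) (eps : D -> R[i]).
Hypothesis DB : topological_bialgebra G Delta eps.
Variables (r : nat) (K : 'rV[int]_r -> D) (p : D -> D -> R[i]).
Variables (A A1 A2 A2' B B2 B1 B1' : set D) (R1 R2' : ctens D).
Hypothesis H : double_data G Delta eps K p A A1 A2 A2' B B2 B1 B1'
  (fun i => R1 i (- i)) (fun i => R2' i (- i)).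
Variables (lq : R[i]) (alpha : 'M[R[i]]_r).
Hypothesis alpha_unit : alpha \in unitmx.
Hypothesis p_alpha : forall i j,
  p (K (delta_mx 0 i)) (K (delta_mx 0 j)) = qpow lq (alpha i j).
Hypotheses (R1_cgt : cgt G A1 B2 R1) (R2'_clt : clt G A2' B1' R2').
Hypothesis R1_diag : forall n1 n2, n1 + n2 != 0 -> R1 n1 n2 = 0.
Hypothesis R2'_diag : forall n1 n2, n1 + n2 != 0 -> R2' n1 n2 = 0.
Variables (E : unitAlgType R[i]) (iota : ctens D -> E) (R0 : E).
Hypothesis X0 : q_r0_extension G K lq alpha iota R0.

Lemma diag_fam (X : ctens D) : (forall n1 n2, n1 + n2 != 0 -> X n1 n2 = 0) ->
  X = fam 0 (fun i => X i (- i)).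
Proof.
move=> X0'; apply/funext => i; apply/funext => j; rewrite /fam.
case: eqP => [e|/eqP/X0' //]; congr (X _ _); lia.
Qed.

Lemma Delta_fam n x : G n x -> Delta x = fam n (fun i => Delta x i (n - i)).
Proof.
move=> gx; apply/funext => i; apply/funext => j; rewrite /fam.
case: eqP => [e|ne]; first by congr (Delta _ _ _); lia.
by apply/eqP/negPn/negP => /(tb_degree DB gx).
Qed.

Lemma cflip_Delta_fam n x : G n x -> cflip (Delta x) = fam n (flipDelta Delta n x).
Proof.
move=> gx; rewrite {1}(Delta_fam gx); apply/funext => i; apply/funext => j.
rewrite /cflip /fam /flipDelta addrC; case: eqP => [e|_]; last by rewrite tflip0.
by congr (tflip (Delta _ _ _)); lia.
Qed.

(** Both equations hold in a completion where they make sense. Since R1 and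
    R2 are invertible, Y is then the value at x of both twisted coproducts. *)
Definition intertwines (x : D) := exists Y, [/\ calg G Y,
  cmul R1 Y = cmul (cflip (Delta x)) R1 &
  iota Y * (iota R2' * R0) = iota R2' * R0 * iota (Delta x)].

Let cR2 : clt G setT setT R2'.
Proof. exact: clt_sub R2'_clt. Qed.

(** Compatibility of the conjugation by R0 with infinite sums turns the
    componentwise conjugates of Delta(x) into R0 Delta(x) R0^-1. *)
Lemma intertwines_hom n x : G n x ->
  intertwiner G Delta K p (fun i => R1 i (- i)) (fun i => R2' i (- i)) n x -> intertwines x.
Proof.
move=> gx [X [tw [Xs [s Hs] Xw X1 X2]]]; exists (fam n X).
have aX : calg G (fam n X).
  split=> [i j|].
    rewrite /fam; case: eqP => [e|_]; last exact: tspan0.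
    have -> : j = n - i by lia.
    by apply: tspan_sub (Xs i).
  exists [seq (i, n - i) | i <- s] => i j; rewrite /fam; case: (i + j =P n) => [e|_].
    move=> h; have si := Hs _ h.
    by apply/mapP; exists i => //; congr pair; lia.
  by rewrite eqxx.
have cD := tb_clt DB x.
have cW : clt G setT setT (fam n tw).
  split=> [i j|].
    rewrite /fam; case: eqP => [e|_]; last exact: tspan0.
    have -> : j = n - i by lia.
    by apply: tspan_sub (wconj_span H (Xw i)).
  have [_ [c1 [c2 Hc]]] := cD; exists c1, c2 => i j; rewrite /fam.
  case: (i + j =P n) => [e|_]; last by rewrite eqxx.
  move=> ti; have -> : j = n - i by lia.
  apply: Hc; apply: contraNneq ti => d0.
  by have [q [_ _ _ ->]] := Xw i.
split=> //.
  rewrite {1}(diag_fam R1_diag) {2}(diag_fam R1_diag) (cflip_Delta_fam gx).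
  by rewrite !cmul_fam addr0 add0r; congr fam; apply/funext.
have e : cmul (fam n X) R2' = cmul R2' (fam n tw).
  rewrite (diag_fam R2'_diag) !cmul_fam addr0 add0r; congr fam; exact/funext.
have cX := calg_clt aX.
rewrite mulrA -(ext_mul X0 cX cR2) e (ext_mul X0 cR2 cW) -!mulrA; congr (_ * _).
apply/esym; apply: (ext_continuous X0) => // i j.
have [ij|ij] := eqVneq (i + j) n.
  have -> : j = n - i by lia.
  by rewrite /fam (_ : i + (n - i) == n) ?(R0_wconj H alpha_unit p_alpha X0 (Xw i)) //; lia.
have c0 : chom i j (0 : tensor D D) = fun _ _ => 0.
  by apply/funext => k; apply/funext => l; rewrite /chom; case: ifP.
by rewrite (Delta_fam gx) /fam (negbTE ij) c0 (iota_zero X0) mulr0 mul0r.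
Qed.

Lemma intertwines_subsp : subsp intertwines.
Proof.
have D0 : Delta 0 = fun _ _ => 0.
  apply/funext => i; apply/funext => j.
  by have [-> _ _] := linP (tb_linear DB i j).
have gR1 := cgt_gt_bounded R1_cgt.
split.
  exists (fun _ _ => 0); split.
  - by split=> [i j|]; [exact: tspan0|exists [::] => i j; rewrite eqxx].
  - rewrite D0; apply/funext => i; apply/funext => j; rewrite /cmul /cflip !fsum0 //.
      by move=> l; rewrite tflip0 tmul0t.
    by move=> l; rewrite tmult0.
  - by rewrite D0 (iota_zero X0) mulr0 mul0r.
move=> c x y [X [aX X1 X2]] [Y [aY Y1 Y2]].
exists (fun i j => c *: X i j + Y i j); split; first exact: (calg_lin (dG H)).
  have gX := calg_gt_bounded aX; have gY := calg_gt_bounded aY.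
  rewrite cmul_linr ?X1 ?Y1 //.
  rewrite -cmul_linl //; try exact: clt_gt_bounded_cflip (tb_clt DB _).
  congr (cmul _ _); apply/funext => i; apply/funext => j.
  by rewrite /cflip (tb_linear DB) tflip_lin.
have -> : Delta (c *: x + y) = fun i j => c *: Delta x i j + Delta y i j.
  by apply/funext => i; apply/funext => j; rewrite (tb_linear DB).
rewrite !(ext_linear X0); try exact: calg_clt; try exact: (tb_clt DB _).
by rewrite mulrDl mulrDr -scalerAl X2 Y2 scalerAr.
Qed.

(** Delta is an algebra morphism, so the product of two solutions is a
    solution. *)
Lemma intertwines_mul x y : intertwines x -> intertwines y -> intertwines (x * y).
Proof.
move=> [X [aX X1 X2]] [Y [aY Y1 Y2]].
have gR1 := cgt_gt_bounded R1_cgt.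
have gX := calg_gt_bounded aX; have gY := calg_gt_bounded aY.
have gx : gt_bounded (cflip (Delta x)) by exact: clt_gt_bounded_cflip (tb_clt DB _).
have gy : gt_bounded (cflip (Delta y)) by exact: clt_gt_bounded_cflip (tb_clt DB _).
exists (cmul X Y); split; first exact: (calg_cmul (dGM H) aX aY).
  by rewrite (tb_mul DB) cflip_cmul cmulA // X1 -!cmulA // Y1.
have cX := calg_clt aX; have cY := calg_clt aY.
rewrite (tb_mul DB) (ext_mul X0 cX cY) (ext_mul X0 (tb_clt DB x) (tb_clt DB y)).
by rewrite -(mulrA (iota X)) Y2 mulrA X2 -mulrA.
Qed.

Lemma intertwines_product (S T U : set D) : S `<=` intertwines -> T `<=` intertwines ->
  @tmulr _ D @` tspan S T = U -> U `<=` intertwines.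
Proof.
move=> Sg Tg <- _ [t ts <-].
apply: tlift_subsp ts; first exact: (bil_mul (@lin_id _ _) (@lin_id _ _)).
  exact: intertwines_subsp.
by move=> x y /Sg ? /Tg ?; exact: intertwines_mul.
Qed.

Lemma intertwines_graded (S : set D) : graded_dec G S ->
  (forall n x, S x -> G n x -> intertwines x) ->
  S `<=` intertwines.
Proof.
move=> gS Sg x /gS[s [f [Hf ->]]]; apply: subsp_sum => [|n _]; first exact: intertwines_subsp.
by have [? ?] := Hf n; apply: (Sg n).
Qed.

Lemma intertwines_A1 n x : A1 x -> G n x -> intertwines x.
Proof. by move=> Ax gx; apply: (intertwines_hom gx); exact: (intertwiner_A1 H). Qed.

Lemma intertwines_A2 n x : A2 x -> G n x -> intertwines x.
Proof.
apply: (dA2_ind H); first exact: intertwines_subsp.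
move=> a u Aa ga; have gau : G n (a * K u).
  by rewrite -(addr0 n); exact: (dGM H ga (dKG H u)).
apply: (intertwines_hom gau); apply: (intertwiner_A2 H _ gau (rwA2 H u Aa)).
by case: (dA2M H) => _; apply; [exact: (dA2'A H)|exact: (dKA H)].
Qed.

Let H' := double_swap H.

(** From the case of A1 by the symmetry of the double; the degree of x
    changes sign. *)
Lemma intertwines_B2 n x : B2 x -> G n x -> intertwines x.
Proof.
move=> Bx gx; apply: (intertwines_hom gx); apply: (intertwiner_swap H).
by apply: (intertwiner_A1 H') => //; rewrite /swG opprK.
Qed.

Lemma intertwines_B1 n x : B1 x -> G n x -> intertwines x.
Proof.
apply: (dB1_ind H); first exact: intertwines_subsp.
move=> b u Bb gb; have gbu : G n (b * K u).
  by rewrite -(addr0 n); exact: (dGM H gb (dKG H u)).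
apply: (intertwines_hom gbu); apply: (intertwiner_swap H).
apply: (intertwiner_A2 H' _ _ (rwA2 H' u Bb)); last by rewrite /swG opprK.
by case: (dB1M H) => _; apply; [exact: (dB1'B H)|exact: (dKB H)].
Qed.

Lemma intertwines_all : graded_dec G A1 -> graded_dec G A2 -> graded_dec G B1 -> graded_dec G B2 ->
  @tmulr _ D @` tspan A1 A2 = A -> @tmulr _ D @` tspan B2 B1 = B ->
  @tmulr _ D @` tspan A B = setT -> forall x, intertwines x.
Proof.
move=> gA1 gA2 gB1 gB2 eA eB eD x; apply: (intertwines_product _ _ eD) => //.
  exact: (intertwines_product (intertwines_graded gA1 intertwines_A1)
    (intertwines_graded gA2 intertwines_A2) eA).
exact: (intertwines_product (intertwines_graded gB2 intertwines_B2)
  (intertwines_graded gB1 intertwines_B1) eB).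
Qed.

End Assembly.

Theorem theorem2 (R : realType)
  (* (i) *)
  (D : algType R[i]) (G : int -> set D)
  (DeltaD : D -> ctens D) (epsD : D -> R[i])
  (D_bialgebra : topological_bialgebra G DeltaD epsD)
  (* (ii) *)
  (r : nat) (K : 'rV[int]_r -> D)
  (K_embedding : group_algebra_embedding G K DeltaD epsD)
  (A B : set D)
  (A_subbialgebra : subbialgebra G DeltaD A)
  (B_subbialgebra : subbialgebra G DeltaD B)
  (K_sub_A : group_algebra K `<=` A) (K_sub_B : group_algebra K `<=` B)
  (AB_iso : balanced_product_iso K A B)
  (p : D -> D -> R[i])
  (p_pairing : bialgebra_pairing G DeltaD epsD A B p)
  (* (iii) *)
  (A1 A2 B1 B2 : set D)
  (A1_graded : graded_subalgebra G A1) (A1_sub : A1 `<=` A)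
  (A2_graded : graded_subalgebra G A2) (A2_sub : A2 `<=` A)
  (B1_graded : graded_subalgebra G B1) (B1_sub : B1 `<=` B)
  (B2_graded : graded_subalgebra G B2) (B2_sub : B2 `<=` B)
  (A1_degrees : forall n, n < 0 -> A1 `&` G n `<=` [set 0])
  (A2_degrees : forall n, 0 < n -> A2 `&` G n `<=` [set 0])
  (B1_degrees : forall n, n < 0 -> B1 `&` G n `<=` [set 0])
  (B2_degrees : forall n, 0 < n -> B2 `&` G n `<=` [set 0])
  (A_iso : product_iso A1 A2 A) (B_iso : product_iso B2 B1 B)
  (* (iv) *)
  (A1_Delta : forall x, A1 x -> clt G A A1 (DeltaD x))
  (A2_Delta : forall x, A2 x -> clt G A2 A (DeltaD x))
  (B1_Delta : forall x, B1 x -> clt G B B1 (DeltaD x))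
  (B2_Delta : forall x, B2 x -> clt G B2 B (DeltaD x))
  (p_factor : forall a1 a2 b1 b2, A1 a1 -> A2 a2 -> B1 b1 -> B2 b2 ->
     p (a1 * a2) (b2 * b1) = p a1 b2 * p a2 b1)
  (* (v) *)
  (A2_degree0 : A2 `&` G 0 = group_algebra K)
  (B1_degree0 : B1 `&` G 0 = group_algebra K)
  (A1_degree0 : A1 `&` G 0 = [set c%:A | c in [set: R[i]]])
  (B2_degree0 : B2 `&` G 0 = [set c%:A | c in [set: R[i]]])
  (A2' B1' : set D)
  (A2'_graded : graded_subalgebra G A2') (A2'_sub : A2' `<=` A2)
  (B1'_graded : graded_subalgebra G B1') (B1'_sub : B1' `<=` B1)
  (A2_iso : product_iso A2' (group_algebra K) A2)
  (B1_iso : product_iso B1' (group_algebra K) B1)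
  (A1_finite : forall n, finite_dim (A1 `&` G n))
  (A2'_finite : forall n, finite_dim (A2' `&` G n))
  (B1'_finite : forall n, finite_dim (B1' `&` G n))
  (B2_finite : forall n, finite_dim (B2 `&` G n))
  (* (vi) *)
  (q lq : R[i]) (q_neq0 : q != 0) (lq_log : cexp lq = q)
  (alpha : 'M[R[i]]_r) (alpha_nondegenerate : alpha \in unitmx)
  (p_alpha : forall i j,
     p (K (delta_mx 0 i)) (K (delta_mx 0 j)) = qpow lq (alpha i j))
  (p_factor2 : forall a a0 b b0,
     A2' a -> (A2 `&` G 0) a0 -> B1' b -> (B1 `&` G 0) b0 ->
     p (a * a0) (b * b0) = p a b * p a0 b0)
  (p1_nondegenerate : graded_nondegenerate G p A1 B2)
  (p2'_nondegenerate : graded_nondegenerate G p A2' B1')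
  (* R1 and its inverse, R2', R0 and R2 = R2' R0 *)
  (R1 R1inv : ctens D)
  (R1_cgt : cgt G A1 B2 R1) (R1_tensor : pairing_tensor G p A1 B2 R1)
  (R1inv_cgt : cgt G setT setT R1inv) (R1_inverse : cinverse R1 R1inv)
  (R2' R2'inv : ctens D)
  (R2'_clt : clt G A2' B1' R2') (R2'_tensor : pairing_tensor G p A2' B1' R2')
  (R2'inv_clt : clt G setT setT R2'inv) (R2'_inverse : cinverse R2' R2'inv)
  (E : unitAlgType R[i]) (iota : ctens D -> E) (R0 : E)
  (R0_extension : q_r0_extension G K lq alpha iota R0) :
  let R2 := iota R2' * R0 in
  let Delta x := R2 * iota (DeltaD x) * R2^-1 in
  let tDelta x := cmul R1inv (cmul (cflip (DeltaD x)) R1) in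
  forall x, exists Y : ctens D,
    [/\ calg G Y, Delta x = iota Y & tDelta x = Y].
Proof.
move=> R2 Delta tDelta x.
have H := double_of_bialgebra D_bialgebra K_embedding A_subbialgebra B_subbialgebra
  p_pairing A1_graded A2_graded B1_graded B2_graded A2'_graded B1'_graded
  A1_sub A2_sub A2'_sub B1_sub B2_sub B1'_sub A1_degrees A2_degrees B1_degrees
  B2_degrees A_iso B_iso A2_iso B1_iso A1_Delta A2_Delta B1_Delta B2_Delta
  p_factor A2_degree0 B1_degree0 p_factor2 R1_cgt.1 R1_tensor R2'_clt.1 R2'_tensor.
have [R1_diag _ _] := R1_tensor; have [R2_diag _ _] := R2'_tensor.
have [Y [aY Y1 Y2]] := intertwines_all D_bialgebra H alpha_nondegenerate p_alpha R1_cgt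
  R2'_clt R1_diag R2_diag R0_extension A1_graded.2.2 A2_graded.2.2
  B1_graded.2.2 B2_graded.2.2 A_iso.1 B_iso.1 AB_iso.1 x.
exists Y; split=> //.
  have uR2 : R2 \is a GRing.unit.
    rewrite unitrMl ?(ext_unit R0_extension) //; apply/unitrP; exists (iota R2'inv).
    have cR2 : clt G setT setT R2' by exact: clt_sub R2'_clt.
    rewrite -!(ext_mul R0_extension) //; case: R2'_inverse => -> ->.
    by rewrite (ext_one R0_extension).
  by rewrite /Delta -Y2 mulrK.
rewrite /tDelta -Y1 cmulA; [|exact: cgt_gt_bounded R1inv_cgt|exact: cgt_gt_bounded R1_cgt|exact: calg_gt_bounded aY].
by case: R1_inverse => _ ->; rewrite cmul1.
Qed.
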